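(* There are universal constants $C,C'>0$ such that the following holds. Suppose $\mathcal M$ is a finite model class with $M_\star\in\mathcal M$, and $\delta\in(0,1/2)$; the number of rounds $T$ need not be known. Run the algorithm LOLIPOP (defined in the context) for $T$ rounds with epoch schedule $\tau_m=2^m$ for $m\ge1$, and with the maximum likelihood oracle $\mathsf{MLE}_{\mathcal M}$ as its offline density estimation oracle. Then its policies $\{\pi_t\}_{t\in[T]}$ satisfy, with probability at least $1-\delta$, $$\mathrm{Reg}(T)\le C\sqrt{H^7S^4A^3\,T\cdot\log\big(|\mathcal M|\log T/\delta\big)},$$ and the algorithm makes at most $C'H\log T$ calls to $\mathsf{MLE}_{\mathcal M}$.
   Context: **Setting.** A contextual MDP (CMDP) of horizon $H$ has a context space $\mathcal C$, finite state and action spaces $\mathcal S,\mathcal A$ with $S=|\mathcal S|$, $A=|\mathcal A|$, a fixed initial state $s^1\in\mathcal S$, and a model $M=\{P_M^h,R_M^h\}_{h\in[H]}$ with transition kernels $P_M^h(\cdot\mid s,a;c)\in\Delta(\mathcal S)$ and reward distributions $R_M^h(s,a;c)\in\Delta([0,1])$. $\Pi_{\mathrm{RNS}}$ is the set of policies $\pi=(\pi^1,\dots,\pi^H)$, $\pi^h:\mathcal S\to\Delta(\mathcal A)$; $\pi^h(s,a)$ is the probability of $a$ at $s$. For a model $M$, policy $\pi$, context $c$, $M(\pi,c)$ is the law of the trajectory $(s_1^1,a_1^1,r_1^1,\dots,s_1^H,a_1^H,r_1^H)$ with $s_1^1=s^1$, $a_1^h\sim\pi^h(s_1^h)$, $r_1^h\sim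 R_M^h(s_1^h,a_1^h;c)$, $s_1^{h+1}\sim P_M^h(\cdot\mid s_1^h,a_1^h;c)$; $\mathbb E^{M,\pi,c}$ is its expectation. The true model is $M_\star=\{P_\star^h,R_\star^h\}$. In each round $t=1,\dots,T$: $c_t\sim\mathcal D$ i.i.d. (with $\mathcal D$ unknown), the learner sees $c_t$, chooses $\pi_t\in\Pi_{\mathrm{RNS}}$ and observes a trajectory drawn from $M_\star(\pi_t,c_t)$. The total reward $\sum_{h}r^h$ lies in $[0,1]$ almost surely. The learner is given a class $\mathcal M$ of models with $M_\star\in\mathcal M$ (realizability). **Regret.** $V_\star^1(\pi,c)=\mathbb E^{M_\star,\pi,c}[\sum_{h=1}^H r_1^h]$, $V_\star^1(c)=\max_\pi V_\star^1(\pi,c)$, $\mathrm{reg}(\pi,c)=V_\star^1(c)-V_\star^1(\pi,c)$, and $\mathrm{Reg}(T)=\sum_{t=1}^T\mathbb E_t[\mathrm{reg}(\pi_t,c_t)]$, where $\mathbb E_t$ is conditional expectation given the interaction before round $t$. **Offline oracle.** $D_{\mathrm H}^2(\mathbb P,\mathbb Q)=\frac12\int(\sqrt{d\mathbb P/d\nu}-\sqrt{d\mathbb Q/d\nu})^2d\nu$ is the squared Hellinger distance. An offline density estimation oracle for $\mathcal M$ with error function $\mathcal E_{\mathcal M,\delta}(n)$ takes $n$ i.i.d. samples $(c_i,\pi_i,\text{trajectory}_i)$, with $c_i\sim\mathcal D$, $\pi_i\sim p(c_i)$ for a kernel $p:\mathcal C\to\Delta(\Pi_{\mathrm{RNS}})$,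 and trajectory drawn from $M_\star(\pi_i,c_i)$, and returns a model $\widehat M$ such that, for any $\delta\in(0,1/2)$, with probability at least $1-\delta$, $\mathbb E_{c\sim\mathcal D,\pi\sim p(c)}[D_{\mathrm H}^2(\widehat M(\pi,c),M_\star(\pi,c))]\le\mathcal E_{\mathcal M,\delta}(n)$. $\mathsf{MLE}_{\mathcal M}$ returns a maximizer over $M\in\mathcal M$ of the likelihood of the observed trajectories given $(c_i,\pi_i)$; for finite $\mathcal M$ it is an oracle with $\mathcal E_{\mathcal M,\delta}(n)=C_0\log(|\mathcal M|/\delta)/n$ for a universal constant $C_0$. Convention: $\mathcal E_{\mathcal M,\delta}(0)=1$. **Algorithm LOLIPOP.** Input: schedule $0=\tau_{-1}=\tau_0<\tau_1<\dots<\tau_N=T/H$, $\delta\in(0,1/2)$, $\mathcal M$, an oracle. (A prescribed formula for $\tau_m$ is truncated: $N$ is the least $m$ for which the formula is at least $T/H$, and $\tau_N=T/H$; integer rounding is ignored.) Epoch $m$ consists of segments $h=1,\dots,H$; segment $h$ consists of the rounds $\tau_{m-1}H+(\tau_m-\tau_{m-1})(h-1)<t\le\tau_{m-1}H+(\tau_m-\tau_{m-1})h$. Initially $\widehat M_0=\{\widehat P_0^h,\widehat R_0^h\}_h$ with arbitrary kernels and zero rewards. In epoch $m$ set $$\mathcal E_m=\mathcal E_{\mathcal M,\delta/(2N^2)}(\tau_{m-1}-\tau_{m-2}),\quad \gamma_m=\sqrt{H^6S^4A^3/\mathcal E_m},\quad \eta_m=\frac{\gamma_m}{720e^3H^5S^3A^2},\quad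 \zeta_m=\frac{\gamma_m}{8eH(H+1)^2}.$$ Let $\widehat V^1_{m-1}(\pi,c)$ be the value of $\pi$ under context $c$ in the model $\widehat M_{m-1}$, $\widehat\pi_{m-1,c}\in\arg\max_\pi\widehat V^1_{m-1}(\pi,c)$, and $\widehat{\mathrm{reg}}_{m-1}(\pi,c)=\max_{\pi'}\widehat V^1_{m-1}(\pi',c)-\widehat V^1_{m-1}(\pi,c)$. Trusted occupancy measures $\widetilde d$ and trusted transitions $\widetilde{\mathcal T}$ are defined recursively in $h$: $\widetilde d_m^1(s;\pi,c)=\mathbb 1(s=s^1)$; for $h\ge2$, $\widetilde d_m^h(s;\pi,c)=\sum_{(s',a'):(s',a',s)\in\widetilde{\mathcal T}_m^{h-1}(c)}\widetilde d_m^{h-1}(s',a';\pi,c)\widehat P_m^{h-1}(s\mid s',a';c)$; $\widetilde d_m^h(s,a;\pi,c)=\widetilde d_m^h(s;\pi,c)\pi^h(s,a)$; and $$\widetilde{\mathcal T}_m^h(c)=\Big\{(s,a,s'):\max_\pi\frac{\widetilde d_m^h(s,a;\pi,c)}{SA+\eta_m\widehat{\mathrm{reg}}_{m-1}(\pi,c)}\,\widehat P_m^h(s'\mid s,a;c)\ge\frac1{\zeta_m}\Big\}.$$ In segment $h$ of epoch $m$, upon observing $c_t=c$: for each $(s,a)$ let $\pi_{m,c}^{h,s,a}\in\arg\max_\pi\frac{\widetilde d_m^h(s,a;\pi,c)}{SA+\eta_m\widehat{\mathrm{reg}}_{m-1}(\pi,c)}$; let $\Pi_m^h(c)=\{\widehat\pi_{m-1,c}\}\cup\{\pi_{m,c}^{h,s,a}\}_{s,a}$;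 let $p_m^h(c)$ be the distribution on $\Pi_m^h(c)$ with $p_m^h(c,\pi)=1/(\lambda_{m,c}^h+\eta_m\widehat{\mathrm{reg}}_{m-1}(\pi,c))$, where $\lambda_{m,c}^h$ is the normalizing constant; sample and execute $\pi_t\sim p_m^h(c)$. At the end of segment $h$, call the oracle on the data $(c_t,\pi_t,\text{trajectory}_t)$ of this segment, and let $\widehat P_m^h,\widehat R_m^h$ be the layer-$h$ part of its output. At the end of the epoch set $\widehat M_m=\{\widehat P_m^h,\widehat R_m^h\}_{h\in[H]}$. $T$ is assumed large enough that $\log T\ge1$. *)

(* Defs.v *)
From HB Require Import structures.
From mathcomp Require Import all_boot all_order all_algebra.
From mathcomp Require Import all_classical all_reals all_analysis.
From mathcomp Require Import measurable_realfun.

Set Implicit Arguments.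
Unset Strict Implicit.
Unset Printing Implicit Defensive.

Import Order.TTheory GRing.Theory Num.Theory.

Local Open Scope classical_set_scope.
Local Open Scope ring_scope.

(* Nonempty finite types; mathcomp-analysis requires measurable types, such as
   the type of policies below, to be pointed. *)
#[short(type="pfinType")]
HB.structure Definition PointedFinite := {T of isPointed T & Finite T}.

Section conditioning.
Context {R : realType} {d : measure_display} {Omega : measurableType d}.
Variables (P : probability Omega R) (G : set (set Omega)).

(* kappa is a regular conditional distribution of X given the sigma-algebra
   generated by G. *)
Definition cond_law d' (E : measurableType d') (X : Omega -> E)
    (kappa : Omega -> set E -> \bar R) : Prop :=
  forall B, measurable B ->
    measurable_fun [set: g_sigma_algebraType G] (fun w => kappa w B) /\
    forall F, <<s G >> F ->
      P (F `&` X @^-1` B) = (\int[P]_(w in F) kappa w B)%E.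

(* Y is a version of the conditional expectation of X given the sigma-algebra
   generated by G. *)
Definition is_cond_exp (X Y : Omega -> R) : Prop :=
  [/\ measurable_fun [set: g_sigma_algebraType G] Y,
      P.-integrable setT (EFin \o Y) &
      forall F, <<s G >> F ->
        (\int[P]_(w in F) (Y w)%:E = \int[P]_(w in F) (X w)%:E)%E].

End conditioning.

Section policies.
Variables (R : realType) (S : finType) (A : pfinType) (H : nat).

Definition is_policy (f : {ffun 'I_H * S * A -> R}) : bool :=
  [forall h : 'I_H, forall s : S,
    [forall a : A, 0 <= f (h, s, a)] && (\sum_(a : A) f (h, s, a) == 1)].

Record policy := Policy { pol_val : {ffun 'I_H * S * A -> R} ;
                          _ : is_policy pol_val }.

HB.instance Definition _ := [isSub for pol_val].
HB.instance Definition _ := [Choice of policy by <:].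

Definition pol_prob (p : policy) (h : 'I_H) (s : S) (a : A) : R :=
  pol_val p (h, s, a).

Lemma is_policy_default : is_policy [ffun x => (x.2 == point)%:R].
Proof.
apply/forallP => h; apply/forallP => s; apply/andP; split.
  by apply/forallP => a; rewrite ffunE ler0n.
rewrite (bigD1 point) //= ffunE eqxx big1 ?addr0 // => a /negbTE aN.
by rewrite ffunE /= aN.
Qed.

HB.instance Definition _ := isPointed.Build policy (Policy is_policy_default).

(* The sigma-algebra on policies is generated by the action probabilities. *)
Definition policy_gen : set (set policy) :=
  [set U | exists h s a (B : set R),
     measurable B /\ U = [set p | pol_prob p h s a \in B]].

HB.instance Definition _ :=
  Measurable.copy policy (g_sigma_algebraType policy_gen).

End policies.
Arguments pol_prob {R S A H} p h s a.

Section trajectories.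
Variables (R : realType) (S A : finType).

(* (s^1, a^1, r^1), ..., (s^H, a^H, r^H); the laws defined below are
   supported by sequences of length H. *)
Definition trajectory := seq (S * A * R).

HB.instance Definition _ := Choice.on trajectory.
HB.instance Definition _ := isPointed.Build trajectory [::].

Definition trajectory_gen : set (set trajectory) :=
  [set W | exists k s a (B : set R), measurable B /\
     W = [set x | exists2 r, B r & onth x k = Some (s, a, r)]].

HB.instance Definition _ :=
  Measurable.copy trajectory (g_sigma_algebraType trajectory_gen).

Definition total_reward (x : trajectory) : R := \sum_(y <- x) y.2.

End trajectories.

Section models.
Context {R : realType} {d : measure_display}.
Variables (X : measurableType d) (S A : pfinType).

(* One layer of a model: the transitions P(s' | s, a; c) and the reward
   distributions R(s, a; c) of a layer h. *)
Record layer := Layer {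
  trans : S -> A -> X -> S -> R ;
  rew : S -> A -> R.-pker X ~> R ;
  trans_ge0 : forall s a c s', 0 <= trans s a c s' ;
  trans_sum1 : forall s a c, \sum_(s' : S) trans s a c s' = 1 ;
  trans_meas : forall s a s', measurable_fun setT (fun c => trans s a c s') ;
  rew01 : forall s a c, rew s a c `[0, 1]%classic = 1%E }.

Variables (H : nat) (s1 : S).
Definition model := 'I_H -> layer.

Local Notation policy := (policy R S A H).
Local Notation trajectory := (trajectory R S A).

(* Expectation of f over the trajectory obtained by running p in M over the
   layers hs from the state s, the steps already made being x. The state
   following the last layer is drawn but not recorded. *)
Fixpoint expect_from (M : model) (p : policy) (c : X) (f : trajectory -> \bar R)
    (hs : seq 'I_H) (s : S) (x : trajectory) : \bar R :=
  if hs is h :: hs' then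
    (\sum_(a : A) (pol_prob p h s a)%:E *
       \int[rew (M h) s a c]_r
         \sum_(s' : S) (trans (M h) s a c s')%:E *
            expect_from M p c f hs' s' (rcons x (s, a, r)))%E
  else f x.

Definition expect M p c f := expect_from M p c f (enum 'I_H) s1 [::].

Definition traj_law M p c (W : set trajectory) : \bar R :=
  expect M p c (fun x => (\1_W x)%:E).

Definition value M p c : R := fine (expect M p c (fun x => (total_reward x)%:E)).

Definition opt_value M c : R := sup (range (fun p => value M p c)).

Definition regret M p c : R := opt_value M c - value M p c.

Definition is_optimal M p c : Prop := forall q, value M q c <= value M p c.

(* Likelihoods are taken with respect to arbitrary kernels [base] dominating
   the reward distributions of a class of models; every finite class is
   dominated by the sum of its reward kernels. *)
Record densities (I : finType) (Ms : I -> model) := Densities {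
  base : 'I_H -> S -> A -> R.-sfker X ~> R ;
  dens : I -> 'I_H -> S -> A -> X -> R -> R ;
  dens_ge0 : forall i h s a c r, 0 <= dens i h s a c r ;
  dens_meas : forall i h s a,
    measurable_fun setT (fun cr : X * R => dens i h s a cr.1 cr.2) ;
  densE : forall i h s a c (B : set R), measurable B ->
    rew (Ms i h) s a c B = (\int[base h s a c]_(r in B) (dens i h s a c r)%:E)%E
}.

Section likelihood.
Variables (I : finType) (Ms : I -> model) (f : densities Ms).

Fixpoint traj_dens_from (i : I) (p : policy) (c : X) (hs : seq 'I_H) (s : S)
    (x : trajectory) : R :=
  match hs, x with
  | [::], [::] => 1
  | h :: hs', (s', a, r) :: x' =>
      (s' == s)%:R * pol_prob p h s a * dens f i h s a c r *
      (if x' is (s'', _, _) :: _ then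
         trans (Ms i h) s a c s'' * traj_dens_from i p c hs' s'' x'
       else (hs' == [::])%:R)
  | _, _ => 0
  end.

(* Density of M_i(p, c) with respect to the measure integrated by
   [base_int_from], the product over the layers of the counting measure on
   state-action pairs and of [base]. *)
Definition traj_dens i p c x := traj_dens_from i p c (enum 'I_H) s1 x.

Fixpoint base_int_from (c : X) (g : trajectory -> \bar R) (hs : seq 'I_H)
    (x : trajectory) : \bar R :=
  if hs is h :: hs' then
    (\sum_(s : S) \sum_(a : A) \int[base f h s a c]_r
       base_int_from c g hs' (rcons x (s, a, r)))%E
  else g x.

(* The squared Hellinger distance between M_i(p, c) and M_j(p, c). *)
Definition hellinger2 (i j : I) (p : policy) (c : X) : \bar R :=
  (2^-1%:E * base_int_from c (fun x =>
     ((Num.sqrt (traj_dens i p c x) - Num.sqrt (traj_dens j p c x)) ^+ 2)%:E)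
     (enum 'I_H) [::])%E.

End likelihood.
End models.
Arguments model R {d} X S A H.
Arguments expect {R d X S A H} s1 M p c f.
Arguments traj_law {R d X S A H} s1 M p c W.
Arguments value {R d X S A H} s1 M p c.
Arguments regret {R d X S A H} s1 M p c.

Section interaction.
Context {R : realType} {d dO : measure_display} {X : measurableType d}.
Context {S A : pfinType} {H : nat} {Omega : measurableType dO}.

Local Notation policy := (policy R S A H).
Local Notation trajectory := (trajectory R S A).

(* Contexts, executed policies and observed trajectories; rounds are numbered
   from 1. *)
Record process := Process {
  ctx : nat -> {mfun Omega >-> X} ;
  pol : nat -> {mfun Omega >-> policy} ;
  trj : nat -> {mfun Omega >-> trajectory} }.

Variables (P : probability Omega R) (D : probability X R) (s1 : S)
  (Mstar : model R X S A H) (Z : process).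

Definition sigma_ctx t := preimage_set_system setT (ctx Z t) measurable.
Definition sigma_pol t := preimage_set_system setT (pol Z t) measurable.
Definition sigma_trj t := preimage_set_system setT (trj Z t) measurable.

(* Generator of the sigma-algebra of the interaction up to the (real) time b. *)
Definition hist (b : R) : set (set Omega) :=
  \bigcup_(t in [set t : nat | (0 < t)%N /\ t%:R <= b])
     (sigma_ctx t `|` sigma_pol t `|` sigma_trj t).

(* In round t, c_t ~ D independently of the past, then pi_t ~ kappa(c_t), where
   kappa may depend on the past, then the trajectory is drawn from
   Mstar(pi_t, c_t). *)
Definition round (t : nat) (kappa : Omega -> X -> set policy -> \bar R) : Prop :=
  let past := hist t.-1%:R in
  [/\ cond_law P past (ctx Z t) (fun _ => D),
      cond_law P (past `|` sigma_ctx t) (pol Z t)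
        (fun w => kappa w (ctx Z t w)) &
      cond_law P (past `|` sigma_ctx t `|` sigma_pol t) (trj Z t)
        (fun w => traj_law s1 Mstar (pol Z t w) (ctx Z t w))].

(* i maximizes over the class the likelihood of the trajectories of the rounds
   ts, given the contexts and the policies. *)
Definition is_mle (I : finType) (Ms : I -> model R X S A H) (f : densities Ms)
    (ts : seq nat) (w : Omega) (i : I) : Prop :=
  let lik j :=
    \prod_(t <- ts) traj_dens s1 f j (pol Z t w) (ctx Z t w) (trj Z t w) in
  forall j, lik j <= lik i.

End interaction.
Arguments process R {d dO} X S A H Omega.

(* The error function of MLE for a class of K models, with E(0) = 1. *)
Definition mle_error (R : realType) (C0 : R) (K : nat) (delta n : R) : R :=
  if n == 0 then 1 else C0 * ln (K%:R / delta) / n.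

(* MLE is an offline density estimation oracle, with the above error function,
   for every finite class containing the true model. *)
Definition mle_is_oracle (R : realType) (C0 : R) : Prop :=
  forall (d dO : measure_display) (X : measurableType d) (S A : pfinType)
    (H : nat) (s1 : S) (D : probability X R)
    (I : finType) (Ms : I -> model R X S A H) (star : I) (f : densities Ms)
    (n : nat) (p : R.-pker X ~> policy R S A H)
    (Omega : measurableType dO) (P : probability Omega R)
    (Z : process R X S A H Omega) (est : Omega -> I) (delta : R),
    0 < delta < 2^-1 ->
    (forall t, (0 < t <= n)%N -> round P D s1 (Ms star) Z t (fun _ c => p c)) ->
    (forall i, measurable [set w | est w = i]) ->
    (forall w, is_mle s1 Z f (iota 1 n) w (est w)) ->
    ((1 - delta)%:E <= P [set w |
       (\int[D]_c \int[p c]_q hellinger2 s1 f (est w) star q c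
          <= (mle_error C0 #|I| delta n%:R)%:E)%E])%E.

Section schedule.
Variables (R : realType) (T H : nat).

(* N is the number of epochs of the schedule tau_m = 2^m truncated at T/H. *)
Definition epoch_count (N : nat) : Prop :=
  [/\ (0 < N)%N, (T%:R / H%:R : R) <= 2 ^+ N &
      forall m, (0 < m < N)%N -> (2 ^+ m : R) < T%:R / H%:R].

Definition tau (N m : nat) : R :=
  if m == 0%N then 0 else if (m < N)%N then 2 ^+ m else T%:R / H%:R.

(* Segment h of epoch m, for h = 0, ..., H - 1, consists of the rounds t with
   bound N m h < t <= bound N m h.+1. *)
Definition bound (N m h : nat) : R :=
  tau N m.-1 * H%:R + (tau N m - tau N m.-1) * h%:R.

Definition in_segment (N m h t : nat) : bool :=
  (bound N m h < t%:R) && (t%:R <= bound N m h.+1).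

Definition segment (N m h : nat) : seq nat :=
  [seq t <- iota 1 T | in_segment N m h t].

(* The pairs (m, h) such that the oracle is called at the end of segment h of
   epoch m. *)
Definition oracle_calls (N : nat) : seq (nat * 'I_H) :=
  [seq (m, h) | m <- iota 1 N, h <- enum 'I_H].

End schedule.

Section parameters.
Variables (R : realType) (C0 : R) (K S A T H N : nat) (delta : R) (m : nat).

(* Since m.-2 is 0 for m = 1, this uses tau_{-1} = tau_0 = 0. *)
Definition err_m : R :=
  mle_error C0 K (delta / (2 * N%:R ^+ 2))
    (tau R T H N m.-1 - tau R T H N m.-2).

Definition gamma_m : R :=
  Num.sqrt (H%:R ^+ 6 * S%:R ^+ 4 * A%:R ^+ 3 / err_m).

Definition eta_m : R :=
  gamma_m / (720 * expR 1 ^+ 3 * H%:R ^+ 5 * S%:R ^+ 3 * A%:R ^+ 2).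

Definition zeta_m : R :=
  gamma_m / (8 * expR 1 * H%:R * (H%:R + 1) ^+ 2).

End parameters.

Section exploration.
Context {R : realType} {d : measure_display} {X : measurableType d}.
Context {S A : pfinType} {H : nat}.
Variables (s1 : S) (eta zeta : R).
(* Mprev is the model estimated in the previous epoch, Mcur the one of the
   current epoch; segment h only uses the layers of Mcur before h. *)
Variables (Mprev Mcur : model R X S A H) (c : X).

Local Notation policy := (policy R S A H).

Definition denominator (p : policy) : R :=
  (#|S| * #|A|)%:R + eta * regret s1 Mprev p c.

Definition ratio (dt : policy -> S -> R) (h : 'I_H) (s : S) (a : A) (p : policy)
    : R := dt p s * pol_prob p h s a / denominator p.

(* Given the trusted occupancy measures dt of the states of layer h: trusted
   transitions of layer h, and trusted occupancy measures of the next layer. *)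
Definition trusted (dt : policy -> S -> R) (h : 'I_H) (s : S) (a : A) (s' : S)
    : bool :=
  `[< zeta^-1 <= sup (range (ratio dt h s a)) * trans (Mcur h) s a c s' >].

Definition next_occupancy (dt : policy -> S -> R) (h : 'I_H) : policy -> S -> R :=
  fun p s => \sum_(sa : S * A | trusted dt h sa.1 sa.2 s)
    dt p sa.1 * pol_prob p h sa.1 sa.2 * trans (Mcur h) sa.1 sa.2 c s.

Definition occupancy (h : 'I_H) : policy -> S -> R :=
  foldl next_occupancy (fun _ s => (s == s1)%:R) (take h (enum 'I_H)).

Definition is_explorer (h : 'I_H) (s : S) (a : A) (p : policy) : Prop :=
  forall q, ratio (occupancy h) h s a q <= ratio (occupancy h) h s a p.

(* Inverse gap weighting on a set of policies, given without repetition. *)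
Definition igw (lam : R) (p : policy) : R := (lam + eta * regret s1 Mprev p c)^-1.

Definition is_normalizer (ps : seq policy) (lam : R) : Prop :=
  0 < lam /\ \sum_(p <- ps) igw lam p = 1.

Definition igw_law (ps : seq policy) (lam : R) (U : set policy) : \bar R :=
  (\sum_(p <- ps) igw lam p * \1_U p)%:E.

End exploration.

Section lolipop.
Context {R : realType} {d dO : measure_display} {X : measurableType d}.
Context {S A : pfinType} {H : nat} {Omega : measurableType dO}.
Variables (C0 : R) (P : probability Omega R) (D : probability X R) (s1 : S).
Variables (I : finType) (Ms : I -> model R X S A H) (star : I)
  (f : densities Ms).
Variables (delta : R) (T N : nat) (Z : process R X S A H Omega).

Local Notation policy := (policy R S A H).

(* The choices left open by the description of the algorithm: the initial
   model, the output of the oracle at the end of each segment (the index of a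
   model of the class), the maximizing policies, and the normalizing
   constants. *)
Record choices := Choices {
  M0 : model R X S A H ;
  est : nat -> 'I_H -> Omega -> I ;
  greedy : nat -> Omega -> X -> policy ;
  explorer : nat -> 'I_H -> S -> A -> Omega -> X -> policy ;
  lam : nat -> 'I_H -> Omega -> X -> R }.

Variable L : choices.

(* The model estimated in epoch m; its layer h is the layer h of the output of
   the oracle at the end of segment h. *)
Definition Mhat (m : nat) (w : Omega) : model R X S A H :=
  if m == 0%N then M0 L else fun h => Ms (est L m h w) h.

Local Notation eta m := (eta_m C0 #|I| #|S| #|A| T H N delta m).
Local Notation zeta m := (zeta_m C0 #|I| #|S| #|A| T H N delta m).
Local Notation bound := (bound R T H N).

Definition policies (m : nat) (h : 'I_H) (w : Omega) (c : X) : seq policy :=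
  undup (greedy L m w c ::
         [seq explorer L m h sa.1 sa.2 w c | sa <- enum {: S * A}]).

(* The process Z is a run of the algorithm over T rounds. Everything the
   algorithm computes before a segment is a (measurable) function of the
   interaction before that segment. *)
Record lolipop_run : Prop := LolipopRun {
  run_epochs : epoch_count R T H N ;
  run_init : forall h s a c, rew (M0 L h) s a c [set 0] = 1%E ;
  run_est_meas : forall m (h : 'I_H) i, (0 < m <= N)%N ->
    <<s hist Z (bound m h.+1) >> [set w | est L m h w = i] ;
  run_est : forall m (h : 'I_H) w, (0 < m <= N)%N ->
    is_mle s1 Z f (segment R T H N m h) w (est L m h w) ;
  run_greedy_meas : forall m, (0 < m <= N)%N ->
    measurable_fun
      [set: (g_sigma_algebraType (hist Z (bound m 0)) * X)%type]
      (fun wc => greedy L m wc.1 wc.2) ;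
  run_greedy : forall m w c, (0 < m <= N)%N ->
    is_optimal s1 (Mhat m.-1 w) (greedy L m w c) c ;
  run_explorer_meas : forall m (h : 'I_H) s a, (0 < m <= N)%N ->
    measurable_fun
      [set: (g_sigma_algebraType (hist Z (bound m h)) * X)%type]
      (fun wc => explorer L m h s a wc.1 wc.2) ;
  run_explorer : forall m (h : 'I_H) s a w c, (0 < m <= N)%N ->
    is_explorer s1 (eta m) (zeta m) (Mhat m.-1 w) (Mhat m w) c h s a
      (explorer L m h s a w c) ;
  run_lam : forall m (h : 'I_H) w c, (0 < m <= N)%N ->
    is_normalizer s1 (eta m) (Mhat m.-1 w) c (policies m h w c) (lam L m h w c) ;
  run_round : forall m (h : 'I_H) t, (0 < m <= N)%N ->
    t \in segment R T H N m h ->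
    round P D s1 (Ms star) Z t (fun w c =>
      igw_law s1 (eta m) (Mhat m.-1 w) c (policies m h w c) (lam L m h w c)) }.

End lolipop.
Arguments choices R {d dO} X S A H Omega I.

(* Main.v *)
(* In a segment of n rounds let e be the mean squared Hellinger distance of the
   estimated model to the true one. The likelihood ratio of the maximizer is at
   least 1, and the square root of the ratio of a fixed model has conditional mean
   1 - e in each round; hence exp(n e) has mean at most |M|. Over the H segments of
   an epoch, all of n rounds, the sum of the errors is thus at most
   H log(2 |M| N^2 / delta) / n, outside an event whose probability is summed over
   the epochs only.

   Fix a context. The explorers of a layer dominate, up to a factor, the ratio of
   the trusted occupancy measures to SA + eta reg_{m-1}. As long as the errors of
   the layers are small, the trusted occupancy measures are at most twice the true
   ones, and a simulation argument bounds the difference of the estimated and true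
   values of a policy by 1/16 of its regret in the previous model plus an error
   linear in the estimation errors. So, by induction on m, true and estimated
   regrets are each at most twice the other plus z_m, where z_m is at most
   z_{m-1} / 4 plus such an error, and at least H in the contexts with large errors.
   Inverse gap weighting has estimated regret at most 2 SA / eta_m. With the
   parameters of the algorithm all these terms are of the order of
   sqrt(H^7 S^4 A^3 log(|M| N / delta) / t) at round t, which sums to the bound. *)

From HB Require Import structures.
Require Import Defs.
From mathcomp Require Import all_boot all_order all_algebra.
From mathcomp Require Import all_classical all_reals all_analysis.
From mathcomp Require Import measurable_realfun finmap ring lra zify.

Set Implicit Arguments.
Unset Strict Implicit.
Unset Printing Implicit Defensive.

Import Order.TTheory GRing.Theory Num.Theory.
Import numFieldNormedType.Exports.

Local Open Scope classical_set_scope.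
Local Open Scope ring_scope.

(** * Integrals and kernels *)

(** The oracle bounds the Hellinger error only on average over contexts, while policies are compared
    within one context. Every estimate in a fixed context is therefore kept linear in the error of
    that context, so that it can be integrated against [D]. The usual passage from Hellinger
    distance to differences of means costs a square root; it is replaced by a bound
    [x * gap + 2 / x] with [x] free, chosen at each state-action pair so that the gap ends up
    weighted by the occupancy of the explorers, along which there are data. Charging [H] to a
    context with a large error is linear as well, since that error exceeds a threshold. The
    explorers are chosen with estimated occupancies, but the data follow the true model. Discarding
    rare transitions reconciles the two: a trusted transition is visited often enough for its
    probability to be known up to a small relative error, and the discarded ones matter little for
    every policy. Policies depend on the past, but only on that before the segment. Within a segment
    they are drawn from one kernel, so the square roots of the likelihood ratios have a conditional
    mean that is the same in all rounds. *)

Section nonneg_measurable_induction.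
Local Open Scope ereal_scope.
Context d (T : measurableType d) (R : realType).
Variable Q : (T -> \bar R) -> Prop.
Implicit Types f g : T -> \bar R.

Hypothesis Qindic : forall A, measurable A -> Q (EFin \o \1_A).
Hypothesis Qscale : forall (k : R) f, (0 <= k)%R -> (forall x, 0 <= f x) ->
  measurable_fun setT f -> Q f -> Q (fun x => k%:E * f x).
Hypothesis Qadd : forall f g, (forall x, 0 <= f x) -> (forall x, 0 <= g x) ->
  measurable_fun setT f -> measurable_fun setT g -> Q f -> Q g ->
  Q (fun x => f x + g x).
Hypothesis Qlim : forall h : (T -> \bar R)^nat, (forall n x, 0 <= h n x) ->
  (forall n, measurable_fun setT (h n)) ->
  (forall x, nondecreasing_seq (h ^~ x)) -> (forall n, Q (h n)) ->
  Q (fun x => limn (h ^~ x)).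

Import HBNNSimple.

Lemma nonneg_measurable_ind f : (forall x, 0 <= f x) ->
  measurable_fun setT f -> Q f.
Proof.
move=> f0 mf; pose f_ := nnsfun_approx measurableT mf.
have -> : f = fun x => limn (fun n => (f_ n x)%:E).
  by apply/funext => x; apply/esym/cvg_lim => //; exact: cvg_nnsfun_approx.
apply: Qlim.
- by move=> n x; rewrite lee_fin.
- by move=> n; exact/measurable_EFinP.
- by move=> x m n mn; rewrite lee_fin; exact/lefP/nd_nnsfun_approx.
move=> n; set h := f_ n.
have -> : (fun x => (h x)%:E) =
    fun x => \sum_(r <- fset_set (range h)) (r * \1_(h @^-1` [set r]) x)%:E.
  by apply/funext => x; rewrite fimfunE fsbig_finite//= -sumEFin.
have Q0 : Q (fun=> 0).
  rewrite [X in Q X](_ : _ = EFin \o \1_set0); first exact: Qindic.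
  by apply/funext => x /=; rewrite indic0.
have mind r : measurable_fun setT (fun x => (r * \1_(h @^-1` [set r]) x)%:E).
  by apply/measurable_EFinP; exact: measurable_funM.
elim: (fset_set (range h) : seq R) => [|r s IH].
  by rewrite [X in Q X](_ : _ = fun=> 0)//; apply/funext => x; rewrite big_nil.
rewrite [X in Q X](_ : _ = fun x => (r * \1_(h @^-1` [set r]) x)%:E +
   \sum_(r <- s) (r * \1_(h @^-1` [set r]) x)%:E); last first.
  by apply/funext => x; rewrite big_cons.
apply: Qadd => //.
- by move=> x; rewrite EFinM nnfun_muleindic_ge0.
- by move=> x; apply: sume_ge0 => ? _; rewrite EFinM nnfun_muleindic_ge0.
- by under eq_fun do rewrite sumEFin -sumEFin; exact: emeasurable_sum.
(* The induction runs over an arbitrary list of reals, so [r] may be negative; it is then not a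
   value of [h] and its term vanishes. *)
have [r0|r0] := leP 0%R r.
  under eq_fun do rewrite EFinM; apply: Qscale => //; last exact: Qindic.
  by apply/measurable_EFinP.
rewrite [X in Q X](_ : _ = fun=> 0)//; apply/funext => x.
by rewrite preimage_nnfun0// indic0 mulr0.
Qed.

End nonneg_measurable_induction.

(** For indicators this is the hypothesis on [f], and the induction above does the rest. No
    sigma-finiteness of [nu] is involved, which suits the s-finite kernels [base]. *)
Lemma ge0_integral_density d (T : measurableType d) (R : realType)
    (mu nu : {measure set T -> \bar R}) (f : T -> R) (g : T -> \bar R) :
  (forall x, 0 <= f x) -> measurable_fun setT f ->
  (forall B, measurable B -> mu B = \int[nu]_(x in B) (f x)%:E)%E ->
  (forall x, 0 <= g x)%E -> measurable_fun setT g ->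
  (\int[mu]_x g x = \int[nu]_x ((f x)%:E * g x))%E.
Proof.
move=> f0 mf fE; move: g; have f0' x : (0 <= (f x)%:E)%E by rewrite lee_fin.
have mf' : measurable_fun setT (EFin \o f) by exact/measurable_EFinP.
apply: nonneg_measurable_ind.
- move=> A mA; rewrite integral_indic// setIT fE// integral_mkcond.
  apply: eq_integral => x _; rewrite /patch /= indicE.
  by case: ifPn => xA; rewrite ?mule1 ?mule0.
- move=> k g k0 g0 mg IH; rewrite ge0_integralZl// IH.
  rewrite -ge0_integralZl//; last 2 first.
    exact: emeasurable_funM.
    by move=> x _; rewrite mule_ge0.
  by apply: eq_integral => x _; rewrite muleCA.
- move=> g h g0 h0 mg mh IHg IHh; rewrite ge0_integralD// IHg IHh.
  rewrite -ge0_integralD//; last 4 first.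
  + by move=> x _; rewrite mule_ge0.
  + exact: emeasurable_funM.
  + by move=> x _; rewrite mule_ge0.
  + exact: emeasurable_funM.
  by apply: eq_integral => x _; rewrite ge0_muleDr.
- move=> h h0 mh ndh IH; rewrite monotone_convergence//.
  under [X in limn X]eq_fun do rewrite IH.
  rewrite -monotone_convergence//; last 3 first.
  + by move=> n; exact: emeasurable_funM.
  + by move=> n x _; rewrite mule_ge0.
  + by move=> x _ m n mn; rewrite lee_pmul//; exact: ndh.
  apply: eq_integral => x _; rewrite limeMl//; exact: ereal_nondecreasing_is_cvgn.
Qed.

Lemma integral_probability_cst d (T : measurableType d) (R : realType)
    (P : probability T R) (r : R) : (\int[P]_x r%:E = r%:E)%E.
Proof. by rewrite (integral_cst _ _ r%:E)// [X in (_ * X)%E]probability_setT mule1. Qed.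

Lemma integral_probability_le1 d (T : measurableType d) (R : realType)
    (P : probability T R) (g : T -> R) :
  measurable_fun setT g -> (forall x, 0 <= g x <= 1) ->
  (0 <= \int[P]_x (g x)%:E <= 1)%E.
Proof.
move=> mg g01; apply/andP; split.
  by apply: integral_ge0 => x _; rewrite lee_fin; case/andP: (g01 x).
rewrite -(integral_probability_cst P 1); apply: ge0_le_integral => //.
- by move=> x _; rewrite lee_fin; case/andP: (g01 x).
- exact/measurable_EFinP.
- by move=> x _; rewrite lee_fin; case/andP: (g01 x).
Qed.

Lemma measurable_kernel_integral d1 d2 d3 (T : measurableType d1)
    (X : measurableType d2) (Y : measurableType d3) (R : realType)
    (k : R.-pker (T * X) ~> Y) (g : Y * X -> \bar R) :
  (forall z, 0 <= g z)%E -> measurable_fun setT g ->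
  measurable_fun setT (fun wc => \int[k wc]_y g (y, wc.2))%E.
Proof.
move=> g0 mg; pose h (z : T * X * Y) := g (z.2, z.1.2).
apply: (measurable_fun_integral_finite_kernel h k) => [z|]; first exact: g0.
have m : measurable_fun setT (fun z : T * X * Y => (z.2, z.1.2)).
  by apply: measurable_fun_pair => //; exact: measurableT_comp measurable_snd measurable_fst.
exact: measurableT_comp mg m.
Qed.

Section kernel_precomposition.
Context d1 d2 d3 (Y : measurableType d1) (X : measurableType d2)
  (Z : measurableType d3) (R : realType) (f : Y -> X).

(** The proof [mf] is an argument so that the kernel structures below can be inferred from the term.
    [cond_kernel], [mdensity], [pker_of] and [finite_law] carry proofs for the same reason. *)
Definition kprecomp (mf : measurable_fun setT f)
    (k : X -> {measure set Z -> \bar R}) : Y -> {measure set Z -> \bar R} :=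
  k \o f.

Hypothesis mf : measurable_fun setT f.

Section ker.
Variable k : R.-ker X ~> Z.

Let measurable_kprecomp U : measurable U ->
  measurable_fun [set: Y] (kprecomp mf k ^~ U).
Proof.
by move=> mU; exact: measurableT_comp (measurable_kernel k U mU) mf.
Qed.

HB.instance Definition _ :=
  isKernel.Build _ _ _ _ _ (kprecomp mf k) measurable_kprecomp.
End ker.

Section sfker.
Variable k : R.-sfker X ~> Z.

Let sfinite_kprecomp : exists2 k_ : (R.-ker Y ~> Z)^nat,
  forall n, measure_fam_uub (k_ n) &
  forall x U, measurable U -> kprecomp mf k x U = mseries (k_ ^~ x) 0 U.
Proof.
have [s hs] := sfinite_kernel k.
exists (fun n => kprecomp mf (s n)).
  by move=> n; have [r sr] := measure_uub (s n); exists r => x; exact: sr.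
by move=> x U mU; rewrite /kprecomp /= hs.
Qed.

HB.instance Definition _ :=
  isSFiniteKernel_subdef.Build _ _ _ _ R (kprecomp mf k) sfinite_kprecomp.
End sfker.

End kernel_precomposition.

(** * Integration against regular conditional distributions *)

Section disintegration.
Local Open Scope ereal_scope.
Context (R : realType) (dO : measure_display) (Omega : measurableType dO)
  (P : probability Omega R) (G : set (set Omega))
  (dE : measure_display) (E : measurableType dE) (X : Omega -> E)
  (kap : Omega -> probability E R).
Hypotheses (GS : <<s G >> `<=` measurable) (mX : measurable_fun setT X)
  (cX : cond_law P G X (fun w B => kap w B)).

Local Notation OG := (g_sigma_algebraType G).

Definition cond_kernel of cond_law P G X (fun w B => kap w B) :
  OG -> {measure set E -> \bar R} := kap.

Let cond_kernel_meas U : measurable U ->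
  measurable_fun [set: OG] (cond_kernel cX ^~ U).
Proof. by move=> mU; have [] := cX mU. Qed.

HB.instance Definition _ :=
  isKernel.Build _ _ _ _ _ (cond_kernel cX) cond_kernel_meas.

Let cond_kernel_prob x : cond_kernel cX x [set: E] = 1.
Proof. exact: probability_setT. Qed.

HB.instance Definition _ :=
  Kernel_isProbability.Build _ _ _ _ _ (cond_kernel cX) cond_kernel_prob.

Lemma measurable_fun_cond_integral (g : OG * E -> \bar R) :
  (forall x, 0 <= g x) -> measurable_fun setT g ->
  measurable_fun [set: OG] (fun w => \int[kap w]_y g (w, y)).
Proof.
move=> g0 mg.
exact: (measurable_fun_integral_finite_kernel g (cond_kernel cX)).
Qed.

Let midG : measurable_fun [set: Omega] (id : Omega -> OG).
Proof. by move=> _ A mA; rewrite setTI; exact: GS. Qed.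

Let PG : probability OG R := distribution P (mfun_Sub (mem_set midG)).

Let lker : R.-sfker OG ~> OG :=
  kprobability (measurable_cst (PG : pprobability OG R)).

Let mpair :
  measurable_fun setT (fun x : (OG * OG) * E => (x.1.2, x.2) : OG * E).
Proof.
apply/measurable_fun_pairP; split => /=; last exact: measurable_snd.
exact: (measurableT_comp measurable_snd measurable_fst).
Qed.

Let ksnd : R.-sfker (OG * OG) ~> E :=
  kprecomp measurable_snd (cond_kernel cX).

Let kpair : R.-sfker (OG * OG) ~> (OG * E)%type := mkcomp ksnd (kdirac mpair).

(** The law of a pair [(w, y)] with [w] drawn from [P] and [y] from [kap w]. It is built by
    composition of kernels, hence the dummy parameter in [OG], later set to [point]. *)
Let kjoint : R.-sfker OG ~> (OG * E)%type := mkcomp lker kpair.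

Let kjointE (g : OG * E -> \bar R) : 
  (forall x, 0 <= g x) -> measurable_fun setT g ->
  \int[kjoint point]_z g z = \int[P]_w \int[kap w]_y g (w, y).
Proof.
move=> g0 mg; rewrite integral_kcomp//=.
rewrite (_ : (fun y => _) = fun y => \int[kap y]_z g (y, z)); last first.
  apply/funext => y; rewrite integral_kcomp//.
  apply: eq_integral => z _; rewrite integral_dirac//= diracT mul1e//.
rewrite ge0_integral_pushforward //.
  exact: measurable_fun_cond_integral.
by move=> y _; exact: integral_ge0.
Qed.

(** By definition of [cond_law], the law of [(w, X w)] agrees with [kjoint] on rectangles, a
    generating pi-system, so the two are equal. As [g] may depend on [w], quantities known from the
    past can stay inside the integral. *)
Lemma cond_law_integral (g : OG * E -> \bar R) :
  (forall x, 0 <= g x) -> measurable_fun setT g ->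
  \int[P]_w g (w, X w) = \int[P]_w \int[kap w]_y g (w, y).
Proof.
move=> g0 mg.
have mwX : measurable_fun [set: Omega] (fun w => (w, X w) : OG * E).
  by apply/measurable_fun_pairP; split.
rewrite -kjointE//.
transitivity (\int[distribution P (mfun_Sub (mem_set mwX))]_z g z).
  rewrite ge0_integral_pushforward //.
apply: eq_measure_integral => A mA _.
pose rect : set (set (OG * E)) :=
  [set A `*` B | A in (@measurable _ OG) & B in (@measurable _ E)].
apply: (measure_unique rect (fun=> setT) _ _ _ _ _ _ _ _ _ mA) => //.
- exact: measurable_prod_measurableType.
- move=> _ _ [A1 mA1 [B1 mB1 <-]] [A2 mA2 [B2 mB2 <-]].
  exists (A1 `&` A2); first exact: (@measurableI _ OG).
  by exists (B1 `&` B2); [exact: measurableI|rewrite setXI].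
- by move=> _; exists setT; [exact: (@measurableT _ OG)|exists setT => //; rewrite setXTT].
- by rewrite bigcup_const.
- move=> _ [F mF [B mB <-]].
  have mFB : measurable (F `*` B : set (OG * E)) by exact: measurableX.
  have -> : kjoint point (F `*` B) = \int[kjoint point]_z (\1_(F `*` B) z)%:E.
    by rewrite integral_indic ?setIT.
  rewrite kjointE//; last by apply/measurable_EFinP; exact: measurable_indic.
  have [_ /(_ _ mF) cXF] := cX mB.
  transitivity (P (F `&` X @^-1` B)).
    by congr (P _); apply/seteqP; split => w.
  rewrite cXF integral_mkcond; apply: eq_integral => w _.
  rewrite /patch; case: ifPn => wF.
    rewrite -[LHS]/(kap w B) -[in LHS](setIT B) -integral_indic//.
    by apply: eq_integral => y _; rewrite !indicE in_setX wF.
  by rewrite [LHS]/(0%E) integral0_eq// => y _; rewrite indicE in_setX (negbTE wF).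
- by move=> _; rewrite (le_lt_trans (probability_le1 _ _)) ?ltry.
Qed.

End disintegration.

(** * Trajectories and their laws *)

Section trajectory_measurability.
Context {R : realType} {S A : finType}.
Local Notation trajectory := (trajectory R S A).
Implicit Types (x y : trajectory) (s : S) (a : A).

Let measurable_gen k s a (B : set R) : measurable B ->
  measurable ([set x | exists2 r, B r & onth x k = Some (s, a, r)]
    : set trajectory).
Proof. by move=> mB; apply: sub_sigma_algebra; exists k, s, a, B. Qed.

(** With [head_rew] and [behead], a measurable substitute for the pattern matching in
    [traj_dens_from]. *)
Definition head_is s a x : bool :=
  if x is (s', a', _) :: _ then (s' == s) && (a' == a) else false.

Definition head_rew x : R := if x is (_, _, r) :: _ then r else 0.

Lemma measurable_head_is s a : measurable_fun setT (head_is s a).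
Proof.
apply: (measurable_fun_bool true); rewrite setTI.
rewrite (_ : _ @^-1` _ =
  [set x | exists2 r, [set: R] r & onth x 0 = Some (s, a, r)]).
  exact: measurable_gen.
apply/seteqP; split => x /=; case: x => [|[[s' a'] r] x] //=.
- by case/andP => /eqP -> /eqP ->; exists r.
- by case.
- by case=> r' _ [-> -> _]; rewrite !eqxx.
Qed.

Lemma measurable_eq_nil :
  measurable_fun setT (fun x : trajectory => x == [::]).
Proof.
apply: (measurable_fun_bool true); rewrite setTI.
rewrite (_ : _ @^-1` _ =
  ~` \bigcup_(sa in [set: S * A]) (head_is sa.1 sa.2 @^-1` [set true])).
  apply/measurableC/fin_bigcup_measurable => [|sa _]; first exact: finite_finset.
  by rewrite -[X in measurable X]setTI; exact: measurable_head_is.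
apply/seteqP; split => x /=; case: x => [|[[s a] r] x] //=.
- by move=> _ [].
- by move=> []; exists (s, a) => //=; rewrite !eqxx.
Qed.

Lemma measurable_behead : measurable_fun setT (behead : trajectory -> trajectory).
Proof.
apply: (@measurability _ _ _ _ setT _ (trajectory_gen (A:=A)) erefl)
  => _ [_ [k [s [a [B [mB ->]]]]] <-].
rewrite setTI.
rewrite (_ : _ @^-1` _ = [set x | exists2 r, B r & onth x k.+1 = Some (s, a, r)]).
  exact: measurable_gen.
apply/seteqP; split => x /= [r Br E]; exists r => //.
  by case: x E => [|? x] //; case: k.
by case: x E.
Qed.

Lemma measurable_cons s a : measurable_fun setT
  (fun ry : R * trajectory => (s, a, ry.1) :: ry.2 : trajectory).
Proof.
apply: (@measurability _ _ _ _ setT _ (trajectory_gen (A:=A)) erefl)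
  => _ [_ [k [s' [a' [B [mB ->]]]]] <-].
rewrite setTI; case: k => [|k].
  have [/eqP[-> ->]|ne] := boolP ((s, a) == (s', a')).
    rewrite (_ : _ @^-1` _ = B `*` setT); first exact: measurableX.
    apply/seteqP; split => -[r y] /=; first by case=> r' Br' [->].
    by case=> Br _; exists r.
  rewrite (_ : _ @^-1` _ = set0)//; apply/seteqP; split => -[r y] //=.
  by case=> r' _ [Es Ea _]; move: ne; rewrite Es Ea eqxx.
rewrite (_ : _ @^-1` _ =
    setT `*` [set x | exists2 r, B r & onth x k = Some (s', a', r)]).
  by apply: measurableX => //; exact: measurable_gen.
by apply/seteqP; split => -[r y] /=; [|case].
Qed.

Lemma measurable_head_rew : measurable_fun setT head_rew.
Proof.
move=> _ B mB; rewrite setTI.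
rewrite (_ : _ @^-1` _ =
    \bigcup_(sa in [set: S * A])
      [set x | exists2 r, B r & onth x 0 = Some (sa.1, sa.2, r)] `|`
    ((eq_op^~ [::]) @^-1` [set true] `&` (fun=> 0) @^-1` B)).
  apply: measurableU.
    apply: fin_bigcup_measurable => [|sa _]; first exact: finite_finset.
    exact: measurable_gen.
  apply: measurableI.
    by rewrite -[X in measurable X]setTI; exact: measurable_eq_nil.
  by rewrite -[X in measurable X]setTI; exact: measurable_cst.
apply/seteqP; split => x /=; case: x => [|[[s a] r] x] //=.
- by right.
- by move=> Br; left; exists (s, a) => //; exists r.
- by case=> [[sa _ []]|[]].
- by case=> [[sa _ [r' Br' [_ _ ->]]]|[]].
Qed.

Lemma measurable_catl (x0 : trajectory) :
  measurable_fun setT (fun x => x0 ++ x : trajectory).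
Proof.
elim: x0 => [|[[s a] r] x0 IH]; first exact: measurable_id.
have -> : cat ((s, a, r) :: x0) =
  (fun ry : R * trajectory => (s, a, ry.1) :: ry.2) \o (fun x => (r, x0 ++ x)).
  by apply/funext.
exact: measurableT_comp (measurable_cons s a) (measurable_fun_pair (measurable_cst r) IH).
Qed.

End trajectory_measurability.

Section kernel_sum.
Local Open Scope ereal_scope.
Context d d' (X : measurableType d) (Y : measurableType d') (R : realType).
Context (I : Type) (k : I -> R.-sfker X ~> Y).

Fixpoint ksum (s : seq I) : R.-sfker X ~> Y :=
  if s is i :: s' then kadd (k i) (ksum s') else @kzero _ _ X Y R.

Lemma integral_ksum s x f : (forall y, 0 <= f y) -> measurable_fun setT f ->
  \int[ksum s x]_y f y = \sum_(i <- s) \int[k i x]_y f y.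
Proof.
move=> f0 mf; elim: s => [|i s IH].
  by rewrite big_nil /= integral_measure_zero.
by rewrite big_cons -IH ge0_integral_measure_add.
Qed.

End kernel_sum.

(** * Dominating measure and densities of trajectories *)

Section base_kernel.
Local Open Scope ereal_scope.
Context {R : realType} {d : measure_display} {X : measurableType d}.
Context {S A : pfinType} {H : nat} {I : finType} {Ms : I -> model R X S A H}.
Variable f : densities Ms.
Local Notation trajectory := (trajectory R S A).

Let measurable_kcons s a :
  measurable_fun setT (fun z : (X * R) * trajectory => (s, a, z.1.2) :: z.2 : trajectory).
Proof.
exact: (measurableT_comp (measurable_cons s a) (measurable_fun_pair
  (measurableT_comp measurable_snd measurable_fst) measurable_snd)).
Qed.

(* The measure integrated by [base_int_from], as a kernel. *)
Fixpoint base_ker (hs : seq 'I_H) : R.-sfker X ~> trajectory :=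
  if hs is h :: hs' then
    ksum (fun sa : S * A => mkcomp (base f h sa.1 sa.2)
      (mkcomp
        (kprecomp measurable_fst (base_ker hs') : R.-sfker (X * R) ~> trajectory)
        (kdirac (measurable_kcons sa.1 sa.2))))
      (enum {: S * A})
  else kdirac (measurable_cst ([::] : trajectory)).

Lemma measurable_integral_base_ker hs c (g : R * trajectory -> \bar R) :
  (forall z, 0 <= g z) -> measurable_fun setT g ->
  measurable_fun setT (fun r => \int[base_ker hs c]_y g (r, y)).
Proof.
move=> g0 mg.
exact: (measurable_fun_integral_sfinite_kernel g
  (kprecomp (measurable_cst c) (base_ker hs) : R.-sfker R ~> trajectory)).
Qed.

Lemma integral_base_ker_nil c (g : trajectory -> \bar R) :
  measurable_fun setT g -> \int[base_ker [::] c]_y g y = g [::].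
Proof. by move=> mg; rewrite integral_dirac// diracT mul1e. Qed.

Lemma integral_base_ker_cons h hs c (g : trajectory -> \bar R) :
  (forall y, 0 <= g y) -> measurable_fun setT g ->
  \int[base_ker (h :: hs) c]_y g y =
  \sum_(s : S) \sum_(a : A) \int[base f h s a c]_r
    \int[base_ker hs c]_y g ((s, a, r) :: y).
Proof.
move=> g0 mg; rewrite integral_ksum// big_enum pair_big/=.
apply: eq_bigr => -[s a] _; rewrite integral_kcomp//=.
apply: eq_integral => r _; rewrite integral_kcomp//.
apply: eq_integral => y _; rewrite integral_dirac//= ?diracT ?mul1e//.
Qed.

(** Turns the iterated integral in the definition of the Hellinger distance into an integral for a
    single measure, so that additivity and monotonicity apply at once. *)
Lemma base_intE c (g : trajectory -> \bar R) hs x :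
  (forall y, 0 <= g y) -> measurable_fun setT g ->
  base_int_from f c g hs x = \int[base_ker hs c]_y g (x ++ y).
Proof.
move=> g0 mg; elim: hs x => [|h hs IH] x.
  rewrite integral_base_ker_nil ?cats0//.
  exact: measurableT_comp mg (measurable_catl x).
rewrite integral_base_ker_cons//=; last exact: measurableT_comp mg (measurable_catl x).
apply: eq_bigr => s _; apply: eq_bigr => a _; apply: eq_integral => r _.
by rewrite IH; apply: eq_integral => y _; rewrite cat_rcons.
Qed.

End base_kernel.

Lemma measurable_natr_bool d (T : measurableType d) (R : realType)
    (b : T -> bool) :
  measurable_fun setT b -> measurable_fun setT (fun t => (b t)%:R : R).
Proof.
move=> mb; rewrite (_ : (fun _ => _) = fun t => if b t then 1 else 0).
  exact: measurable_fun_ifT.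
by apply/funext => t; case: (b t).
Qed.

Lemma measurable_pol_prob (R : realType) (S : finType) (A : pfinType) (H : nat)
    h s a :
  measurable_fun setT (fun p : policy R S A H => pol_prob p h s a).
Proof.
move=> _ B mB; rewrite setTI; apply: sub_sigma_algebra.
exists h, s, a, B; split => //.
by apply/seteqP; split => p; rewrite /= in_setE.
Qed.

Lemma pol_prob_ge0 (R : realType) (S : finType) (A : pfinType) (H : nat)
    (p : policy R S A H) h s a : 0 <= pol_prob p h s a.
Proof.
by have /forallP/(_ h)/forallP/(_ s)/andP[/forallP/(_ a)] := valP p.
Qed.

Lemma pol_prob_sum1 (R : realType) (S : finType) (A : pfinType) (H : nat)
    (p : policy R S A H) h s : \sum_a pol_prob p h s a = 1.
Proof.
by have /forallP/(_ h)/forallP/(_ s)/andP[_ /eqP] := valP p.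
Qed.

Section densities_theory.
Context {R : realType} {d : measure_display} {X : measurableType d}.
Context {S A : pfinType} {H : nat} {I : finType} {Ms : I -> model R X S A H}.
Variable f : densities Ms.
Local Notation trajectory := (trajectory R S A).
Local Notation policy := (policy R S A H).
Implicit Types (i j : I) (p : policy) (c : X) (hs : seq 'I_H) (s : S).
Implicit Types (x y : trajectory).

Lemma traj_dens_nil i p c s x :
  traj_dens_from f i p c [::] s x = (x == [::])%:R.
Proof. by case: x. Qed.

Lemma traj_dens_head i p c hs s s0 a r y : s0 != s ->
  traj_dens_from f i p c hs s ((s0, a, r) :: y) = 0.
Proof. by case: hs => [//|h hs] /= /negbTE ->; rewrite !mul0r. Qed.

(* After the last layer the sum over the unrecorded state gives the factor 1. *)
Lemma traj_dens_cons i p c h hs s s0 a r y :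
  traj_dens_from f i p c (h :: hs) s ((s0, a, r) :: y) =
  (s0 == s)%:R * pol_prob p h s a * dens f i h s a c r *
  \sum_s' trans (Ms i h) s a c s' * traj_dens_from f i p c hs s' y.
Proof.
rewrite /=; congr (_ * _); case: y => [|[[s2 a2] r2] y].
  case: hs => [|h' hs] /=; last by rewrite big1// => s' _; rewrite mulr0.
  by under eq_bigr do rewrite mulr1; rewrite trans_sum1.
rewrite (bigD1 s2)//= [X in _ = _ + X]big1 ?addr0// => s' s's2.
by rewrite traj_dens_head ?mulr0// eq_sym.
Qed.

Lemma traj_dens_ge0 i p c hs s x : 0 <= traj_dens_from f i p c hs s x.
Proof.
elim: hs s x => [|h hs IH] s x; first by rewrite traj_dens_nil.
case: x => [//|[[s0 a] r] x]; rewrite traj_dens_cons.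
rewrite !mulr_ge0 ?pol_prob_ge0 ?dens_ge0//; apply: sumr_ge0 => s' _.
by rewrite mulr_ge0 ?trans_ge0.
Qed.

Lemma measurable_traj_dens i hs s : measurable_fun setT
  (fun z : policy * X * trajectory => traj_dens_from f i z.1.1 z.1.2 hs s z.2).
Proof.
have mpol : measurable_fun setT (fun z : policy * X * trajectory => z.1.1).
  exact: measurableT_comp measurable_fst measurable_fst.
have mctx : measurable_fun setT (fun z : policy * X * trajectory => z.1.2).
  exact: measurableT_comp measurable_snd measurable_fst.
have mtrj := @measurable_snd _ _ (policy * X)%type trajectory.
elim: hs s => [|h hs IH] s.
  under eq_fun do rewrite traj_dens_nil.
  apply: measurable_natr_bool.
  exact: measurableT_comp measurable_eq_nil mtrj.
(* The match on the first step becomes a finite sum over its action, of which [head_is] keeps at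
   most one term. *)
rewrite (_ : (fun _ => _) = fun z : policy * X * trajectory =>
    \sum_(a : A) ((head_is s a z.2)%:R * pol_prob z.1.1 h s a *
      dens f i h s a z.1.2 (head_rew z.2) *
      \sum_s' trans (Ms i h) s a z.1.2 s' *
        traj_dens_from f i z.1.1 z.1.2 hs s' (behead z.2))).
  apply: measurable_sum => a; apply: measurable_funM.
    apply: measurable_funM; last first.
      exact: measurableT_comp (dens_meas f i h s a) (measurable_fun_pair mctx
        (measurableT_comp measurable_head_rew mtrj)).
    apply: measurable_funM.
      apply: measurable_natr_bool.
      exact: measurableT_comp (measurable_head_is s a) mtrj.
    exact: measurableT_comp (measurable_pol_prob _ _ _) mpol.
  apply: measurable_sum => s'; apply: measurable_funM.
    exact: measurableT_comp (trans_meas _ _ _ _) mctx.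
  exact: measurableT_comp (IH s') (measurable_fun_pair
    (measurable_fun_pair mpol mctx) (measurableT_comp measurable_behead mtrj)).
apply/funext => -[[p c] [|[[s0 a] r] x]].
  by rewrite /= big1// => a _; rewrite !mul0r.
rewrite traj_dens_cons/=; have [_|_] := eqVneq s0 s.
  rewrite (bigD1 a)//= eqxx [X in _ = _ + X]big1 ?addr0// => a' a'a.
  by rewrite eq_sym (negbTE a'a) !mul0r.
by rewrite !mul0r big1// => a' _; rewrite !mul0r.
Qed.

Lemma measurable_traj_dens_sect i p c hs s :
  measurable_fun setT (fun x => traj_dens_from f i p c hs s x).
Proof.
exact: (measurableT_comp (measurable_traj_dens i hs s)
  (measurable_fun_pair (measurable_cst (p, c)) (@measurable_id _ trajectory setT))).
Qed.

Lemma dens_meas_sect i h s a c : measurable_fun setT (dens f i h s a c).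
Proof.
exact: (measurableT_comp (dens_meas f i h s a) (measurable_fun_pair
  (measurable_cst c) (@measurable_id _ R setT))).
Qed.

Local Open Scope ereal_scope.

(** Layer by layer, [rew] is exchanged for [dens] times [base], and the sum over states in
    [base_ker] keeps only the current state, since the density vanishes at the others. Trajectory
    laws thus have the density [traj_dens] used by the likelihood and by the Hellinger distance. *)
Lemma expect_fromE i p c (g : trajectory -> \bar R) hs s x :
  (forall y, 0 <= g y) -> measurable_fun setT g ->
  expect_from (Ms i) p c g hs s x =
  \int[base_ker f hs c]_y ((traj_dens_from f i p c hs s y)%:E * g (x ++ y)).
Proof.
move=> g0 mg; elim: hs s x => [|h hs IH] s x.
  rewrite integral_base_ker_nil/= ?mul1e ?cats0//.
  apply: emeasurable_funM; last exact: measurableT_comp mg (measurable_catl x).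
  by apply/measurable_EFinP; exact: (measurable_traj_dens_sect i p c [::] s).
have mgx x' : measurable_fun setT (fun y => g (x' ++ y)).
  exact: measurableT_comp mg (measurable_catl x').
have mh s' x' : measurable_fun setT
    (fun y => (traj_dens_from f i p c hs s' y)%:E * g (x' ++ y)).
  apply: emeasurable_funM => //; apply/measurable_EFinP.
  exact: measurable_traj_dens_sect.
have h0 s' x' y : 0 <= (traj_dens_from f i p c hs s' y)%:E * g (x' ++ y).
  by rewrite mule_ge0 ?lee_fin ?traj_dens_ge0.
have mK s' a : measurable_fun setT (fun r => \int[base_ker f hs c]_y
    ((traj_dens_from f i p c hs s' y)%:E * g (x ++ (s, a, r) :: y))).
  pose G (ry : R * trajectory) := (traj_dens_from f i p c hs s' ry.2)%:E *
    g (x ++ (s, a, ry.1) :: ry.2).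
  apply: (@measurable_integral_base_ker _ _ _ _ _ _ _ _ f hs c G).
    by move=> z; rewrite mule_ge0 ?lee_fin ?traj_dens_ge0.
  apply: emeasurable_funM.
    apply/measurable_EFinP.
    exact: measurableT_comp (measurable_traj_dens_sect _ _ _ _ _) measurable_snd.
  exact: measurableT_comp (mgx x) (measurable_cons s a).
have K0 s' a r : 0 <= \int[base_ker f hs c]_y
    ((traj_dens_from f i p c hs s' y)%:E * g (x ++ (s, a, r) :: y)).
  by apply: integral_ge0 => y _; rewrite mule_ge0 ?lee_fin ?traj_dens_ge0.
rewrite integral_base_ker_cons; last 2 first.
- by move=> y; rewrite mule_ge0 ?lee_fin ?traj_dens_ge0.
- apply: emeasurable_funM => //; apply/measurable_EFinP.
  exact: measurable_traj_dens_sect.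
rewrite [LHS]/= (bigD1 s)// [X in _ = _ + X]big1 ?adde0; last first.
  move=> s0 s0s; apply: big1 => a _; apply: integral0_eq => r _.
  by apply: integral0_eq => y _; rewrite traj_dens_head ?mul0e.
apply: eq_bigr => a _.
have mS : measurable_fun setT (fun r => \sum_s' (trans (Ms i h) s a c s')%:E *
    \int[base_ker f hs c]_y
      ((traj_dens_from f i p c hs s' y)%:E * g (x ++ (s, a, r) :: y))).
  by apply: emeasurable_sum => s'; apply: measurable_funeM; exact: mK.
have S0 r : 0 <= \sum_s' (trans (Ms i h) s a c s')%:E *
    \int[base_ker f hs c]_y
      ((traj_dens_from f i p c hs s' y)%:E * g (x ++ (s, a, r) :: y)).
  by apply: sume_ge0 => s' _; rewrite mule_ge0 ?lee_fin ?trans_ge0.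
have mf : measurable_fun setT (fun r => (dens f i h s a c r)%:E).
  by apply/measurable_EFinP; exact: dens_meas_sect.
under [in LHS]eq_integral => r _.
  under eq_bigr do rewrite IH.
  under eq_bigr do under eq_integral do rewrite cat_rcons.
  over.
rewrite (ge0_integral_density (mu := rew (Ms i h) s a c)
  (nu := base f h s a c) (f := dens f i h s a c))//;
  first last.
- by move=> B mB; exact: densE.
- exact: dens_meas_sect.
- by move=> r; exact: dens_ge0.
rewrite -ge0_integralZl ?lee_fin ?pol_prob_ge0//; last 2 first.
- exact: emeasurable_funM.
- by move=> r _; rewrite mule_ge0 ?lee_fin ?dens_ge0.
apply: eq_integral => r _.
under [RHS]eq_integral => y _.
  rewrite traj_dens_cons eqxx mul1r EFinM -muleA -sumEFin.
  rewrite ge0_sume_distrl; last first.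
    by move=> s' _; rewrite lee_fin mulr_ge0 ?trans_ge0 ?traj_dens_ge0.
  under eq_bigr do rewrite EFinM -muleA.
  over.
rewrite ge0_integralZl ?lee_fin ?mulr_ge0 ?pol_prob_ge0 ?dens_ge0//; last 2 first.
- apply: emeasurable_sum => s'; apply: measurable_funeM.
  by under eq_fun do rewrite -cat_rcons; exact: mh.
- move=> y _; apply: sume_ge0 => s' _.
  by rewrite -cat_rcons mule_ge0 ?lee_fin ?trans_ge0.
rewrite EFinM -muleA; congr (_ * (_ * _)).
rewrite ge0_integral_sum//; last 2 first.
- move=> s'; apply: measurable_funeM.
  by under eq_fun do rewrite -cat_rcons; exact: mh.
- by move=> s' y _; rewrite -cat_rcons mule_ge0 ?lee_fin ?trans_ge0.
apply: eq_bigr => s' _; rewrite ge0_integralZl ?lee_fin ?trans_ge0//.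
- by under eq_fun do rewrite -cat_rcons; exact: mh.
- by move=> y _; rewrite -cat_rcons.
Qed.

End densities_theory.

Section density_measure.
Local Open Scope ereal_scope.
Context d (T : measurableType d) (R : realType).
Variables (mu : {measure set T -> \bar R}) (f : T -> R).

Definition mdensity of (forall x, (0 <= f x)%R) & measurable_fun setT f :=
  fun B : set T => \int[mu]_(x in B) (f x)%:E.

Hypotheses (f0 : forall x, (0 <= f x)%R) (mf : measurable_fun setT f).

Let mdensity0 : mdensity f0 mf set0 = 0.
Proof. exact: integral_set0. Qed.

Let mdensity_ge0 B : 0 <= mdensity f0 mf B.
Proof. by apply: integral_ge0 => x _; rewrite lee_fin. Qed.

Let mdensity_sigma_additive : semi_sigma_additive (mdensity f0 mf).
Proof.
move=> F mF tF mUF; rewrite /mdensity ge0_integral_bigcup//.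
- by apply: is_cvg_ereal_nneg_natsum => n _; apply: integral_ge0 => x _;
    rewrite lee_fin.
- exact/measurable_EFinP/measurable_funTS.
- by move=> x _; rewrite lee_fin.
Qed.

HB.instance Definition _ := isMeasure.Build _ _ _ (mdensity f0 mf)
  mdensity0 mdensity_ge0 mdensity_sigma_additive.

End density_measure.

Section trajectory_law.
Local Open Scope ereal_scope.
Context {R : realType} {d : measure_display} {X : measurableType d}.
Context {S A : pfinType} {H : nat} {I : finType} {Ms : I -> model R X S A H}.
Variables (s1 : S) (f : densities Ms).
Local Notation trajectory := (trajectory R S A).
Local Notation policy := (policy R S A H).
Implicit Types (i j : I) (p : policy) (c : X) (hs : seq 'I_H) (s : S).

Lemma expect_from_cst1 (M : model R X S A H) p c hs s x :
  expect_from M p c (fun=> 1) hs s x = 1.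
Proof.
elim: hs s x => [//|h hs IH] s x /=.
under eq_bigr => a _.
  under eq_integral => r _.
    under eq_bigr do rewrite IH mule1.
    rewrite sumEFin trans_sum1; over.
  rewrite integral_cst// mul1e prob_kernel mule1; over.
by rewrite sumEFin pol_prob_sum1.
Qed.

Lemma integral_traj_dens i p c hs s :
  \int[base_ker f hs c]_y (traj_dens_from f i p c hs s y)%:E = 1.
Proof.
rewrite -(expect_from_cst1 (Ms i) p c hs s [::]) (expect_fromE f)//.
by under [RHS]eq_integral do rewrite mule1.
Qed.

(** [traj_law] is by definition only a set function; the density turns it into a probability
    measure, see [traj_lawE]. *)
Definition traj_measure i p c : set trajectory -> \bar R :=
  mdensity (base_ker f (enum 'I_H) c)
    (traj_dens_ge0 f i p c (enum 'I_H) s1)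
    (measurable_traj_dens_sect f i p c (enum 'I_H) s1).

HB.instance Definition _ i p c := Measure.on (traj_measure i p c).

Let traj_measure_setT i p c : traj_measure i p c setT = 1.
Proof. exact: integral_traj_dens. Qed.

HB.instance Definition _ i p c :=
  Measure_isProbability.Build _ _ _ (traj_measure i p c)
    (traj_measure_setT i p c).

Lemma traj_lawE i p c W : measurable W ->
  traj_law s1 (Ms i) p c W = traj_measure i p c W.
Proof.
move=> mW; rewrite /traj_law /expect (expect_fromE f); last 2 first.
- by move=> y; rewrite lee_fin.
- by apply/measurable_EFinP; exact: measurable_indic.
rewrite [RHS](integral_mkcond W); apply: eq_integral => y _.
by rewrite /patch/= indicE; case: ifPn => yW; rewrite ?mule1 ?mule0.
Qed.

Lemma integral_traj_measure i p c (g : trajectory -> \bar R) :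
  (forall x, 0 <= g x) -> measurable_fun setT g ->
  \int[traj_measure i p c]_x g x =
  \int[base_ker f (enum 'I_H) c]_y ((traj_dens s1 f i p c y)%:E * g y).
Proof.
move=> g0 mg.
apply: (ge0_integral_density (mu := traj_measure i p c)) => //.
- by move=> y; exact: traj_dens_ge0.
- exact: measurable_traj_dens_sect.
Qed.

Lemma traj_measure_dens0 i p c :
  traj_measure i p c [set x | traj_dens s1 f i p c x = 0%R] = 0.
Proof.
rewrite -[LHS]/(\int[_]_(x in _) _); apply: integral0_eq => x /=.
by rewrite /traj_dens => ->.
Qed.

End trajectory_law.

Lemma sqrtr_mul_le (R : realType) (a b : R) : 0 <= a -> 0 <= b ->
  Num.sqrt a * Num.sqrt b <= (a + b) / 2.
Proof.
move=> a0 b0; rewrite -{2}(sqr_sqrtr a0) -{2}(sqr_sqrtr b0).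
have := sqr_ge0 (Num.sqrt a - Num.sqrt b); nra.
Qed.

Lemma measurable_sqrtr d (T : measurableType d) (R : realType) (g : T -> R) :
  measurable_fun setT g -> measurable_fun setT (fun x => Num.sqrt (g x)).
Proof.
exact: measurableT_comp (continuous_measurable_fun (@sqrt_continuous R)).
Qed.

(** * Hellinger affinities of trajectory laws *)

Section affinity.
Context {R : realType} {d : measure_display} {X : measurableType d}.
Context {S A : pfinType} {H : nat} {I : finType} {Ms : I -> model R X S A H}.
Variables (f : densities Ms) (i j : I).
Local Notation trajectory := (trajectory R S A).
Local Notation policy := (policy R S A H).
Implicit Types (p : policy) (c : X) (hs : seq 'I_H) (s : S).

(** Bhattacharyya coefficient of the two reward distributions; [trans_aff] and [aff] are those of
    the next states and of the trajectories. *)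
Definition rew_aff h s a c : R := fine (\int[base f h s a c]_r
  (Num.sqrt (dens f i h s a c r) * Num.sqrt (dens f j h s a c r))%:E)%E.

Definition trans_aff h s a c : R :=
  \sum_s' Num.sqrt (trans (Ms i h) s a c s') * Num.sqrt (trans (Ms j h) s a c s').

(** Policy probabilities enter without a root, being common to both laws; the unrecorded state after
    the last layer contributes the factor 1. *)
Fixpoint aff p c hs s : R :=
  if hs is h :: hs' then
    \sum_a pol_prob p h s a * (rew_aff h s a c *
      (if hs' is [::] then 1 else
       \sum_s' Num.sqrt (trans (Ms i h) s a c s') *
               Num.sqrt (trans (Ms j h) s a c s') * aff p c hs' s'))
  else 1.

Local Open Scope ereal_scope.

Lemma integral_dens k h s a c :
  \int[base f h s a c]_r (dens f k h s a c r)%:E = 1.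
Proof. by rewrite -densE// prob_kernel. Qed.

Lemma measurable_dens_sqrt h s a c : measurable_fun setT (fun r =>
  (Num.sqrt (dens f i h s a c r) * Num.sqrt (dens f j h s a c r))%:E).
Proof.
by apply/measurable_EFinP; apply: measurable_funM; apply: measurable_sqrtr;
  exact: dens_meas_sect.
Qed.

Let aff_le h s a c : \int[base f h s a c]_r
  (Num.sqrt (dens f i h s a c r) * Num.sqrt (dens f j h s a c r))%:E <= 1.
Proof.
have mD k : measurable_fun setT (fun r => (dens f k h s a c r)%:E).
  by apply/measurable_EFinP; exact: dens_meas_sect.
have D0 k r : 0 <= (dens f k h s a c r)%:E by rewrite lee_fin dens_ge0.
apply: (@le_trans _ _ (\int[base f h s a c]_r
   (2^-1%:E * ((dens f i h s a c r)%:E + (dens f j h s a c r)%:E)))).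
  apply: ge0_le_integral => //.
  - exact: measurable_dens_sqrt.
  - by apply: measurable_funeM; exact: emeasurable_funD.
  - move=> r _; rewrite -EFinD -EFinM lee_fin [leRHS]mulrC.
    by apply: sqrtr_mul_le; exact: dens_ge0.
rewrite ge0_integralZl//; last 2 first.
- exact: emeasurable_funD.
- by move=> r _; rewrite adde_ge0.
rewrite ge0_integralD// !integral_dens -EFinD -EFinM lee_fin.
by rewrite (_ : 1 + 1 = 2)%R ?mulVf// -natrD.
Qed.

Lemma rew_affE h s a c : \int[base f h s a c]_r
  (Num.sqrt (dens f i h s a c r) * Num.sqrt (dens f j h s a c r))%:E =
  (rew_aff h s a c)%:E.
Proof.
rewrite /rew_aff fineK// ge0_fin_numE ?(le_lt_trans (aff_le _ _ _ _)) ?ltry//.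
by apply: integral_ge0 => r _; rewrite lee_fin mulr_ge0 ?sqrtr_ge0.
Qed.

Lemma rew_aff_ge0 h s a c : (0 <= rew_aff h s a c)%R.
Proof.
rewrite -lee_fin -rew_affE.
by apply: integral_ge0 => r _; rewrite lee_fin mulr_ge0 ?sqrtr_ge0.
Qed.

Lemma rew_aff_le1 h s a c : (rew_aff h s a c <= 1)%R.
Proof. by rewrite -lee_fin -rew_affE. Qed.

(** Applied to the densities of the rest of a trajectory: only its first state [s0] has a nonzero
    one, so the root passes through the sum. *)
Let sqrt_sum_trans (k : I) h s a c (F : S -> R) s0 :
  (forall s', s' != s0 -> F s' = 0)%R ->
  Num.sqrt (\sum_s' trans (Ms k h) s a c s' * F s')%R =
  (Num.sqrt (trans (Ms k h) s a c s0) * Num.sqrt (F s0))%R.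
Proof.
move=> F0; rewrite (bigD1 s0)//= big1 ?addr0.
  by rewrite sqrtrM ?trans_ge0.
by move=> s' ne; rewrite F0 ?mulr0.
Qed.

Lemma integral_sqrt_traj_dens p c hs s :
  \int[base_ker f hs c]_y (Num.sqrt (traj_dens_from f i p c hs s y) *
    Num.sqrt (traj_dens_from f j p c hs s y))%:E = (aff p c hs s)%:E.
Proof.
have md hs' s' : measurable_fun setT (fun y =>
    (Num.sqrt (traj_dens_from f i p c hs' s' y) *
     Num.sqrt (traj_dens_from f j p c hs' s' y))%:E).
  by apply/measurable_EFinP; apply: measurable_funM; apply: measurable_sqrtr;
    exact: measurable_traj_dens_sect.
have d0 hs' s' y : 0 <= (Num.sqrt (traj_dens_from f i p c hs' s' y) *
     Num.sqrt (traj_dens_from f j p c hs' s' y))%:E.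
  by rewrite lee_fin mulr_ge0 ?sqrtr_ge0.
elim: hs s => [|h hs IH] s.
  by rewrite integral_base_ker_nil; [rewrite /= sqrtr1 mulr1|exact: md].
rewrite integral_base_ker_cons//.
rewrite (bigD1 s)// [X in _ + X = _]big1 ?adde0; last first.
  move=> s0 s0s; apply: big1 => a _; apply: integral0_eq => r _.
  by apply: integral0_eq => y _; rewrite traj_dens_head// sqrtr0 mul0r.
rewrite [in RHS]/= -sumEFin; apply: eq_bigr => a _.
set W := (if hs is [::] then _ else _).
pose G k y := (\sum_s' trans (Ms k h) s a c s' * traj_dens_from f k p c hs s' y)%R.
have G0 k y : (0 <= G k y)%R.
  by apply: sumr_ge0 => s' _; rewrite mulr_ge0 ?trans_ge0 ?traj_dens_ge0.
have mG : measurable_fun setT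
    (fun y => (Num.sqrt (G i y) * Num.sqrt (G j y))%:E).
  apply/measurable_EFinP; apply: measurable_funM; apply: measurable_sqrtr;
    apply: measurable_sum => s'; apply: measurable_funM => //;
    exact: measurable_traj_dens_sect.
have GW : \int[base_ker f hs c]_y (Num.sqrt (G i y) * Num.sqrt (G j y))%:E = W%:E.
  rewrite {}/W; move: G0 mG; rewrite {}/G; case: hs IH => [|h' hs] IH _ mG.
    rewrite integral_base_ker_nil//=.
    by rewrite -!mulr_suml !trans_sum1 mul1r sqrtr1 mulr1.
  transitivity (\int[base_ker f (h' :: hs) c]_y \sum_s'
    ((Num.sqrt (trans (Ms i h) s a c s') * Num.sqrt (trans (Ms j h) s a c s'))%:E *
     (Num.sqrt (traj_dens_from f i p c (h' :: hs) s' y) *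
      Num.sqrt (traj_dens_from f j p c (h' :: hs) s' y))%:E)).
    apply: eq_integral => -[|[[s0 a0] r0] y] _.
      rewrite [RHS]big1; last by move=> s' _; rewrite /= sqrtr0 mulr0 mule0.
      by rewrite big1 ?sqrtr0 ?mul0r// => s' _; rewrite mulr0.
    have F0 k s' : s' != s0 ->
        traj_dens_from f k p c (h' :: hs) s' ((s0, a0, r0) :: y) = 0%R.
      by move=> ne; rewrite traj_dens_head// eq_sym.
    rewrite (@sqrt_sum_trans i h s a c _ s0 (F0 i)) (@sqrt_sum_trans j h s a c _ s0 (F0 j)).
    rewrite (bigD1 s0)// [X in _ = _ + X]big1 ?adde0; last first.
      by move=> s' ne; rewrite F0// sqrtr0 mul0r mule0.
    by rewrite -EFinM; congr (_%:E); rewrite mulrACA.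
  rewrite ge0_integral_sum//; last first.
    by move=> s'; apply: measurable_funeM; exact: md.
  rewrite -sumEFin; apply: eq_bigr => s' _.
  by rewrite ge0_integralZl ?lee_fin ?mulr_ge0 ?sqrtr_ge0// IH.
have W0 : (0 <= W)%R.
  by rewrite -lee_fin -GW; apply: integral_ge0 => y _;
    rewrite lee_fin mulr_ge0 ?sqrtr_ge0.
transitivity (\int[base f h s a c]_r ((pol_prob p h s a * W)%:E *
  (Num.sqrt (dens f i h s a c r) * Num.sqrt (dens f j h s a c r))%:E)); last first.
  rewrite ge0_integralZl ?lee_fin ?mulr_ge0 ?pol_prob_ge0//.
  - by rewrite rew_affE -EFinM; congr (_%:E); rewrite mulrAC mulrA.
  - exact: measurable_dens_sqrt.
apply: eq_integral => r _.
rewrite (EFinM (pol_prob p h s a) W) -GW muleAC -EFinM.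
rewrite -ge0_integralZl//; last first.
  by rewrite lee_fin !mulr_ge0 ?sqrtr_ge0 ?pol_prob_ge0.
apply: eq_integral => y _; rewrite !traj_dens_cons eqxx !mul1r -EFinM.
congr (_%:E); rewrite -/(G i y) -/(G j y).
(* Both roots contain [Num.sqrt (pol_prob p h s a)], and their product gives back the
   probability. *)
rewrite !sqrtrM ?mulr_ge0 ?pol_prob_ge0 ?dens_ge0//.
rewrite mulrACA; congr (_ * _)%R.
by rewrite mulrACA -expr2 sqr_sqrtr ?pol_prob_ge0.
Qed.

Lemma aff_ge0 p c hs s : (0 <= aff p c hs s)%R.
Proof.
rewrite -lee_fin -integral_sqrt_traj_dens.
by apply: integral_ge0 => y _; rewrite lee_fin mulr_ge0 ?sqrtr_ge0.
Qed.

Lemma hellinger2E (s1 : S) p c :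
  hellinger2 s1 f i j p c = (1 - aff p c (enum 'I_H) s1)%:E.
Proof.
set hs := enum 'I_H.
pose D k y := traj_dens_from f k p c hs s1 y.
have D0 k y : (0 <= D k y)%R by exact: traj_dens_ge0.
have mD k : measurable_fun setT (D k) by exact: measurable_traj_dens_sect.
pose V := \int[base_ker f hs c]_y ((Num.sqrt (D i y) - Num.sqrt (D j y)) ^+ 2)%:E.
have mV : measurable_fun setT (fun y => ((Num.sqrt (D i y) - Num.sqrt (D j y)) ^+ 2)%:E).
  apply/measurable_EFinP; apply: measurable_funX; apply: measurable_funB;
  exact: measurable_sqrtr.
have V0 y : 0 <= ((Num.sqrt (D i y) - Num.sqrt (D j y)) ^+ 2)%:E.
  by rewrite lee_fin sqr_ge0.
have mW : measurable_fun setT (fun y => (Num.sqrt (D i y) * Num.sqrt (D j y))%:E).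
  by apply/measurable_EFinP; apply: measurable_funM; exact: measurable_sqrtr.
(* Expanding the square gives two densities of integral 1 minus twice the affinity. The identity is
   stated as a sum so that only nonnegative functions are integrated. *)
have VE : V + (2 * aff p c hs s1)%:E = 2%:E.
  rewrite EFinM -integral_sqrt_traj_dens -ge0_integralZl//.
  rewrite -ge0_integralD//; last first.
    by apply: measurable_funeM.
  transitivity (\int[base_ker f hs c]_y ((D i y)%:E + (D j y)%:E)).
    apply: eq_integral => y _; rewrite -EFinM -!EFinD; congr (_%:E).
    by rewrite sqrrB !sqr_sqrtr// -/(D i y) -/(D j y); ring.
  rewrite ge0_integralD//.
  - by rewrite !integral_traj_dens -EFinD; congr (_%:E); rewrite -natrD.
  - by move=> y _; rewrite lee_fin.
  - exact/measurable_EFinP.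
  - by move=> y _; rewrite lee_fin.
  - exact/measurable_EFinP.
rewrite /hellinger2 base_intE//=.
rewrite -/V.
have -> : V = (2 - 2 * aff p c hs s1)%:E.
  by rewrite EFinB -VE addeK.
by rewrite -EFinM; congr (_%:E); rewrite mulrBr mulVf// mulrA mulVf// mul1r.
Qed.

Lemma aff_le1 (s1 : S) p c : (aff p c (enum 'I_H) s1 <= 1)%R.
Proof.
rewrite -subr_ge0 -lee_fin -hellinger2E /hellinger2.
rewrite mule_ge0 ?lee_fin// base_intE//.
- by apply: integral_ge0 => y _; rewrite lee_fin sqr_ge0.
- by move=> y; rewrite lee_fin sqr_ge0.
- apply/measurable_EFinP; apply: measurable_funX; apply: measurable_funB;
  apply: measurable_sqrtr; exact: measurable_traj_dens_sect.
Qed.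

End affinity.

(** * Rounds of the interaction *)

Section generated_measurability.
Context d' (E : measurableType d') (T : pointedType).
Implicit Types G : set (set T).

Lemma measurable_fun_gen_sub G G' (f : T -> E) : <<s G >> `<=` <<s G' >> ->
  measurable_fun [set: g_sigma_algebraType G] (f : g_sigma_algebraType G -> E) ->
  measurable_fun [set: g_sigma_algebraType G'] (f : g_sigma_algebraType G' -> E).
Proof.
move=> GG' mf _ B mB; rewrite setTI; apply: GG'.
by have := mf measurableT B mB; rewrite setTI.
Qed.

Lemma measurable_fun_gen_sub_prod d2 (E2 : measurableType d2) G G'
    (f : T * E -> E2) : <<s G >> `<=` <<s G' >> ->
  measurable_fun [set: (g_sigma_algebraType G * E)%type]
    (f : g_sigma_algebraType G * E -> E2) ->
  measurable_fun [set: (g_sigma_algebraType G' * E)%type]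
    (f : g_sigma_algebraType G' * E -> E2).
Proof.
move=> GG' mf.
have mid : measurable_fun [set: (g_sigma_algebraType G' * E)%type]
    (fun z => (z.1, z.2) : g_sigma_algebraType G * E).
  apply: measurable_fun_pair; last exact: measurable_snd.
  move=> _ B mB; rewrite setTI.
  rewrite (_ : _ @^-1` _ = B `*` setT).
    by apply: measurableX => //; exact: GG'.
  by apply/seteqP; split => -[w e] /=; [|case].
by have := measurableT_comp mf mid; apply: eq_measurable_fun => -[].
Qed.

Lemma g_sigma_algebra_sub G G' : G `<=` <<s G' >> -> <<s G >> `<=` <<s G' >>.
Proof. by move=> GG'; apply: smallest_sub => //; exact: smallest_sigma_algebra. Qed.

Lemma g_sigma_algebra_mono G G' : G `<=` G' -> <<s G >> `<=` <<s G' >>.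
Proof.
by move=> GG'; apply: g_sigma_algebra_sub => B /GG'; exact: sub_sigma_algebra.
Qed.

End generated_measurability.

Lemma g_sigma_algebra_measurable d (T : measurableType d) (G : set (set T)) :
  G `<=` measurable -> <<s G >> `<=` measurable.
Proof. by move=> GS; apply: smallest_sub => //; exact: sigma_algebra_measurable. Qed.

Lemma cond_law_eq (R : realType) dO (Omega : measurableType dO)
    (P : probability Omega R) G dE (E : measurableType dE) (X : Omega -> E)
    (k1 k2 : Omega -> set E -> \bar R) :
  (forall w B, measurable B -> k1 w B = k2 w B) ->
  cond_law P G X k1 -> cond_law P G X k2.
Proof.
move=> k12 c1 B mB; have [mk1 k1E] := c1 B mB; split.
  by rewrite (_ : (fun _ => _) = fun w => k1 w B)//; apply/funext => w; rewrite k12.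
by move=> F mF; rewrite k1E//; apply: eq_integral => w _; rewrite k12.
Qed.

Section kernel_probability.
Context d d' (X : measurableType d) (Y : measurableType d') (R : realType).
Variables (k : R.-pker X ~> Y) (x : X).

Definition kernel_prob : set Y -> \bar R := k x.
HB.instance Definition _ := Measure.on kernel_prob.
HB.instance Definition _ :=
  Measure_isProbability.Build _ _ _ kernel_prob (prob_kernel x).

End kernel_probability.

Section rounds.
Local Open Scope ereal_scope.
Context {R : realType} {d dO : measure_display} {X : measurableType d}.
Context {S A : pfinType} {H : nat} {Omega : measurableType dO}.
Local Notation policy := (policy R S A H).
Local Notation trajectory := (trajectory R S A).
Variables (P : probability Omega R) (D : probability X R) (s1 : S).
Context {I : finType} {Ms : I -> model R X S A H}.
Variables (f : densities Ms) (star : I) (Z : process R X S A H Omega).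

Lemma hist_measurable b : <<s hist Z b >> `<=` measurable.
Proof.
apply: g_sigma_algebra_measurable => F [t _ [[|]|]] [B mB <-];
  exact: measurable_funPT.
Qed.

Lemma hist_mono b b' : (b <= b')%R -> <<s hist Z b >> `<=` <<s hist Z b' >>.
Proof.
move=> bb'; apply: g_sigma_algebra_mono => F [t [t0 tb] Ft].
by exists t => //; split => //; exact: le_trans bb'.
Qed.

Lemma measurable_fun_preimage_gen d' (E : measurableType d') (G : set (set Omega))
  (Y : Omega -> E) :
  preimage_set_system setT Y measurable `<=` <<s G >> ->
  measurable_fun [set: g_sigma_algebraType G] (Y : g_sigma_algebraType G -> E).
Proof. by move=> YG _ B mB; apply: YG; exists B. Qed.

Lemma measurable_traj_integral (g : policy * X * trajectory -> \bar R) :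
  (forall z, 0 <= g z) -> measurable_fun setT g ->
  measurable_fun setT (fun qc : policy * X =>
    \int[traj_measure s1 f star qc.1 qc.2]_x g (qc, x)).
Proof.
move=> g0 mg.
pose g' (z : policy * X * trajectory) :=
  (traj_dens s1 f star z.1.1 z.1.2 z.2)%:E * g z.
rewrite (_ : (fun _ => _) = fun qc : policy * X =>
    \int[base_ker f (enum 'I_H) qc.2]_y g' (qc, y)).
  apply: (measurable_fun_integral_sfinite_kernel g' (kprecomp measurable_snd
    (base_ker f (enum 'I_H)) : R.-sfker (policy * X) ~> trajectory)).
    by move=> z; rewrite mule_ge0 ?lee_fin ?traj_dens_ge0.
  apply: emeasurable_funM => //; apply/measurable_EFinP.
  exact: measurable_traj_dens.
apply/funext => -[q c]; rewrite integral_traj_measure//.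
exact: measurableT_comp mg (measurable_pair1 (q, c)).
Qed.

Variables (t : nat) (kappa : Omega -> X -> set policy -> \bar R) (b : R).
Hypothesis bt : <<s hist Z b >> `<=` <<s hist Z t.-1%:R >>.
Local Notation Ob := (g_sigma_algebraType (hist Z b)).
Variable kap : R.-pker (Ob * X) ~> policy.
Hypothesis kapE : forall w c U, measurable U -> kappa w c U = kap (w, c) U.
Hypothesis roundt : round P D s1 (Ms star) Z t kappa.

Let past := hist Z t.-1%:R.
Let past_ctx := past `|` sigma_ctx Z t.
Let past_pol := past_ctx `|` sigma_pol Z t.

Let past_sub : <<s past >> `<=` <<s past_ctx >>.
Proof. by apply: g_sigma_algebra_mono => B; left. Qed.

Let past_ctx_sub : <<s past_ctx >> `<=` <<s past_pol >>.
Proof. by apply: g_sigma_algebra_mono => B; left. Qed.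

Let past_pol_sub : <<s past_pol >> `<=` measurable.
Proof.
apply: g_sigma_algebra_measurable => F [[|]|].
- by move=> pF; apply: (@hist_measurable t.-1%:R); exact: sub_sigma_algebra.
- by case=> B mB <-; exact: measurable_funPT.
- by case=> B mB <-; exact: measurable_funPT.
Qed.

Let mctx : measurable_fun [set: g_sigma_algebraType past_ctx]
  (ctx Z t : g_sigma_algebraType past_ctx -> X).
Proof.
by apply: measurable_fun_preimage_gen => F ?; apply: sub_sigma_algebra; right.
Qed.

Let mpol : measurable_fun [set: g_sigma_algebraType past_pol]
  (pol Z t : g_sigma_algebraType past_pol -> policy).
Proof.
by apply: measurable_fun_preimage_gen => F ?; apply: sub_sigma_algebra; right.
Qed.

(** Tower property: trajectory, policy and context are integrated out in the reverse order of
    drawing. The weight [V] carries whatever is known before the round. *)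
Lemma round_integral (V : Omega -> \bar R)
    (g : policy * X * trajectory -> \bar R) :
  (forall w, 0 <= V w) ->
  measurable_fun [set: g_sigma_algebraType past] (V : g_sigma_algebraType past -> \bar R) ->
  (forall z, 0 <= g z) -> measurable_fun setT g ->
  \int[P]_w (V w * g (pol Z t w, ctx Z t w, trj Z t w)) =
  \int[P]_w (V w * \int[D]_c \int[kap (w, c)]_q
    \int[traj_measure s1 f star q c]_x g (q, c, x)).
Proof.
move=> V0 mV g0 mg; have [cctx cpol ctrj] := roundt.
pose h (qc : policy * X) := \int[traj_measure s1 f star qc.1 qc.2]_x g (qc, x).
have mh : measurable_fun setT h by exact: measurable_traj_integral.
have h0 qc : 0 <= h qc by exact: integral_ge0.
pose k (wc : Ob * X) := \int[kap wc]_q h (q, wc.2).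
have k0 wc : 0 <= k wc by exact: integral_ge0.
have mk : measurable_fun setT k by exact: measurable_kernel_integral.
have hZ w : measurable_fun setT (fun x => g (pol Z t w, ctx Z t w, x)).
  exact: measurableT_comp mg (pair1_measurable _).
transitivity (\int[P]_w (V w * h (pol Z t w, ctx Z t w))).
  pose G2 := g_sigma_algebraType past_pol.
  pose g3 (z : G2 * trajectory) := V z.1 * g (pol Z t z.1, ctx Z t z.1, z.2).
  rewrite (cond_law_integral past_pol_sub (measurable_funPT (trj Z t))
    (cond_law_eq _ ctrj)
    (kap := fun w => traj_measure s1 f star (pol Z t w) (ctx Z t w)) (g := g3)).
  - apply: eq_integral => w _; rewrite /g3/= ge0_integralZl//.
  - by move=> w B mB; exact: traj_lawE.
  - by move=> z; exact: mule_ge0.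
  - apply: emeasurable_funM.
      apply: (measurableT_comp _ measurable_fst).
      apply: measurable_fun_gen_sub mV.
      exact: subset_trans past_sub past_ctx_sub.
    have m3 : measurable_fun setT (fun z : G2 * trajectory =>
        (pol Z t z.1, ctx Z t z.1, z.2) : policy * X * trajectory).
      apply: measurable_fun_pair => //; apply: measurable_fun_pair.
        exact: measurableT_comp mpol measurable_fst.
      apply: (measurableT_comp _ measurable_fst).
      exact: measurable_fun_gen_sub mctx.
    exact: measurableT_comp mg m3.
(* The kernel [kap] sees the past only through [hist Z b], which is coarser than the past of round
   [t]. *)
have mid1 : measurable_fun [set: g_sigma_algebraType past_ctx]
    (fun w => (w, ctx Z t w) : Ob * X).
  apply: measurable_fun_pair => //.
  move=> _ B mB; rewrite setTI; apply: past_sub; exact: bt.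
have hctx w : measurable_fun setT (fun q => h (q, ctx Z t w)).
  by apply: measurable_fun_pair1.
have kctx w : measurable_fun setT (fun c => k (w, c)).
  exact: measurableT_comp mk (pair1_measurable _).
transitivity (\int[P]_w (V w * k (w, ctx Z t w))).
  pose G1 := g_sigma_algebraType past_ctx.
  pose g2 (z : G1 * policy) := V z.1 * h (z.2, ctx Z t z.1).
  rewrite (cond_law_integral (subset_trans past_ctx_sub past_pol_sub)
    (measurable_funPT (pol Z t)) (cond_law_eq _ cpol)
    (kap := fun w => kernel_prob kap (w, ctx Z t w)) (g := g2)).
  - by apply: eq_integral => w _; rewrite /g2/= ge0_integralZl.
  - by move=> w B mB; exact: kapE.
  - by move=> z; exact: mule_ge0.
  - apply: emeasurable_funM.
      apply: (measurableT_comp _ measurable_fst).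
      exact: measurable_fun_gen_sub mV.
    have m2 : measurable_fun setT (fun z : G1 * policy =>
        (z.2, ctx Z t z.1) : policy * X).
      apply: measurable_fun_pair => //.
      exact: measurableT_comp mctx measurable_fst.
    exact: measurableT_comp mh m2.
pose G0 := g_sigma_algebraType past.
pose g1 (z : G0 * X) := V z.1 * k z.
rewrite (cond_law_integral (@hist_measurable _) (measurable_funPT (ctx Z t))
  cctx (kap := fun w => D) (g := g1)).
- by apply: eq_integral => w _; rewrite /g1/= ge0_integralZl.
- by move=> z; exact: mule_ge0.
- apply: emeasurable_funM.
    exact: measurableT_comp mV measurable_fst.
  exact: (measurable_fun_gen_sub_prod bt mk).
Qed.

End rounds.

(** * Maximum likelihood estimation *)

Lemma measurable_invr_ge0 d (T : measurableType d) (R : realType) (g : T -> R) :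
  (forall x, 0 <= g x) -> measurable_fun setT g ->
  measurable_fun setT (fun x => (g x)^-1).
Proof.
move=> g0 mg; under eq_fun do rewrite -powR_inv1//.
exact: measurableT_comp (measurable_powR _) mg.
Qed.

Section probability_kernel_of_family.
Context d d' (X : measurableType d) (Y : measurableType d') (R : realType).
Variable k : X -> probability Y R.

Definition pker_of
    of (forall U, measurable U -> measurable_fun [set: X] (fun x => k x U)) :
  X -> {measure set Y -> \bar R} := k.

Hypothesis mk :
  forall U, measurable U -> measurable_fun [set: X] (fun x => k x U).

HB.instance Definition _ := isKernel.Build _ _ _ _ _ (pker_of mk) mk.

Let pker_of_setT x : pker_of mk x [set: Y] = 1%E.
Proof. exact: probability_setT. Qed.

HB.instance Definition _ :=
  Kernel_isProbability.Build _ _ _ _ _ (pker_of mk) pker_of_setT.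

End probability_kernel_of_family.

(** From [b <= expR (b - 1)]. With [b] the mean affinity, it shows that the exponential of [n] times
    the mean error is compensated by the product of [n] conditional means. *)
Lemma exp_mul_le1 (R : realType) (b : R) n : 0 <= b ->
  expR (n%:R * (1 - b)) * b ^+ n <= 1.
Proof.
move=> b0; rewrite mulrC -ler_pdivlMr ?expR_gt0// div1r -expRN -mulrN opprB.
rewrite mulrC expRM_natr lerXn2r// ?nnegrE ?expR_ge0//.
by have := expR_ge1Dx (b - 1); lra.
Qed.

Section likelihood_ratio.
Local Open Scope ereal_scope.
Context {R : realType} {d dO : measure_display} {X : measurableType d}.
Context {S A : pfinType} {H : nat} {Omega : measurableType dO}.
Local Notation policy := (policy R S A H).
Local Notation trajectory := (trajectory R S A).
Variables (P : probability Omega R) (D : probability X R) (s1 : S).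
Context {I : finType} {Ms : I -> model R X S A H}.
Variables (f : densities Ms) (star : I) (Z : process R X S A H Omega).

Definition traj_aff i (q : policy) (c : X) : R :=
  aff f i star q c (enum 'I_H) s1.

Lemma traj_aff_ge0 i q c : (0 <= traj_aff i q c)%R.
Proof. exact: aff_ge0. Qed.

Lemma traj_aff_le1 i q c : (traj_aff i q c <= 1)%R.
Proof. exact: aff_le1. Qed.

(* The junk value 0 at the zeros of the true density, a null set, is harmless. *)
Definition sqrt_lr i (z : policy * X * trajectory) : R :=
  Num.sqrt (traj_dens s1 f i z.1.1 z.1.2 z.2) /
  Num.sqrt (traj_dens s1 f star z.1.1 z.1.2 z.2).

Lemma sqrt_lr_ge0 i z : (0 <= sqrt_lr i z)%R.
Proof. by rewrite divr_ge0 ?sqrtr_ge0. Qed.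

Lemma measurable_sqrt_lr i : measurable_fun setT (sqrt_lr i).
Proof.
apply: measurable_funM.
  by apply: measurable_sqrtr; exact: measurable_traj_dens.
apply: measurable_invr_ge0 => [z|]; first exact: sqrtr_ge0.
by apply: measurable_sqrtr; exact: measurable_traj_dens.
Qed.

Lemma integral_sqrt_lr i q c :
  \int[traj_measure s1 f star q c]_x (sqrt_lr i (q, c, x))%:E =
  (traj_aff i q c)%:E.
Proof.
rewrite integral_traj_measure; last 2 first.
- by move=> x; rewrite lee_fin sqrt_lr_ge0.
- apply/measurable_EFinP.
  exact: measurableT_comp (measurable_sqrt_lr i) (pair1_measurable _).
rewrite -integral_sqrt_traj_dens; apply: eq_integral => y _.
rewrite -EFinM; congr (_%:E); rewrite /sqrt_lr /traj_dens/=.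
set u := traj_dens_from f i _ _ _ _ _; set v := traj_dens_from f star _ _ _ _ _.
have v0 : (0 <= v)%R by exact: traj_dens_ge0.
(* Where the true density vanishes, so does the integrand of the affinity, in agreement with the
   convention for division by 0. *)
rewrite -{1}(sqr_sqrtr v0); have [->|vN0] := eqVneq (Num.sqrt v) 0%R.
  by rewrite expr0n/= mul0r mulr0.
by field.
Qed.

Lemma measurable_traj_aff i :
  measurable_fun setT (fun qc : policy * X => traj_aff i qc.1 qc.2).
Proof.
apply/measurable_EFinP.
rewrite (_ : _ \o _ = fun qc : policy * X =>
    \int[traj_measure s1 f star qc.1 qc.2]_x (sqrt_lr i (qc, x))%:E).
  apply: (@measurable_traj_integral _ _ _ _ _ _ s1 _ _ f star
    (fun z => (sqrt_lr i z)%:E)).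
    by move=> z; rewrite lee_fin sqrt_lr_ge0.
  by apply/measurable_EFinP; exact: measurable_sqrt_lr.
by apply/funext => -[q c]; rewrite integral_sqrt_lr.
Qed.

Variable b : R.
Local Notation Ob := (g_sigma_algebraType (hist Z b)).
Variable kap : R.-pker (Ob * X) ~> policy.

Definition mean_aff i (w : Ob) : R :=
  fine (\int[D]_c \int[kap (w, c)]_q (traj_aff i q c)%:E).

Lemma measurable_kap_aff i : measurable_fun setT
  (fun wc : Ob * X => \int[kap wc]_q (traj_aff i q wc.2)%:E).
Proof.
apply: (measurable_kernel_integral kap (g := fun z => (traj_aff i z.1 z.2)%:E)).
  by move=> z; rewrite lee_fin traj_aff_ge0.
by apply/measurable_EFinP; exact: measurable_traj_aff.
Qed.

Let kap_aff_ge0 i wc : 0 <= \int[kap wc]_q (traj_aff i q wc.2)%:E.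
Proof. by apply: integral_ge0 => q _; rewrite lee_fin traj_aff_ge0. Qed.

Let kap_aff_le1 i wc : \int[kap wc]_q (traj_aff i q wc.2)%:E <= 1.
Proof.
have : 0 <= \int[kap wc]_q (traj_aff i q wc.2)%:E <= 1.
  apply: (integral_probability_le1 (kernel_prob kap wc)
    (g := fun q => traj_aff i q wc.2)) => [|q].
    exact: (measurable_fun_pair1 _ (measurable_traj_aff i)).
  by rewrite traj_aff_ge0 traj_aff_le1.
by case/andP.
Qed.

Let mean_aff_le1' i w : \int[D]_c \int[kap (w, c)]_q (traj_aff i q c)%:E <= 1.
Proof.
rewrite -(integral_probability_cst D 1); apply: ge0_le_integral => //.
exact: (measurable_fun_pair2 _ (measurable_kap_aff i)).
Qed.

Lemma mean_affE i w :
  \int[D]_c \int[kap (w, c)]_q (traj_aff i q c)%:E = (mean_aff i w)%:E.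
Proof.
rewrite /mean_aff fineK// ge0_fin_numE ?(le_lt_trans (mean_aff_le1' _ _)) ?ltry//.
by apply: integral_ge0 => c _; exact: (kap_aff_ge0 i (w, c)).
Qed.

Lemma mean_aff_ge0 i w : (0 <= mean_aff i w)%R.
Proof.
rewrite -lee_fin -mean_affE.
by apply: integral_ge0 => c _; exact: (kap_aff_ge0 i (w, c)).
Qed.

Lemma mean_aff_le1 i w : (mean_aff i w <= 1)%R.
Proof. by rewrite -lee_fin -mean_affE. Qed.

Lemma measurable_mean_aff i : measurable_fun [set: Ob] (mean_aff i).
Proof.
apply/measurable_EFinP.
rewrite (_ : _ \o _ = fun w : Ob =>
    \int[D]_c (fun wc : Ob * X => \int[kap wc]_q (traj_aff i q wc.2)%:E) (w, c)).
  exact: (@measurable_fun_fubini_tonelli_F _ _ _ _ _ D _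
    (measurable_kap_aff i) (kap_aff_ge0 i)).
by apply/funext => w; rewrite /= -mean_affE.
Qed.

End likelihood_ratio.

Lemma measurable_prod_seq d (T : measurableType d) (R : realType) (J : eqType)
    (s : seq J) (F : J -> T -> R) :
  (forall j, j \in s -> measurable_fun setT (F j)) ->
  measurable_fun setT (fun x => \prod_(j <- s) F j x).
Proof.
elim: s => [_|j s IH mF].
  by under eq_fun do rewrite big_nil; exact: measurable_cst.
under eq_fun do rewrite big_cons; apply: measurable_funM.
  by apply: mF; rewrite inE eqxx.
by apply: IH => k ks; apply: mF; rewrite inE ks orbT.
Qed.

Lemma sqrtr_prod (R : realType) (J : Type) (s : seq J) (F : J -> R) :
  (forall j, 0 <= F j) ->
  \prod_(j <- s) Num.sqrt (F j) = Num.sqrt (\prod_(j <- s) F j).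
Proof.
move=> F0; elim: s => [|j s IH]; first by rewrite !big_nil sqrtr1.
by rewrite !big_cons sqrtrM// IH.
Qed.

Section segments.
Local Open Scope ereal_scope.
Context {R : realType} {d dO : measure_display} {X : measurableType d}.
Context {S A : pfinType} {H : nat} {Omega : measurableType dO}.
Local Notation policy := (policy R S A H).
Local Notation trajectory := (trajectory R S A).
Variables (P : probability Omega R) (D : probability X R) (s1 : S).
Context {I : finType} {Ms : I -> model R X S A H}.
Variables (f : densities Ms) (star : I) (Z : process R X S A H Omega).
Variables (b : R) (kappa : Omega -> X -> set policy -> \bar R).
Local Notation Ob := (g_sigma_algebraType (hist Z b)).
Variable kap : R.-pker (Ob * X) ~> policy.
Hypothesis kapE : forall w c U, measurable U -> kappa w c U = kap (w, c) U.

Local Notation b_ i := (mean_aff D s1 f star kap i).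
Local Notation obs t w := (pol Z t w, ctx Z t w, trj Z t w).
Local Notation L i t w := (sqrt_lr s1 f star i (obs t w)).

Lemma measurable_obs t (c : R) : (0 < t)%N -> (t%:R <= c)%R ->
  measurable_fun [set: g_sigma_algebraType (hist Z c)]
    (fun w : g_sigma_algebraType (hist Z c) => obs t w).
Proof.
move=> t0 tc; have sub F : (sigma_ctx Z t `|` sigma_pol Z t `|` sigma_trj Z t) F ->
    <<s hist Z c >> F.
  by move=> Ft; apply: sub_sigma_algebra; exists t.
apply: measurable_fun_pair; first apply: measurable_fun_pair.
- by apply: measurable_fun_preimage_gen => F Ft; apply: sub; left; right.
- by apply: measurable_fun_preimage_gen => F Ft; apply: sub; left; left.
- by apply: measurable_fun_preimage_gen => F Ft; apply: sub; right.
Qed.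

(** All rounds share a kernel fixed at time [b], and [b <= t.-1] makes that kernel known before
    round [t]. The order allows the rounds to be integrated out from the last one on. *)
Definition is_segment (ts : seq nat) := sorted ltn ts /\
  forall t, t \in ts -> [/\ (0 < t)%N, (b <= t.-1%:R)%R &
    round P D s1 (Ms star) Z t kappa].

(** The last round is integrated out first. Its conditional mean [b_ i] is known at time [b]
    already, so it joins the weight [W], which is why the induction needs a general [W]. *)
Lemma integral_prod_sqrt_lr i (W : Omega -> \bar R) ts : is_segment ts ->
  (forall w, 0 <= W w) -> measurable_fun [set: Ob] (W : Ob -> \bar R) ->
  \int[P]_w (W w * (\prod_(t <- ts) L i t w)%:E) =
  \int[P]_w (W w * (b_ i w ^+ size ts)%:E).
Proof.
elim/last_ind: ts W => [|ts t IH] W [sts tsP] W0 mW.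
  by apply: eq_integral => w _; rewrite big_nil.
have [t0 bt rt] : [/\ (0 < t)%N, (b <= t.-1%:R)%R &
    round P D s1 (Ms star) Z t kappa] by apply: tsP; rewrite mem_rcons inE eqxx.
have tst u : u \in ts -> (u < t)%N.
  move=> uts; move: sts; rewrite (sorted_pairwise ltn_trans).
  by rewrite -cats1 pairwise_cat => /and3P[/allrelP/(_ u t uts)]; rewrite inE eqxx => ->.
have segts : is_segment ts.
  split; first by move: sts; rewrite -cats1 => /cat_sorted2[].
  by move=> u uts; apply: tsP; rewrite mem_rcons inE uts orbT.
pose V w := W w * (\prod_(u <- ts) L i u w)%:E.
have LP0 w : (0 <= \prod_(u <- ts) L i u w)%R.
  by apply: prodr_ge0 => u _; exact: sqrt_lr_ge0.
have V0 w : 0 <= V w by rewrite mule_ge0// lee_fin.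
have mV : measurable_fun [set: g_sigma_algebraType (hist Z t.-1%:R)]
    (V : g_sigma_algebraType (hist Z t.-1%:R) -> \bar R).
  apply: emeasurable_funM.
    by apply: measurable_fun_gen_sub mW; exact: hist_mono.
  apply/measurable_EFinP; apply: measurable_prod_seq => u uts.
  apply: measurableT_comp (measurable_sqrt_lr s1 f star i) _.
  have [u0 _ _] : [/\ (0 < u)%N, (b <= u.-1%:R)%R &
    round P D s1 (Ms star) Z u kappa] by apply: tsP; rewrite mem_rcons inE uts orbT.
  apply: measurable_obs => //; rewrite ler_nat -ltnS prednK//.
  exact: tst.
transitivity (\int[P]_w (V w * (L i t w)%:E)).
  by apply: eq_integral => w _; rewrite big_rcons EFinM muleA.
rewrite (round_integral f (hist_mono bt) kapE rt V0 mV
  (g := fun z => (sqrt_lr s1 f star i z)%:E))//; last 2 first.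
- by move=> z; rewrite lee_fin sqrt_lr_ge0.
- by apply/measurable_EFinP; exact: measurable_sqrt_lr.
transitivity (\int[P]_w ((W w * (b_ i w)%:E) * (\prod_(u <- ts) L i u w)%:E)).
  apply: eq_integral => w _; rewrite /V muleAC; congr (_ * _ * _).
  rewrite -mean_affE; apply: eq_integral => c _; apply: eq_integral => q _.
  by rewrite integral_sqrt_lr.
rewrite IH//; last 2 first.
- by move=> w; rewrite mule_ge0// lee_fin mean_aff_ge0.
- apply: emeasurable_funM => //; apply/measurable_EFinP.
  exact: measurable_mean_aff.
by apply: eq_integral => w _; rewrite -muleA -EFinM size_rcons exprS.
Qed.

(** In each round the trajectory follows the true law, which does not charge the zeros of its own
    density. *)
Lemma ae_dens_gt0 ts : is_segment ts ->
  {ae P, forall w, forall t, t \in ts ->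
    (0 < traj_dens s1 f star (pol Z t w) (ctx Z t w) (trj Z t w))%R}.
Proof.
move=> [_ tsP].
apply: ae_foralln => t.
have [|tNts] := boolP (t \in ts); last exact: aeW.
move=> /tsP[t0 bt rt].
pose z0 := [set z : policy * X * trajectory | traj_dens s1 f star z.1.1 z.1.2 z.2 = 0%R].
have mz0 : measurable z0.
  have := measurable_traj_dens f star (enum 'I_H) s1 measurableT (measurable_set1 0%R).
  by rewrite setTI.
have mobs : measurable_fun [set: Omega] (fun w => obs t w).
  by repeat apply: measurable_fun_pair; exact: measurable_funPT.
exists ((fun w => obs t w) @^-1` z0); split.
- by rewrite -[X in measurable X]setTI; exact: mobs.
- transitivity (\int[P]_w (1 * (\1_z0 (obs t w))%:E)).
    under eq_integral do rewrite mul1e.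
    rewrite -[LHS](congr1 P (setIT _)) -integral_indic//.
    by rewrite -[X in measurable X]setTI; exact: mobs.
  rewrite (round_integral f (hist_mono bt) kapE rt (V := fun=> 1)
    (g := fun z => (\1_z0 z)%:E))//; last first.
    by apply/measurable_EFinP; exact: measurable_indic.
  apply: integral0_eq => w _; rewrite mul1e.
  apply: integral0_eq => c _; apply: integral0_eq => q _.
  rewrite -(traj_measure_dens0 s1 f star q c) -(setIT [set x | _]).
  rewrite -integral_indic//.
  rewrite -[X in measurable X]setTI.
  exact: (measurable_traj_dens_sect f star q c (enum 'I_H) s1 measurableT (measurable_set1 _)).
- move=> w /=; apply: contra_notP => /eqP; rewrite /z0/= => ne _.
  by rewrite lt_neqAle eq_sym ne traj_dens_ge0.
Qed.

(* On the event that the estimate is [i] the likelihood ratio of [i] to the true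
   model is at least 1, so its square root, of conditional mean [b_ i] in each
   round, bounds the indicator of this event. *)
Lemma mle_exp_moment (est : Omega -> I) (W : Omega -> \bar R) ts :
  is_segment ts -> (forall i, measurable [set w | est w = i]) ->
  (forall w, is_mle s1 Z f ts w (est w)) ->
  (forall w, 0 <= W w) -> measurable_fun [set: Ob] (W : Ob -> \bar R) ->
  \int[P]_w (W w * (expR ((size ts)%:R * (1 - b_ (est w) w)))%:E) <=
  (#|I|%:R)%:E * \int[P]_w W w.
Proof.
move=> segts mest mle W0 mW; set n := size ts.
pose V i w := W w * (expR (n%:R * (1 - b_ i w)))%:E.
have V0 i w : 0 <= V i w by rewrite mule_ge0// lee_fin expR_ge0.
have mV i : measurable_fun [set: Ob] (V i : Ob -> \bar R).
  apply: emeasurable_funM => //; apply/measurable_EFinP.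
  apply: measurableT_comp => //; apply: measurable_funM => //.
  by apply: measurable_funB => //; exact: measurable_mean_aff.
have mO (F : Omega -> \bar R) : measurable_fun [set: Ob] (F : Ob -> \bar R) ->
    measurable_fun [set: Omega] F.
  move=> mF _ B mB; rewrite setTI; apply: (@hist_measurable _ _ _ _ _ _ _ _ Z b).
  by have := mF measurableT B mB; rewrite setTI.
have mE i : measurable_fun [set: Omega] (fun w => (\1_[set w | est w = i] w)%:E : \bar R).
  by apply/measurable_EFinP; exact: measurable_indic.
have mL i : measurable_fun [set: Omega] (fun w => (\prod_(t <- ts) L i t w)%:E).
  apply/measurable_EFinP; apply: measurable_prod_seq => t tts.
  apply: measurableT_comp (measurable_sqrt_lr s1 f star i) _.
  by repeat apply: measurable_fun_pair; exact: measurable_funPT.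
(* The estimate depends on the data of the segment, whereas the moment is known for a fixed model
   only. Splitting along the value of the estimate produces the factor [#|I|]. *)
rewrite [leLHS](_ : _ =
    \int[P]_w \sum_i (V i w * (\1_[set w | est w = i] w)%:E)); last first.
  apply: eq_integral => w _; rewrite (bigD1 (est w))//= big1 ?adde0.
    by rewrite indicE mem_set//= mule1.
  by move=> i /eqP ne; rewrite indicE memNset ?mule0//= => /esym.
rewrite ge0_integral_sum//; last 2 first.
- by move=> i; apply: emeasurable_funM => //; exact: mO.
- by move=> i w _; rewrite mule_ge0.
rewrite (_ : #|I|%:R%:E * _ = \sum_(i : I) \int[P]_w W w); last first.
  by rewrite sumr_const mule_natl.
apply: lee_sum => i _.
apply: (@le_trans _ _ (\int[P]_w (V i w * (\prod_(t <- ts) L i t w)%:E))).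
  apply: ae_ge0_le_integral => //.
  - by move=> w _; rewrite mule_ge0.
  - by apply: emeasurable_funM => //; exact: mO.
  - by move=> w _; rewrite mule_ge0// lee_fin prodr_ge0// => t _; exact: sqrt_lr_ge0.
  - by apply: emeasurable_funM => //; exact: mO.
  - have := ae_dens_gt0 segts; apply: filterS => w dpos _.
    rewrite lee_wpmul2l// lee_fin indicE; case: (boolP (w \in _)); last first.
      by move=> _; apply: prodr_ge0 => t _; exact: sqrt_lr_ge0.
    rewrite in_setE/= => Ei; have := mle w star; rewrite {}Ei.
    have -> : (\prod_(t <- ts) L i t w =
      \prod_(t <- ts) Num.sqrt (traj_dens s1 f i (pol Z t w) (ctx Z t w) (trj Z t w)) /
      \prod_(t <- ts) Num.sqrt (traj_dens s1 f star (pol Z t w) (ctx Z t w) (trj Z t w)))%R.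
      by rewrite -prodf_div.
    rewrite !sqrtr_prod; try by move=> t; exact: traj_dens_ge0.
    move=> le; rewrite ler_pdivlMr ?mul1r ?ler_wsqrtr// sqrtr_gt0.
    by rewrite big_seq; apply: prodr_gt0 => t tts; exact: dpos.
rewrite integral_prod_sqrt_lr//; apply: ge0_le_integral => //.
- by move=> w _; rewrite mule_ge0// lee_fin exprn_ge0// mean_aff_ge0.
- apply: emeasurable_funM; first exact: mO.
  apply: mO; apply/measurable_EFinP/measurable_funX; exact: measurable_mean_aff.
- exact: mO.
- move=> w _; rewrite /V -muleA -EFinM -[leRHS]mule1 lee_wpmul2l//.
  by rewrite lee_fin exp_mul_le1// mean_aff_ge0.
Qed.

End segments.

Lemma measurable_fun_fin_select d (T : measurableType d) (R : realType)
    (I : finType) (est : T -> I) (F : I -> T -> R) :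
  (forall i, measurable [set x | est x = i]) ->
  (forall i, measurable_fun setT (F i)) ->
  measurable_fun setT (fun x => F (est x) x).
Proof.
move=> mest mF; rewrite (_ : (fun _ => _) = fun x =>
    \sum_i (\1_[set x | est x = i] x * F i x)); last first.
  apply/funext => x; rewrite (bigD1 (est x))//= big1 ?addr0.
    by rewrite indicE mem_set// mul1r.
  by move=> i /eqP ne; rewrite indicE memNset ?mul0r//= => /esym.
by apply: measurable_sum => i; apply: measurable_funM => //; exact: measurable_indic.
Qed.

Lemma integral_onem d (T : measurableType d) (R : realType)
    (mu : {measure set T -> \bar R}) (g : T -> R) (a : R) :
  mu setT = 1%E -> measurable_fun setT g -> (forall x, 0 <= g x <= 1) ->
  (\int[mu]_x (g x)%:E = a%:E -> \int[mu]_x (1 - g x)%:E = (1 - a)%:E)%E.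
Proof.
move=> mu1 mg g01 ga.
have : (\int[mu]_x (1 - g x)%:E + \int[mu]_x (g x)%:E = 1)%E.
  rewrite -ge0_integralD//.
  - under eq_integral do rewrite -EFinD subrK.
    by rewrite integral_cst// mul1e.
  - by move=> x _; rewrite lee_fin subr_ge0; case/andP: (g01 x).
  - by apply/measurable_EFinP; exact: measurable_funB.
  - by move=> x _; rewrite lee_fin; case/andP: (g01 x).
  - exact/measurable_EFinP.
by rewrite ga => E; rewrite EFinB -E addeK.
Qed.

(** Markov's inequality at level [a], read on the complementary event. *)
Lemma probability_le_moment d (T : measurableType d) (R : realType)
    (P : probability T R) (g : T -> R) (a del : R) :
  0 < a -> measurable_fun setT g -> (forall x, 0 <= g x) ->
  (\int[P]_x (g x)%:E <= (del * a)%:E ->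
   (1 - del)%:E <= P [set x | (g x <= a)%R])%E.
Proof.
move=> a0 mg g0 ga.
have mA : measurable [set x | g x <= a].
  rewrite -[X in measurable X]setTI.
  exact: (measurable_fun_ler mg (measurable_cst a) measurableT (Y := [set true])).
have PC : (P (~` [set x | (g x <= a)%R]) <= del%:E)%E.
  rewrite -(@lee_pmul2l _ a%:E)//.
  rewrite -EFinM mulrC (le_trans _ ga)//.
  rewrite -(setIT (~` _)) -integral_indic//; last exact: measurableC.
  rewrite -ge0_integralZl//; last 2 first.
  - by apply/measurable_EFinP; exact/measurable_indic/measurableC.
  - by rewrite lee_fin ltW.
  apply: ge0_le_integral => //.
  - by move=> x _; rewrite mule_ge0// lee_fin ltW.
  - by apply: measurable_funeM; apply/measurable_EFinP; exact/measurable_indic/measurableC.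
  - exact/measurable_EFinP.
  - move=> x _; rewrite indicE; case: (boolP (x \in _)); rewrite ?mule0 ?lee_fin//.
    by rewrite in_setE/= => /negP; rewrite -ltNge mulr1 => /ltW.
rewrite -[X in P X]setCK probability_setC ?EFinB; last exact: measurableC.
by rewrite leeB.
Qed.

Section hellinger_gap.
Local Open Scope ereal_scope.
Context {R : realType} {d d1 : measure_display} {X : measurableType d}.
Context {S A : pfinType} {H : nat} {T : measurableType d1}.
Local Notation policy := (policy R S A H).
Variables (D : probability X R) (s1 : S).
Context {I : finType} {Ms : I -> model R X S A H}.
Variables (f : densities Ms) (star : I) (kap : R.-pker (T * X) ~> policy).

(* Mean squared Hellinger distance over the policies drawn in a context. *)
Definition hell_gap i (wc : T * X) : R :=
  fine (\int[kap wc]_q (1 - traj_aff s1 f star i q wc.2)%:E).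

Lemma measurable_traj_aff_pol i c :
  measurable_fun setT (fun q : policy => traj_aff s1 f star i q c).
Proof. exact: measurable_fun_pair1 (measurable_traj_aff s1 f star i). Qed.

Let gap01 i wc :
  0 <= \int[kap wc]_q (1 - traj_aff s1 f star i q wc.2)%:E <= 1.
Proof.
apply: (integral_probability_le1 (kernel_prob kap wc)
  (g := fun q => 1 - traj_aff s1 f star i q wc.2)%R).
- by apply: measurable_funB => //; exact: measurable_traj_aff_pol.
- by move=> q; rewrite subr_ge0 traj_aff_le1 gerBl traj_aff_ge0.
Qed.

Lemma hell_gapE i wc :
  \int[kap wc]_q (1 - traj_aff s1 f star i q wc.2)%:E = (hell_gap i wc)%:E.
Proof.
have /andP[g0 g1] := gap01 i wc.
by rewrite /hell_gap fineK// ge0_fin_numE// (le_lt_trans g1) ?ltry.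
Qed.

Lemma hell_gap01 i wc : (0 <= hell_gap i wc <= 1)%R.
Proof. by rewrite -!lee_fin -hell_gapE gap01. Qed.

Lemma measurable_hell_gap i : measurable_fun setT (hell_gap i).
Proof.
apply/measurable_EFinP.
rewrite (_ : _ \o _ =
  fun wc => \int[kap wc]_q (1 - traj_aff s1 f star i q wc.2)%:E); last first.
  by apply/funext => wc; rewrite /= -hell_gapE.
apply: (measurable_kernel_integral kap
  (g := fun z => (1 - traj_aff s1 f star i z.1 z.2)%:E)).
  by move=> z; rewrite lee_fin subr_ge0 traj_aff_le1.
apply/measurable_EFinP; apply: measurable_funB => //.
exact: measurable_traj_aff.
Qed.

End hellinger_gap.

Section mean_hellinger_gap.
Local Open Scope ereal_scope.
Context {R : realType} {d dO : measure_display} {X : measurableType d}.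
Context {S A : pfinType} {H : nat} {Omega : measurableType dO}.
Local Notation policy := (policy R S A H).
Variables (D : probability X R) (s1 : S).
Context {I : finType} {Ms : I -> model R X S A H}.
Variables (f : densities Ms) (star : I) (Z : process R X S A H Omega) (b : R).
Local Notation Ob := (g_sigma_algebraType (hist Z b)).
Variable kap : R.-pker (Ob * X) ~> policy.

Lemma hell_gap_kap_aff i wc : \int[kap wc]_q (traj_aff s1 f star i q wc.2)%:E =
  (1 - hell_gap s1 f star kap i wc)%:E.
Proof.
rewrite -(integral_onem _ _ _ (hell_gapE s1 f star kap i wc)).
- by apply: eq_integral => q _; rewrite opprB addrC subrK.
- exact: prob_kernel.
- by apply: measurable_funB => //; exact: measurable_traj_aff_pol.
- by move=> q; rewrite subr_ge0 traj_aff_le1 gerBl traj_aff_ge0.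
Qed.

Lemma integral_hell_gap i w : \int[D]_c (hell_gap s1 f star kap i (w, c))%:E =
  (1 - mean_aff D s1 f star kap i w)%:E.
Proof.
have mg : measurable_fun setT (fun c => (1 - hell_gap s1 f star kap i (w, c))%R).
  apply: measurable_funB => //.
  exact: measurable_fun_pair2 (measurable_hell_gap s1 f star kap i).
rewrite -(integral_onem (mu := D) _ mg _ (a := mean_aff D s1 f star kap i w)).
- by apply: eq_integral => c _; rewrite opprB addrC subrK.
- exact: probability_setT.
- by move=> c; rewrite subr_ge0 gerBl andbC; exact: hell_gap01.
- by rewrite -mean_affE; apply: eq_integral => c _; rewrite -hell_gap_kap_aff.
Qed.

End mean_hellinger_gap.

(** Markov's inequality at level [#|I| / delta], applied to the exponential of [n] times the error,
    bounds the latter by [ln (#|I| / delta)]; hence the constant 1. *)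
Lemma mle_is_oracle1 (R : realType) : mle_is_oracle (1 : R).
Proof.
move=> d dO X S A H s1 D I Ms star f n p Omega P Z est delta /andP[d0 d2] rnd mest mle.
(* The policies are drawn independently of the past, so the segment may start at time 0 with a
   kernel constant in the outcome. *)
pose kf (wc : g_sigma_algebraType (hist Z 0) * X) := kernel_prob p wc.2.
have mkf U : measurable U -> measurable_fun setT (fun wc => kf wc U).
  by move=> mU; exact: (measurableT_comp (measurable_kernel p U mU) measurable_snd).
pose kap := pker_of mkf.
have kapE w c U : measurable U -> p c U = kap (w, c) U by [].
pose b i := mean_aff D s1 f star (kap : R.-pker _ ~> _) i.
have hellE w : (\int[D]_c \int[p c]_q hellinger2 s1 f (est w) star q c =
    (1 - b (est w) w)%:E)%E.
  rewrite -integral_hell_gap; apply: eq_integral => c _.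
  rewrite -(hell_gapE s1 f star kap (est w) (w, c)); apply: eq_integral => q _.
  exact: hellinger2E.
(* Without data the error function is 1, which bounds every squared Hellinger distance. *)
have [->|n0] := eqVneq n 0%N.
  rewrite (_ : [set _ | _] = setT) ?probability_setT ?lee_fin; first by lra.
  apply/seteqP; split => // w _ /=; rewrite hellE /mle_error eqxx lee_fin.
  by rewrite gerBl mean_aff_ge0.
have K0 : 0 < #|I|%:R :> R by rewrite ltr0n; apply/card_gt0P; exists star.
rewrite (_ : [set _ | _] =
    [set w | expR (n%:R * (1 - b (est w) w)) <= #|I|%:R / delta]); last first.
  apply/seteqP; split => w /=; rewrite hellE /mle_error pnatr_eq0 (negbTE n0) mul1r lee_fin.
    rewrite ler_pdivlMr ?ltr0n ?lt0n// mulrC => le.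
    by rewrite -[leRHS]lnK ?posrE ?divr_gt0// ler_expR.
  rewrite -[leRHS]lnK ?posrE ?divr_gt0// ler_expR => le.
  by rewrite ler_pdivlMr ?ltr0n ?lt0n// mulrC.
have segn : is_segment P D s1 star Z 0 (fun _ c => p c) (iota 1 n) (Ms := Ms).
  split; first exact: iota_ltn_sorted.
  by move=> t; rewrite mem_iota add1n ltnS => /andP[t0 tn]; split => //; apply: rnd; rewrite t0.
apply: probability_le_moment.
- by rewrite divr_gt0.
- apply: measurableT_comp => //; apply: measurable_funM => //.
  apply: measurable_funB => //; apply: measurable_fun_fin_select => // i.
  move=> _ B mB; rewrite setTI; apply: (@hist_measurable _ _ _ _ _ _ _ _ Z 0).
  by have := measurable_mean_aff D s1 f star kap i measurableT mB; rewrite setTI.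
- by move=> w; exact: expR_ge0.
have := mle_exp_moment (kappa := fun _ c => p c) (kap := kap) kapE (W := fun=> 1%E) segn mest mle.
rewrite size_iota => /(_ (fun=> lee01) (measurable_cst _)) le.
rewrite mulrC divfK ?gt_eqF// (le_trans _ (le_trans le _))//.
  by under [leRHS]eq_integral do rewrite mul1e.
rewrite integral_cst// mul1e -[leRHS]mule1 lee_wpmul2l//.
exact: probability_le1.
Qed.

(** * Values and optimal policies *)

Section values.
Context {R : realType} {d : measure_display} {X : measurableType d}.
Context {S A : pfinType} {H : nat}.
Local Notation trajectory := (trajectory R S A).
Local Notation policy := (policy R S A H).
Local Notation model := (model R X S A H).
Implicit Types (M : model) (p q : policy) (c : X) (hs : seq 'I_H) (s : S).

Definition clip01 (r : R) : R := Num.max 0 (Num.min r 1).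

Lemma clip01_ge0 r : 0 <= clip01 r.
Proof. by rewrite /clip01 le_max lexx. Qed.

Lemma clip01_le1 r : clip01 r <= 1.
Proof. by rewrite /clip01 ge_max ler01 ge_min lexx orbT. Qed.

Lemma clip01_id r : 0 <= r <= 1 -> clip01 r = r.
Proof. by case/andP => r0 r1; rewrite /clip01 min_l// max_r. Qed.

Lemma measurable_clip01 : measurable_fun setT clip01.
Proof.
by apply: measurable_maxr => //; apply: measurable_minr.
Qed.

(* Clipping changes nothing, as rewards lie in [0, 1], and bounds the integrand. *)
Definition mean_rew (l : layer X S A) s (a : A) c : R :=
  fine (\int[rew l s a c]_r (clip01 r)%:E)%E.

Lemma mean_rewE (l : layer X S A) s a c :
  (\int[rew l s a c]_r (clip01 r)%:E = (mean_rew l s a c)%:E)%E.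
Proof.
have /andP[g0 g1] : (0 <= \int[rew l s a c]_r (clip01 r)%:E <= 1)%E.
  apply: (integral_probability_le1 (kernel_prob (rew l s a) c)).
    exact: measurable_clip01.
  by move=> r; rewrite clip01_ge0 clip01_le1.
by rewrite /mean_rew fineK// ge0_fin_numE// (le_lt_trans g1) ?ltry.
Qed.

Lemma mean_rew01 (l : layer X S A) s a c : 0 <= mean_rew l s a c <= 1.
Proof.
rewrite -!lee_fin -mean_rewE.
apply: (integral_probability_le1 (kernel_prob (rew l s a) c)).
- exact: measurable_clip01.
- by move=> r; rewrite clip01_ge0 clip01_le1.
Qed.

Lemma ae_rew01 (l : layer X S A) s a c :
  {ae rew l s a c, forall r, r = clip01 r}.
Proof.
exists (~` `[0, 1]%classic); split; first exact: measurableC.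
  have := @probability_setC _ _ _ (kernel_prob (rew l s a) c) `[0, 1]%classic (measurable_itv _).
  by rewrite /kernel_prob rew01 subee.
by move=> r /=; apply: contra_not => /itvP r01; rewrite clip01_id// !r01.
Qed.

Lemma integral_rew_affine (l : layer X S A) s a c (K : R) :
  (\int[rew l s a c]_r (K + r)%:E = (K + mean_rew l s a c)%:E)%E.
Proof.
have mc := measurable_clip01.
have ic : (rew l s a c).-integrable setT (EFin \o clip01).
  apply/integrableP; split; first exact/measurable_EFinP.
  under eq_integral do rewrite /= ger0_norm ?clip01_ge0//.
  by rewrite mean_rewE ltry.
have iK : (rew l s a c).-integrable setT (EFin \o cst K).
  exact: (finite_measure_integrable_cst (kernel_prob (rew l s a) c) K).
transitivity (\int[rew l s a c]_r ((cst K r)%:E + (clip01 r)%:E))%E.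
  apply: ae_eq_integral => //.
  - by apply/measurable_EFinP; apply: measurable_funD.
  - by apply: emeasurable_funD; apply/measurable_EFinP.
  - by apply: filterS (ae_rew01 l s a c) => r rE _; rewrite {1}rE EFinD.
by rewrite integralD//= mean_rewE integral_cst// prob_kernel mule1 -EFinD.
Qed.

Fixpoint value_from M p c hs s : R :=
  if hs is h :: hs' then
    \sum_a pol_prob p h s a * (mean_rew (M h) s a c +
      \sum_s' trans (M h) s a c s' * value_from M p c hs' s')
  else 0.

Lemma expect_total_reward M p c hs s x :
  expect_from M p c (fun x => (total_reward x)%:E) hs s x =
  (total_reward x + value_from M p c hs s)%:E.
Proof.
elim: hs s x => [|h hs IH] s x; first by rewrite /= addr0.
have -> : (total_reward x + value_from M p c (h :: hs) s)%:E =
    (\sum_a (pol_prob p h s a)%:E * (total_reward x + (mean_rew (M h) s a c +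
      \sum_s' trans (M h) s a c s' * value_from M p c hs s'))%:E)%E.
  under [RHS]eq_bigr do rewrite -EFinM.
  rewrite sumEFin /=; congr (_%:E).
  under [RHS]eq_bigr do rewrite mulrDr.
  by rewrite big_split/= -mulr_suml pol_prob_sum1 mul1r.
rewrite /=; apply: eq_bigr => a _; congr (_ * _)%E.
transitivity (\int[rew (M h) s a c]_r ((total_reward x +
   \sum_s' trans (M h) s a c s' * value_from M p c hs s') + r)%:E)%E.
  apply: eq_integral => r _; under eq_bigr do rewrite IH -EFinM.
  rewrite sumEFin; congr (_%:E).
  under eq_bigr do rewrite mulrDr.
  rewrite big_split/= -mulr_suml trans_sum1 mul1r /total_reward.
  by rewrite big_rcons/= addrAC.
by rewrite integral_rew_affine; congr (_%:E); rewrite -addrA [X in _ + X]addrC.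
Qed.

Lemma valueE (s1 : S) M p c : value s1 M p c = value_from M p c (enum 'I_H) s1.
Proof.
by rewrite /value /expect expect_total_reward /= /total_reward big_nil add0r.
Qed.

Lemma value_from_bound M p c hs s : 0 <= value_from M p c hs s <= (size hs)%:R.
Proof.
elim: hs s => [|h hs IH] s; first by rewrite lexx.
have Q a : 0 <= mean_rew (M h) s a c +
    \sum_s' trans (M h) s a c s' * value_from M p c hs s' <= (size (h :: hs))%:R.
  have /andP[r0 r1] := mean_rew01 (M h) s a c.
  apply/andP; split.
    rewrite addr_ge0// sumr_ge0// => s' _; rewrite mulr_ge0 ?trans_ge0//.
    by case/andP: (IH s').
  rewrite /= -natr1 addrC lerD// -[leRHS]mul1r -{1}(trans_sum1 (M h) s a c) mulr_suml.
  apply: ler_sum => s' _; rewrite ler_wpM2l ?trans_ge0//.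
  by case/andP: (IH s').
apply/andP; split.
  by apply: sumr_ge0 => a _; rewrite mulr_ge0 ?pol_prob_ge0//; case/andP: (Q a).
rewrite -[leRHS]mul1r -{1}(pol_prob_sum1 p h s) mulr_suml.
by apply: ler_sum => a _; rewrite ler_wpM2l ?pol_prob_ge0//; case/andP: (Q a).
Qed.

(** Bellman's optimality recursion; the default 0 of the maximum is harmless, as values are
    nonnegative. *)
Fixpoint opt_from M c hs s : R :=
  if hs is h :: hs' then
    \big[Num.max/0]_a (mean_rew (M h) s a c +
      \sum_s' trans (M h) s a c s' * opt_from M c hs' s')
  else 0.

Lemma value_from_le_opt M p c hs s : value_from M p c hs s <= opt_from M c hs s.
Proof.
elim: hs s => [//|h hs IH] s /=.
rewrite -[leRHS]mul1r -{1}(pol_prob_sum1 p h s) mulr_suml.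
apply: ler_sum => a _; rewrite ler_wpM2l ?pol_prob_ge0//.
apply: le_trans (le_bigmax _ _ a); rewrite lerD2l; apply: ler_sum => s' _.
by rewrite ler_wpM2l ?trans_ge0.
Qed.

Definition bellman_q M c (h : 'I_H) s (a : A) : R := mean_rew (M h) s a c +
  \sum_s' trans (M h) s a c s' * opt_from M c (drop h.+1 (enum 'I_H)) s'.

Definition bellman_ffun M c : {ffun 'I_H * S * A -> R} :=
  [ffun x => (x.2 == [arg max_(a > point) bellman_q M c x.1.1 x.1.2 a]%O)%:R].

Lemma is_policy_bellman M c : is_policy (bellman_ffun M c).
Proof.
apply/forallP => h; apply/forallP => s; apply/andP; split.
  by apply/forallP => a; rewrite ffunE ler0n.
set b := [arg max_(a > point) bellman_q M c h s a]%O.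
rewrite (bigD1 b) //= ffunE eqxx big1 ?addr0// => a /negbTE aN.
by rewrite ffunE /= aN.
Qed.

Definition bellman_policy M c : policy := Policy (is_policy_bellman M c).

Lemma value_bellman M c k s : (k <= H)%N ->
  value_from M (bellman_policy M c) c (drop k (enum 'I_H)) s =
  opt_from M c (drop k (enum 'I_H)) s.
Proof.
(* Backward induction, on the number [H - k] of remaining layers. *)
move=> kH; rewrite -(subKn kH); elim: (H - k)%N s (leq_subr k H) => [|n IH] s nH.
  by rewrite subn0 drop_oversize ?size_enum_ord.
have lt : (H - n.+1 < H)%N by rewrite ltn_subrL (leq_trans _ nH).
rewrite (drop_nth (Ordinal lt)) ?size_enum_ord//.
have -> : nth (Ordinal lt) (enum 'I_H) (H - n.+1) = Ordinal lt.
  exact: (nth_ord_enum (Ordinal lt) (Ordinal lt)).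
have E : drop (H - n.+1).+1 (enum 'I_H) = drop (H - n) (enum 'I_H).
  by rewrite -subSn.
set h := Ordinal lt; rewrite /= E.
set b := [arg max_(a > point) bellman_q M c h s a]%O.
under eq_bigr => a _ do under eq_bigr do rewrite IH ?(ltnW nH)//.
have qE a : mean_rew (M h) s a c + \sum_s' trans (M h) s a c s' *
    opt_from M c (drop (H - n) (enum 'I_H)) s' = bellman_q M c h s a.
  by rewrite /bellman_q -E.
under eq_bigr do rewrite qE.
under [RHS]eq_bigr do rewrite qE.
rewrite (bigD1 b)//= big1 ?addr0 => [|a /negbTE ab]; last first.
  by rewrite /pol_prob/= ffunE/= ab mul0r.
rewrite /pol_prob/= ffunE/= eqxx mul1r.
have bmax a : bellman_q M c h s a <= bellman_q M c h s b.
  by rewrite /b; case: arg_maxP => // a' _; exact.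
apply/le_anti/andP; split; first exact: (le_bigmax _ _ b).
apply/bigmax_leP; split=> //.
have /andP[r0 _] := mean_rew01 (M h) s b c.
rewrite addr_ge0//; apply: sumr_ge0 => s' _; rewrite mulr_ge0 ?trans_ge0//.
have /andP[v0 _] := value_from_bound M (bellman_policy M c) c (drop h.+1 (enum 'I_H)) s'.
exact: le_trans v0 (value_from_le_opt _ _ _ _ _).
Qed.

Variable s1 : S.

(** The supremum is attained by the greedy policy of the Bellman recursion. The recursive form also
    yields measurability in the context, which a supremum over uncountably many policies does
    not. *)
Lemma opt_valueE M c : opt_value s1 M c = opt_from M c (enum 'I_H) s1.
Proof.
have ub : ubound (range (fun p => value s1 M p c)) (opt_from M c (enum 'I_H) s1).
  by move=> _ [p _ <-]; rewrite valueE value_from_le_opt.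
apply/le_anti/andP; split.
  by apply: ge_sup => //; exists (value s1 M point c); exists point.
apply: sup_ubound; first by exists (opt_from M c (enum 'I_H) s1).
exists (bellman_policy M c) => //.
by rewrite valueE -[enum 'I_H]drop0 value_bellman.
Qed.

Lemma regret_ge0 M p c : 0 <= regret s1 M p c.
Proof. by rewrite /regret opt_valueE valueE subr_ge0 value_from_le_opt. Qed.

(** Estimated models glue layers of different outputs of the oracle, so the bound has to come from
    the rewards of the single layers, each at most 1. *)
Lemma regret_le M p c : regret s1 M p c <= H%:R.
Proof.
rewrite /regret opt_valueE -[enum _]drop0 -value_bellman// drop0 valueE.
have /andP[v0 _] := value_from_bound M p c (enum 'I_H) s1.
have /andP[_] := value_from_bound M (bellman_policy M c) c (enum 'I_H) s1.
rewrite size_enum_ord => v1.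
by rewrite (le_trans _ v1)// gerBl.
Qed.

Lemma regret_optimal M p c : is_optimal s1 M p c -> regret s1 M p c = 0.
Proof.
move=> opt; apply/le_anti; rewrite regret_ge0 andbT subr_le0.
rewrite opt_valueE -[enum _]drop0 -value_bellman// drop0 -valueE.
exact: opt.
Qed.

Lemma is_optimal_bellman M c : is_optimal s1 M (bellman_policy M c) c.
Proof.
move=> q; rewrite !valueE -[in leRHS](drop0 (enum _)) value_bellman// drop0.
exact: value_from_le_opt.
Qed.
Lemma measurable_mean_rew (l : layer X S A) s a :
  measurable_fun setT (mean_rew l s a).
Proof.
apply/measurable_EFinP.
rewrite (_ : _ \o _ = fun c => \int[rew l s a c]_r (clip01 r)%:E)%E.
  apply: (measurable_fun_integral_finite_kernel (fun z => (clip01 z.2)%:E) (rew l s a)).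
    by move=> z; rewrite lee_fin clip01_ge0.
  by apply/measurable_EFinP; exact: measurableT_comp measurable_clip01 measurable_snd.
by apply/funext => c; rewrite mean_rewE.
Qed.

Lemma measurable_value_from M hs s : measurable_fun setT
  (fun pc : policy * X => value_from M pc.1 pc.2 hs s).
Proof.
elim: hs s => [|h hs IH] s /=; first exact: measurable_cst.
apply: measurable_sum => a; apply: measurable_funM.
  exact: measurableT_comp (measurable_pol_prob _ _ _) measurable_fst.
apply: measurable_funD.
  exact: measurableT_comp (measurable_mean_rew _ _ _) measurable_snd.
apply: measurable_sum => s'; apply: measurable_funM => //.
exact: measurableT_comp (trans_meas _ _ _ _) measurable_snd.
Qed.

Lemma measurable_opt_from M hs s : measurable_fun setT (fun c => opt_from M c hs s).
Proof.
elim: hs s => [|h hs IH] s /=; first exact: measurable_cst.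
elim: (index_enum A) => [|a r IHr].
  by under eq_fun do rewrite big_nil; exact: measurable_cst.
under eq_fun do rewrite big_cons; apply: measurable_maxr => //.
apply: measurable_funD; first exact: measurable_mean_rew.
by apply: measurable_sum => s'; apply: measurable_funM => //; exact: trans_meas.
Qed.

Lemma measurable_regret M :
  measurable_fun setT (fun pc : policy * X => regret s1 M pc.1 pc.2).
Proof.
rewrite /regret; under eq_fun do rewrite opt_valueE valueE.
apply: measurable_funB; last exact: measurable_value_from.
exact: measurableT_comp (measurable_opt_from _ _ _) measurable_snd.
Qed.

End values.

(** * Comparison of two models layer by layer *)

(** Cauchy-Schwarz, by the mean inequality for the families normalized to sum 1. *)
Lemma sum_sqrt_mul_le (R : realType) (J : finType) (u v : J -> R) :
  (forall j, 0 <= u j) -> (forall j, 0 <= v j) ->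
  \sum_j Num.sqrt (u j) * Num.sqrt (v j) <=
  Num.sqrt (\sum_j u j) * Num.sqrt (\sum_j v j).
Proof.
move=> u0 v0; set U := \sum_j u j; set V := \sum_j v j.
have z (w : J -> R) j : (forall j, 0 <= w j) -> \sum_j w j = 0 -> w j = 0.
  by move=> w0 /eqP; rewrite psumr_eq0// => /allP/(_ j); rewrite mem_index_enum => /(_ isT)/eqP.
have U0 : 0 <= U by exact: sumr_ge0.
have V0 : 0 <= V by exact: sumr_ge0.
have [U00|Un0] := eqVneq U 0.
  by rewrite big1 ?mulr_ge0 ?sqrtr_ge0// => j _; rewrite (z u)// sqrtr0 mul0r.
have [V00|Vn0] := eqVneq V 0.
  by rewrite big1 ?mulr_ge0 ?sqrtr_ge0// => j _; rewrite (z v)// sqrtr0 mulr0.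
have Up : 0 < U by rewrite lt_neqAle eq_sym Un0.
have Vp : 0 < V by rewrite lt_neqAle eq_sym Vn0.
apply: (@le_trans _ _ (\sum_j Num.sqrt U * Num.sqrt V * ((u j / U + v j / V) / 2))).
  apply: ler_sum => j _.
  have := @sqrtr_mul_le _ (u j / U) (v j / V) (divr_ge0 (u0 j) U0) (divr_ge0 (v0 j) V0).
  rewrite !sqrtrM// !sqrtrV// mulrACA -invfM.
  rewrite ler_pdivrMr ?mulr_gt0 ?sqrtr_gt0// => /le_trans; apply.
  by rewrite mulrC.
rewrite -mulr_sumr -mulr_suml big_split/= -!mulr_suml -/U -/V !divff//.
by rewrite mulr1.
Qed.

Section occupancy_measures.
Context {R : realType} {d : measure_display} {X : measurableType d}.
Context {S A : pfinType} {H : nat}.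
Local Notation policy := (policy R S A H).
Variables (p : policy) (c : X).
Implicit Types (M : model R X S A H) (mu : S -> R) (hs : seq 'I_H).

Definition next_occ M mu (h : 'I_H) : S -> R :=
  fun s' => \sum_(sa : S * A)
    mu sa.1 * pol_prob p h sa.1 sa.2 * trans (M h) sa.1 sa.2 c s'.

Definition occ M mu hs : S -> R := foldl (next_occ M) mu hs.

Lemma occ_ge0 M mu hs s : (forall s, 0 <= mu s) -> 0 <= occ M mu hs s.
Proof.
elim: hs mu => [//|h hs IH] mu mu0 /=; apply: IH => s'.
by apply: sumr_ge0 => sa _; rewrite !mulr_ge0 ?pol_prob_ge0 ?trans_ge0.
Qed.

Lemma occ_sum1 M mu hs : \sum_s mu s = 1 -> \sum_s occ M mu hs s = 1.
Proof.
elim: hs mu => [//|h hs IH] mu mu1 /=; apply: IH; rewrite exchange_big/=.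
under eq_bigr do rewrite -mulr_sumr trans_sum1 mulr1.
rewrite -[LHS](pair_big xpredT xpredT (fun s a => mu s * pol_prob p h s a))/=.
by under eq_bigr do rewrite -mulr_sumr pol_prob_sum1 mulr1.
Qed.

End occupancy_measures.

Section layer_gap.
Context {R : realType} {d : measure_display} {X : measurableType d}.
Context {S A : pfinType} {H : nat} {I : finType} {Ms : I -> model R X S A H}.
Variables (f : densities Ms) (i j : I) (c : X).
Local Notation policy := (policy R S A H).
Implicit Types (p : policy) (hs : seq 'I_H) (s : S) (mu : S -> R).

Local Notation raff h s a := (rew_aff f i j h s a c).
Local Notation taff h s a := (trans_aff (Ms:=Ms) i j h s a c).

Lemma trans_aff_ge0 h s a : 0 <= taff h s a.
Proof. by apply: sumr_ge0 => s' _; rewrite mulr_ge0 ?sqrtr_ge0. Qed.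

Lemma trans_aff_le1 h s a : taff h s a <= 1.
Proof.
apply: le_trans (sum_sqrt_mul_le _ _) _ => [s'|s'|]; rewrite ?trans_ge0//.
by rewrite !trans_sum1 sqrtr1 mulr1.
Qed.

(* The state following the last layer is not observed. *)
Definition layer_aff (last : bool) h s a : R :=
  raff h s a * (if last then 1 else taff h s a).

Definition layer_gap (last : bool) h s a : R := 1 - layer_aff last h s a.

Lemma layer_aff01 last h s a : 0 <= layer_aff last h s a <= 1.
Proof.
rewrite /layer_aff; case: last; rewrite ?mulr1.
  by rewrite rew_aff_ge0 rew_aff_le1.
by rewrite mulr_ge0 ?rew_aff_ge0 ?trans_aff_ge0//= mulr_ile1
  ?rew_aff_ge0 ?trans_aff_ge0 ?rew_aff_le1 ?trans_aff_le1.
Qed.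

Lemma layer_gap_ge0 last h s a : 0 <= layer_gap last h s a.
Proof. by rewrite subr_ge0; case/andP: (layer_aff01 last h s a). Qed.

Let aff_tail_le (h : 'I_H) (s : S) (a : A) p hs :
  (forall s', aff f i j p c hs s' <= 1) ->
  (if hs is [::] then 1 else \sum_s' Num.sqrt (trans (Ms i h) s a c s') *
    Num.sqrt (trans (Ms j h) s a c s') * aff f i j p c hs s') <=
  (if nilp hs then 1 else taff h s a).
Proof.
case: hs => [//|h' hs] le1 /=; apply: ler_sum => s' _.
by rewrite -[leRHS]mulr1 ler_wpM2l ?mulr_ge0 ?sqrtr_ge0//; exact: le1.
Qed.

Lemma aff_from_le1 p hs s : aff f i j p c hs s <= 1.
Proof.
elim: hs s => [//|h hs IH] s /=.
rewrite -[leRHS](pol_prob_sum1 p h s); apply: ler_sum => a _.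
rewrite -[leRHS]mulr1 ler_wpM2l ?pol_prob_ge0//.
apply: le_trans (ler_wpM2l (rew_aff_ge0 f i j h s a c) (aff_tail_le h s a IH)) _.
by case/andP: (layer_aff01 (nilp hs) h s a).
Qed.

Lemma aff_cons_le p h hs s :
  aff f i j p c (h :: hs) s <=
  \sum_a pol_prob p h s a * layer_aff (nilp hs) h s a.
Proof.
apply: ler_sum => a _; rewrite ler_wpM2l ?pol_prob_ge0// ler_wpM2l ?rew_aff_ge0//.
by apply: aff_tail_le => s'; exact: aff_from_le1.
Qed.

(** A step of [next_occ] with geometric means of the two models in place of probabilities. By
    Cauchy-Schwarz its iterates stay below the geometric mean of the two occupancies. *)
Let next_aff p mu h s' : R := \sum_(sa : S * A) mu sa.1 * pol_prob p h sa.1 sa.2 *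
  raff h sa.1 sa.2 * (Num.sqrt (trans (Ms i h) sa.1 sa.2 c s') *
  Num.sqrt (trans (Ms j h) sa.1 sa.2 c s')).

Let aff_foldl p mu hs1 h hs2 :
  \sum_s mu s * aff f i j p c (hs1 ++ h :: hs2) s =
  \sum_s foldl (next_aff p) mu hs1 s * aff f i j p c (h :: hs2) s.
Proof.
elim: hs1 mu => [//|h1 hs1 IH] mu; rewrite [in RHS]/= -IH cat_cons.
set hs := hs1 ++ h :: hs2.
have hsE (T : Type) (x y : T) : (if hs is [::] then x else y) = y.
  by rewrite /hs; case: hs1 {IH hs}.
rewrite /next_aff; under [RHS]eq_bigr do rewrite mulr_suml.
rewrite exchange_big/= -(pair_big xpredT xpredT (fun s a => \sum_i0
  mu s * pol_prob p h1 s a * raff h1 s a * (Num.sqrt (trans (Ms i h1) s a c i0) *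
  Num.sqrt (trans (Ms j h1) s a c i0)) * aff f i j p c hs i0))/=.
apply: eq_bigr => s _; rewrite -/aff mulr_sumr; apply: eq_bigr => a _.
rewrite hsE !mulr_sumr; apply: eq_bigr => s' _; ring.
Qed.

Let next_aff_le p mu mui muj hs s : (forall s, 0 <= mui s) -> (forall s, 0 <= muj s) ->
  (forall s, 0 <= mu s <= Num.sqrt (mui s) * Num.sqrt (muj s)) ->
  0 <= foldl (next_aff p) mu hs s <=
    Num.sqrt (occ p c (Ms i) mui hs s) * Num.sqrt (occ p c (Ms j) muj hs s).
Proof.
elim: hs mu mui muj => [//|h hs IH] mu mui muj i0 j0 le /=; apply: IH => s'.
- by apply: (occ_ge0 p c (Ms i) [:: h]).
- by apply: (occ_ge0 p c (Ms j) [:: h]).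
apply/andP; split.
  apply: sumr_ge0 => sa _; rewrite !mulr_ge0 ?pol_prob_ge0 ?rew_aff_ge0 ?sqrtr_ge0//.
  by case/andP: (le sa.1).
apply: le_trans (sum_sqrt_mul_le _ _); last 2 first.
- by move=> sa; rewrite !mulr_ge0 ?pol_prob_ge0 ?trans_ge0.
- by move=> sa; rewrite !mulr_ge0 ?pol_prob_ge0 ?trans_ge0.
apply: ler_sum => -[t a] _; have /andP[m0 m1] := le t.
have p0 := pol_prob_ge0 p h t a.
rewrite !sqrtrM ?mulr_ge0//.
rewrite [leRHS](_ : _ = Num.sqrt (mui t) * Num.sqrt (muj t) *
    Num.sqrt (pol_prob p h t a) ^+ 2 * (Num.sqrt (trans (Ms i h) t a c s') *
    Num.sqrt (trans (Ms j h) t a c s'))); last by ring.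
rewrite sqr_sqrtr// ler_wpM2r ?mulr_ge0 ?sqrtr_ge0//.
rewrite -[leRHS]mulr1 ler_pM ?mulr_ge0 ?rew_aff_ge0 ?rew_aff_le1//.
by rewrite ler_wpM2r.
Qed.

(* With [x], [y] the square roots of the two occupancy measures and [b] the
   layer affinity, [x^2 (1 - b) <= x^2 + y^2 - 2 x y b]. *)
Lemma layer_gap_le (s1 : S) p hs1 h hs2 : enum 'I_H = hs1 ++ h :: hs2 ->
  \sum_s \sum_a occ p c (Ms j) (fun s => (s == s1)%:R) hs1 s * pol_prob p h s a *
    layer_gap (nilp hs2) h s a <= 2 * (1 - aff f i j p c (enum 'I_H) s1).
Proof.
move=> E; set mu0 : S -> R := fun s => (s == s1)%:R.
have mu01 : \sum_s mu0 s = 1.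
  rewrite (bigD1 s1)//= /mu0 eqxx big1 ?addr0// => s /negbTE ->//.
have mu00 s : 0 <= mu0 s by rewrite /mu0 ler0n.
pose x s := Num.sqrt (occ p c (Ms j) mu0 hs1 s).
pose y s := Num.sqrt (occ p c (Ms i) mu0 hs1 s).
pose u := foldl (next_aff p) mu0 hs1.
have uxy s : 0 <= u s <= y s * x s.
  apply: next_aff_le => // s'; rewrite mu00 /mu0; case: eqP => _ /=.
    by rewrite sqrtr1 mulr1.
  by rewrite sqrtr0 mulr0.
have x2 s : occ p c (Ms j) mu0 hs1 s = x s ^+ 2.
  by rewrite sqr_sqrtr// occ_ge0.
have affE : aff f i j p c (enum 'I_H) s1 = \sum_s u s * aff f i j p c (h :: hs2) s.
  rewrite E -(aff_foldl p mu0) (bigD1 s1)//= {1}/mu0 eqxx mul1r big1 ?addr0// => s ss1.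
  by rewrite /mu0 (negbTE ss1) mul0r.
have affle : aff f i j p c (enum 'I_H) s1 <= \sum_s \sum_a y s * x s *
    (pol_prob p h s a * layer_aff (nilp hs2) h s a).
  rewrite affE; apply: ler_sum => s _; rewrite -mulr_sumr.
  have /andP[u0 u1] := uxy s.
  by rewrite ler_pM ?aff_ge0 ?aff_cons_le.
have one M : \sum_s \sum_a occ p c M mu0 hs1 s * pol_prob p h s a = 1.
  under eq_bigr do rewrite -mulr_sumr pol_prob_sum1 mulr1.
  exact: occ_sum1.
apply: (@le_trans _ _ (\sum_s \sum_a (occ p c (Ms j) mu0 hs1 s * pol_prob p h s a +
    occ p c (Ms i) mu0 hs1 s * pol_prob p h s a -
    2 * (y s * x s * (pol_prob p h s a * layer_aff (nilp hs2) h s a))))).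
  apply: ler_sum => s _; apply: ler_sum => a _.
  have -> : occ p c (Ms i) mu0 hs1 s = y s ^+ 2 by rewrite sqr_sqrtr// occ_ge0.
  rewrite x2 /layer_gap; have /andP[b0 b1] := layer_aff01 (nilp hs2) h s a.
  set b := layer_aff _ _ _ _ in b0 b1 *.
  have p0 := pol_prob_ge0 p h s a.
  rewrite -subr_ge0.
  have -> : x s ^+ 2 * pol_prob p h s a + y s ^+ 2 * pol_prob p h s a -
      2 * (y s * x s * (pol_prob p h s a * b)) - x s ^+ 2 * pol_prob p h s a * (1 - b) =
      pol_prob p h s a * (b * (x s - y s) ^+ 2 + (1 - b) * y s ^+ 2) by ring.
  by rewrite mulr_ge0// addr_ge0// mulr_ge0 ?sqr_ge0 ?subr_ge0.
under eq_bigr do rewrite !big_split/= sumrN.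
rewrite !big_split/= sumrN !one.
under [X in _ - X <= _]eq_bigr do rewrite -mulr_sumr.
by rewrite -mulr_sumr; lra.
Qed.

End layer_gap.

(** As [2 u v = u^2 + v^2 - (u - v)^2], this is the weighted mean inequality for [(u - v) (u + v)],
    with [(u + v)^2 <= 2 (u^2 + v^2)]. It is arranged without subtraction so that it can be
    integrated with [u], [v] the square roots of densities. *)
Lemma sqr_gap_le (R : realFieldType) (k x u v : R) : 0 <= k <= 1 -> 0 < x ->
  0 <= u -> 0 <= v ->
  k * u ^+ 2 + x * (u * v) <= k * v ^+ 2 + (x / 2 + x^-1) * (u ^+ 2 + v ^+ 2).
Proof.
move=> /andP[k0 k1] x0 u0 v0; set y := x^-1.
have xy : x * y = 1 by rewrite divff// gt_eqF.
have y0 : 0 < y by rewrite invr_gt0.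
have P1 : 0 <= x * (u - v) ^+ 2 by rewrite mulr_ge0 ?sqr_ge0// ltW.
have P2 : 0 <= y * (x * (u - v) - (u + v)) ^+ 2 by rewrite mulr_ge0 ?sqr_ge0// ltW.
have P3 : 0 <= y * (u - v) ^+ 2 by rewrite mulr_ge0 ?sqr_ge0// ltW.
have E : y * (x * (u - v) - (u + v)) ^+ 2 =
   x * (u - v) ^+ 2 - 2 * (u ^+ 2 - v ^+ 2) + y * (u + v) ^+ 2.
  have -> : y * (x * (u - v) - (u + v)) ^+ 2 = (x * y) * x * (u - v) ^+ 2 -
     2 * (x * y) * (u ^+ 2 - v ^+ 2) + y * (u + v) ^+ 2 by ring.
  by rewrite xy; ring.
have Y0 : 0 <= y * (u ^+ 2 + v ^+ 2) by rewrite mulr_ge0 ?addr_ge0 ?sqr_ge0// ltW.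
have [uv|vu] := leP (u ^+ 2) (v ^+ 2).
  have K : k * (u ^+ 2 - v ^+ 2) <= 0 by rewrite mulr_ge0_le0// subr_le0.
  by nra.
have K : k * (u ^+ 2 - v ^+ 2) <= u ^+ 2 - v ^+ 2.
  by rewrite ler_piMl// subr_ge0 ltW.
by nra.
Qed.

Section layer_comparison.
Context {R : realType} {d : measure_display} {X : measurableType d}.
Context {S A : pfinType} {H : nat} {I : finType} {Ms : I -> model R X S A H}.
Variables (f : densities Ms) (c : X).
Implicit Types (i j : I) (h : 'I_H) (s : S) (a : A).

Let mean_rew_le i j h s a x : 0 < x ->
  mean_rew (Ms i h) s a c + x * rew_aff f i j h s a c <=
  mean_rew (Ms j h) s a c + (x + 2 / x).
Proof.
move=> x0; have x0' := ltW x0.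
have md k : measurable_fun setT (dens f k h s a c) by exact: dens_meas_sect.
have mrE k : (mean_rew (Ms k h) s a c)%:E = (\int[base f h s a c]_r
    (clip01 r * dens f k h s a c r)%:E)%E.
  rewrite -mean_rewE (ge0_integral_density (mu := rew (Ms k h) s a c)
    (nu := base f h s a c) (f := dens f k h s a c)).
  - by apply: eq_integral => r _; rewrite -EFinM mulrC.
  - by move=> r; exact: dens_ge0.
  - exact: md.
  - by move=> B mB; exact: densE.
  - by move=> r; rewrite lee_fin clip01_ge0.
  - by apply/measurable_EFinP; exact: measurable_clip01.
have mcd k : measurable_fun setT (fun r => (clip01 r * dens f k h s a c r)%:E).
  by apply/measurable_EFinP; apply: measurable_funM => //; exact: measurable_clip01.
have cd0 k r : (0 <= (clip01 r * dens f k h s a c r)%:E)%E.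
  by rewrite lee_fin mulr_ge0 ?clip01_ge0 ?dens_ge0.
have sq0 r : (0 <= (Num.sqrt (dens f i h s a c r) * Num.sqrt (dens f j h s a c r))%:E)%E.
  by rewrite lee_fin mulr_ge0 ?sqrtr_ge0.
have msq := measurable_dens_sqrt f i j h s a c.
have mdE k : measurable_fun setT (fun r => (dens f k h s a c r)%:E).
  exact/measurable_EFinP.
have dE0 k r : (0 <= (dens f k h s a c r)%:E)%E by rewrite lee_fin dens_ge0.
have y0 : 0 <= x / 2 + x^-1 by rewrite addr_ge0 ?divr_ge0 ?invr_ge0.
rewrite -lee_fin EFinD [leRHS]EFinD EFinM !mrE -rew_affE.
rewrite -ge0_integralZl// -ge0_integralD//; last 2 first.
- by move=> r _; rewrite mule_ge0.
- exact: measurable_funeM.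
have -> : (x + 2 / x)%:E = (\int[base f h s a c]_r ((x / 2 + x^-1)%:E *
    ((dens f i h s a c r)%:E + (dens f j h s a c r)%:E)))%E.
  rewrite ge0_integralZl//; last 2 first.
  - exact: emeasurable_funD.
  - by move=> r _; rewrite adde_ge0.
  rewrite ge0_integralD// !integral_dens -EFinD -EFinM; congr (_%:E).
  by field; rewrite gt_eqF.
rewrite -ge0_integralD//; last 2 first.
- by move=> r _; rewrite mule_ge0 ?adde_ge0.
- by apply: measurable_funeM; exact: emeasurable_funD.
apply: ge0_le_integral => //.
- by move=> r _; rewrite adde_ge0// mule_ge0.
- by apply: emeasurable_funD => //; exact: measurable_funeM.
- by apply: emeasurable_funD => //; apply: measurable_funeM; exact: emeasurable_funD.
- move=> r _; rewrite -!(EFinM, EFinD) lee_fin.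
  have := @sqr_gap_le _ (clip01 r) x (Num.sqrt (dens f i h s a c r))
    (Num.sqrt (dens f j h s a c r)).
  rewrite !sqr_sqrtr ?dens_ge0// clip01_ge0 clip01_le1; exact.
Qed.

(** Optimizing [x] would give the usual bound [2 sqrt (2 gap)]. Leaving [x] free keeps the bound
    linear in the gap and lets each state-action pair have its own [x]. *)
Lemma mean_rew_gap i j h s a x : 0 < x ->
  `|mean_rew (Ms i h) s a c - mean_rew (Ms j h) s a c| <=
  x * (1 - rew_aff f i j h s a c) + 2 / x.
Proof.
move=> x0; have := mean_rew_le i j h s a x0; have := mean_rew_le j i h s a x0.
have -> : rew_aff f j i h s a c = rew_aff f i j h s a c.
  by rewrite /rew_aff; congr fine; apply: eq_integral => r _; rewrite mulrC.
by rewrite ler_norml; move=> *; apply/andP; split; lra.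
Qed.

Lemma trans_gap i j h s a x G (V : S -> R) : 0 < x -> (forall s', 0 <= V s' <= G) ->
  `|\sum_s' (trans (Ms i h) s a c s' - trans (Ms j h) s a c s') * V s'| <=
  G * (x * (1 - trans_aff (Ms:=Ms) i j h s a c) + 2 / x).
Proof.
move=> x0 V0G; pose u k s' := Num.sqrt (trans (Ms k h) s a c s').
have u2 k s' : trans (Ms k h) s a c s' = u k s' ^+ 2 by rewrite sqr_sqrtr ?trans_ge0.
have u0 k s' : 0 <= u k s' by exact: sqrtr_ge0.
have G0 : 0 <= G by case/andP: (V0G point) => /le_trans; apply.
have le1 : (0 <= (1 : R) <= 1) by rewrite ler01 lexx.
apply: (@le_trans _ _ (\sum_s' G * ((x / 2 + x^-1) *
    (trans (Ms i h) s a c s' + trans (Ms j h) s a c s') - x * (u i s' * u j s')))).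
  apply: le_trans (ler_norm_sum _ _ _) _; apply: ler_sum => s' _.
  have /andP[v0 vG] := V0G s'; rewrite normrM (ger0_norm v0) mulrC ler_pM//.
  have := sqr_gap_le le1 x0 (u0 i s') (u0 j s').
  have := sqr_gap_le le1 x0 (u0 j s') (u0 i s').
  by rewrite !u2 ler_norml !mul1r; move=> *; apply/andP; split; nra.
rewrite -mulr_sumr ler_wpM2l// big_split/= sumrN -!mulr_sumr big_split/= !trans_sum1.
rewrite -/(trans_aff i j h s a c) le_eqVlt; apply/orP; left; apply/eqP.
by field; rewrite gt_eqF.
Qed.

(** The affinity of a layer is at most each of its factors, so [layer_gap] dominates both the reward
    gap and the transition gap. On the last layer it says nothing of the transitions, but there [V]
    vanishes. *)
Lemma layer_step_le (last : bool) i j h s a x G (V : S -> R) : 0 < x -> 0 <= G ->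
  (forall s', 0 <= V s' <= G) -> (last -> forall s', V s' = 0) ->
  `|mean_rew (Ms i h) s a c - mean_rew (Ms j h) s a c +
    \sum_s' (trans (Ms i h) s a c s' - trans (Ms j h) s a c s') * V s'| <=
  (1 + G) * (x * layer_gap f i j c last h s a + 2 / x).
Proof.
move=> x0 G0 V0G lastV; have x0' := ltW x0; apply: le_trans (ler_normD _ _) _.
rewrite mulrDl mul1r.
have r01 := rew_aff_ge0 f i j h s a c; have r1 := rew_aff_le1 f i j h s a c.
have t0 := trans_aff_ge0 i j c h s a (Ms:=Ms); have t1 := trans_aff_le1 i j c h s a (Ms:=Ms).
apply: lerD; last first.
  case: last lastV => [lastV|_]; last first.
    apply: le_trans (trans_gap i j h s a x0 V0G) _.
    rewrite ler_wpM2l// lerD2r ler_wpM2l// /layer_gap lerD2l lerN2 /layer_aff.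
    by rewrite -[leRHS]mul1r ler_wpM2r.
  rewrite big1 ?normr0 => [|s' _]; last by rewrite lastV ?mulr0.
  by rewrite mulr_ge0// addr_ge0 ?divr_ge0 ?mulr_ge0 ?layer_gap_ge0// ltW.
apply: le_trans (mean_rew_gap i j h s a x0) _.
rewrite lerD2r ler_wpM2l// /layer_gap lerD2l lerN2 /layer_aff.
by case: last {lastV}; rewrite ?mulr1// -[leRHS]mulr1 ler_wpM2l.
Qed.

(** One term of a sum of squares equal to twice a squared Hellinger distance. A bound on square
    roots is what yields relative accuracy for trusted transitions. *)
Lemma sqrt_trans_gap i j h s a s' :
  (Num.sqrt (trans (Ms i h) s a c s') - Num.sqrt (trans (Ms j h) s a c s')) ^+ 2 <=
  2 * layer_gap f i j c false h s a.
Proof.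
pose u k s' := Num.sqrt (trans (Ms k h) s a c s').
apply: (@le_trans _ _ (\sum_s2 (u i s2 - u j s2) ^+ 2)).
  rewrite (bigD1 s')//= lerDl; apply: sumr_ge0 => s2 _; exact: sqr_ge0.
have -> : \sum_s2 (u i s2 - u j s2) ^+ 2 = 2 * (1 - trans_aff (Ms:=Ms) i j h s a c).
  under eq_bigr do rewrite sqrrB !sqr_sqrtr ?trans_ge0//.
  rewrite !big_split/= sumrN !trans_sum1 sumrMnl /trans_aff /u.
  by rewrite -mulr_natl; ring.
rewrite ler_wpM2l// /layer_gap lerD2l lerN2 /layer_aff -[leRHS]mul1r ler_wpM2r//.
  exact: trans_aff_ge0.
exact: rew_aff_le1.
Qed.

End layer_comparison.

(** * One epoch in a fixed context *)

Lemma enum_ord_split (H : nat) (hs1 : seq 'I_H) h hs2 :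
  enum 'I_H = hs1 ++ h :: hs2 ->
  hs1 = take h (enum 'I_H) /\ nilp hs2 = (h.+1 == H).
Proof.
move=> E; have sE : (size hs1 + (size hs2).+1)%N = H.
  by rewrite -[RHS]size_enum_ord E size_cat.
have hE : h = size hs1 :> nat.
  have lt : (size hs1 < H)%N by move: sE; lia.
  by have := nth_enum_ord h lt; rewrite E nth_cat ltnn subnn.
split; first by rewrite hE E take_size_cat.
by rewrite /nilp; apply/eqP/eqP; move: sE hE; lia.
Qed.

(** The choice [x = y * Q / m] moves the gap [D] from the occupancy [m] of an arbitrary policy to
    the occupancy [Q] of the explorers; the price [2 / x] is controlled by [m / Q <= 2 * den]. *)
Lemma weighted_step_le (R : realFieldType) (m Q D den y G err : R) :
  0 <= m -> 0 <= Q -> 0 < y -> m <= 2 * den * Q ->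
  (forall x, 0 < x -> err <= G * (x * D + 2 / x)) -> 0 <= G ->
  0 <= D -> 0 <= den ->
  m * err <= G * (y * (Q * D) + 4 * den / y * m).
Proof.
move=> m0 Q0 y0 mQ errP G0 D0 den0; have [->|mN0] := eqVneq m 0.
  by rewrite mul0r mulr_ge0// mulr0 addr0 !mulr_ge0// ltW.
have mp : 0 < m by rewrite lt_neqAle eq_sym mN0.
have Qp : 0 < Q.
  by rewrite lt_neqAle Q0 andbT eq_sym; apply: contraTneq mQ => ->; rewrite mulr0 -ltNge.
have x0 : 0 < y * Q / m by rewrite divr_gt0 ?mulr_gt0.
apply: le_trans (ler_wpM2l m0 (errP _ x0)) _.
rewrite mulrCA ler_wpM2l// mulrDr lerD//.
  by rewrite le_eqVlt; apply/orP; left; apply/eqP; field.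
have -> : m * (2 / (y * Q / m)) = 2 * m / Q / y * m.
  by field; rewrite mN0 !gt_eqF.
rewrite ler_wpM2r// ler_wpM2r ?invr_ge0 ?(ltW y0)//.
by rewrite ler_pdivrMr//; nra.
Qed.

Section epoch_analysis.
Context {R : realType} {d : measure_display} {X : measurableType d}.
Context {S A : pfinType} {H : nat} {I : finType} {Ms : I -> model R X S A H}.
Local Notation policy := (policy R S A H).
Variables (f : densities Ms) (star : I) (s1 : S) (c : X).
Variables (eta zeta : R) (Mprev : model R X S A H) (e : 'I_H -> I).
Hypotheses (eta0 : 0 < eta) (zeta0 : 0 < zeta) (H0 : (0 < H)%N).
Let Mcur : model R X S A H := fun h => Ms (e h) h.
Let Mstar := Ms star.

Local Notation rho p := (regret s1 Mprev p c).
Local Notation den p := (denominator s1 eta Mprev c p).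
Local Notation next := (next_occupancy s1 eta zeta Mprev Mcur c).
Local Notation init := (fun (_ : policy) (s : S) => (s == s1)%:R : R).
Local Notation SA := ((#|S| * #|A|)%:R : R).

Definition est_occ (hs : seq 'I_H) : policy -> S -> R := foldl next init hs.
Definition true_occ (hs : seq 'I_H) (p : policy) : S -> R :=
  occ p c Mstar (fun s => (s == s1)%:R) hs.

Local Notation dt h := (est_occ (take h (enum 'I_H))).
Local Notation ds h := (true_occ (take h (enum 'I_H))).

Variables (ps : 'I_H -> seq policy) (wt : 'I_H -> policy -> R).
Hypothesis wt0 : forall h p, 0 <= wt h p.

Implicit Types (h : 'I_H) (s : S) (a : A) (p : policy).

Definition expl_occ h s a : R :=
  \sum_(p <- ps h) wt h p * (dt h p s * pol_prob p h s a).
Definition gap_at h s a : R := layer_gap f (e h) star c (h.+1 == H) h s a.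
(** Weighted by the true occupancies, under which the data are collected, unlike [expl_occ]. *)
Definition expl_gap h : R :=
  \sum_(p <- ps h) wt h p * \sum_s \sum_a ds h p s * pol_prob p h s a * gap_at h s a.

Hypothesis explP : forall (h : 'I_H) s a p,
  Defs.ratio s1 eta Mprev c (dt h) h s a p <= 2 * expl_occ h s a.

Let SA0 : 0 < SA.
Proof.
rewrite ltr0n muln_gt0; apply/andP; split; apply/card_gt0P; exists point => //.
Qed.

Lemma denominator_gt0 p : 0 < den p.
Proof. by rewrite ltr_wpDr// mulr_ge0 ?regret_ge0// ltW. Qed.

Lemma est_occ_ge0 hs p s : 0 <= est_occ hs p s.
Proof.
elim/last_ind: hs s => [|hs h IH] s; first by rewrite /est_occ /= ler0n.
rewrite /est_occ foldl_rcons; apply: sumr_ge0 => sa _.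
by rewrite !mulr_ge0 ?IH ?pol_prob_ge0 ?trans_ge0.
Qed.

Lemma est_occ_sum_le1 hs p : \sum_s est_occ hs p s <= 1.
Proof.
elim/last_ind: hs => [|hs h IH].
  rewrite /est_occ/= (bigD1 s1)//= eqxx big1 ?addr0// => s /negbTE ->//.
rewrite /est_occ foldl_rcons -/(est_occ hs).
apply: le_trans IH.
apply: (@le_trans _ _ (\sum_s \sum_(sa : S * A) est_occ hs p sa.1 *
    pol_prob p h sa.1 sa.2 * trans (Mcur h) sa.1 sa.2 c s)).
  apply: ler_sum => s _; rewrite /next_occupancy big_mkcond/=.
  apply: ler_sum => sa _; case: ifP => // _.
  by rewrite !mulr_ge0 ?est_occ_ge0 ?pol_prob_ge0 ?trans_ge0.
rewrite exchange_big/=; under eq_bigr do rewrite -mulr_sumr trans_sum1 mulr1.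
rewrite -(pair_big xpredT xpredT (fun s a => est_occ hs p s * pol_prob p h s a))/=.
by under eq_bigr do rewrite -mulr_sumr pol_prob_sum1 mulr1.
Qed.

Lemma expl_occ_ge0 h s a : 0 <= expl_occ h s a.
Proof.
by apply: sumr_ge0 => p _; rewrite !mulr_ge0 ?est_occ_ge0 ?pol_prob_ge0.
Qed.

Lemma est_occ_le_expl h s a p :
  dt h p s * pol_prob p h s a <= 2 * den p * expl_occ h s a.
Proof.
have := explP h s a p; rewrite /Defs.ratio ler_pdivrMr ?denominator_gt0//.
by rewrite mulrAC.
Qed.

Let has_ratio h s a : has_sup (range (Defs.ratio s1 eta Mprev c (dt h) h s a)).
Proof.
split; first by exists (Defs.ratio s1 eta Mprev c (dt h) h s a point); exists point.
by exists (2 * expl_occ h s a) => _ [p _ <-].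
Qed.

(** A trusted transition has probability at least [1 / (2 zeta)] under the explorers, so an error
    along them is also small relative to its own probability. *)
Lemma trusted_expl h s a s' :
  trusted s1 eta zeta Mprev Mcur c (dt h) h s a s' ->
  1 <= 2 * zeta * expl_occ h s a * trans (Mcur h) s a c s'.
Proof.
move/asboolP => tr.
suff le : zeta^-1 <= 2 * expl_occ h s a * trans (Mcur h) s a c s'.
  rewrite (_ : 2 * zeta * _ * _ =
    zeta * (2 * expl_occ h s a * trans (Mcur h) s a c s')); last by ring.
  by rewrite -ler_pdivrMl ?mulr1.
apply: le_trans tr _; rewrite ler_wpM2r ?trans_ge0//; apply: ge_sup.
  by have [] := has_ratio h s a.
by move=> _ [p _ <-].
Qed.

(** The price, for an arbitrary policy, of discarding a transition. *)
Lemma untrusted_le h s a s' p :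
  ~~ trusted s1 eta zeta Mprev Mcur c (dt h) h s a s' ->
  dt h p s * pol_prob p h s a * trans (Mcur h) s a c s' <= den p / zeta.
Proof.
move/asboolPn/negP; rewrite -ltNge => /ltW lt.
have -> : dt h p s * pol_prob p h s a =
    den p * Defs.ratio s1 eta Mprev c (dt h) h s a p.
  by rewrite [RHS]mulrC /Defs.ratio divfK// gt_eqF ?denominator_gt0.
rewrite -mulrA ler_wpM2l ?(ltW (denominator_gt0 p))//; apply: le_trans lt.
rewrite ler_wpM2r ?trans_ge0//; apply: sup_ubound; first by have [] := has_ratio h s a.
by exists p.
Qed.

Lemma gap_at_ge0 h s a : 0 <= gap_at h s a.
Proof. exact: layer_gap_ge0. Qed.

Lemma expl_gap_ge0 h : 0 <= expl_gap h.
Proof.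
apply: sumr_ge0 => p _; rewrite mulr_ge0//; apply: sumr_ge0 => s _.
apply: sumr_ge0 => a _; rewrite !mulr_ge0 ?pol_prob_ge0 ?gap_at_ge0//.
by apply: occ_ge0 => s'; rewrite ler0n.
Qed.

(* Contexts in which the estimated transitions are uniformly reliable. *)
Hypothesis good : 128 * zeta * H%:R * \sum_h expl_gap h <= 1.

Let HR : 0 < H%:R :> R. Proof. by rewrite ltr0n. Qed.

(** A majorant of [sqrt (8 zeta expl_gap)], the relative error of the roots of trusted transition
    probabilities, made linear by the mean inequality. Summed over the layers, each of its two terms
    is at most [1 / 8]. *)
Let tol h : R := 16 * H%:R * zeta * expl_gap h + (8 * H%:R)^-1.

Let tol_ge0 h : 0 <= tol h.
Proof. by rewrite addr_ge0 ?mulr_ge0 ?invr_ge0 ?mulr_ge0 ?expl_gap_ge0// ltW. Qed.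

Let tol_sum : \sum_h tol h <= 4^-1.
Proof.
rewrite big_split/= -mulr_sumr sumr_const card_ord -[X in _ + X <= _]mulr_natl invfM.
have -> : H%:R * (8^-1 / H%:R) = 8^-1 :> R by field; rewrite gt_eqF.
have := good; rewrite (_ : 128 * zeta * H%:R * _ =
  8 * (16 * H%:R * zeta * \sum_h expl_gap h)); last by ring.
lra.
Qed.

Let tol_sum_prefix hs1 hs2 : enum 'I_H = hs1 ++ hs2 -> \sum_(h <- hs1) tol h <= 4^-1.
Proof.
move=> E; apply: le_trans tol_sum.
rewrite (_ : \sum_h tol h = \sum_(h <- enum 'I_H) tol h) ?big_enum//.
rewrite -big_enum/= E big_cat/= lerDl.
exact: sumr_ge0.
Qed.

(** Induction on the layers. Before layer [h] the estimated occupancies are at most twice the true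
    ones, so the gap weighted by [expl_occ] is at most twice [expl_gap]; trusted transitions of
    layer [h] then lose at most a factor [(1 - tol h) ^+ 2]. *)
Lemma est_occ_le_true hs1 hs2 p s : enum 'I_H = hs1 ++ hs2 -> hs2 != [::] ->
  (1 - 2 * \sum_(h <- hs1) tol h) * est_occ hs1 p s <= true_occ hs1 p s.
Proof.
elim/last_ind: hs1 hs2 p s => [|hs1 h IH] hs2 p s E hs20.
  by rewrite big_nil mulr0 subr0 mul1r.
have E' : enum 'I_H = hs1 ++ h :: hs2 by rewrite E cat_rcons.
have [hs1E nE] := enum_ord_split E'.
have := tol_sum_prefix E; have := tol_sum_prefix E'.
rewrite -!cats1 big_cat big_seq1/=; set T := \sum_(_ <- hs1) _; set t := tol h.
have T0 : 0 <= T by exact: sumr_ge0.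
have t0 : 0 <= t by exact: tol_ge0.
move=> T4 Tt4.
rewrite /est_occ /true_occ /occ !foldl_cat/= -/(est_occ hs1) -/(occ _ _ _ _ _) -/(true_occ hs1 p).
rewrite mulr_sumr big_mkcond/=; apply: ler_sum => -[s0 a] _ /=.
have star0 : 0 <= true_occ hs1 p s0 * pol_prob p h s0 a * trans (Mstar h) s0 a c s.
  by rewrite !mulr_ge0 ?pol_prob_ge0 ?trans_ge0//; apply: occ_ge0 => s'; rewrite ler0n.
case: ifPn => // tr; have IHp q s' : (1 - 2 * T) * est_occ hs1 q s' <= true_occ hs1 q s'.
  by apply: (IH (h :: hs2)).
have half : 2^-1 <= 1 - 2 * T by lra.
have le2 q s' : est_occ hs1 q s' <= 2 * true_occ hs1 q s'.
  have := IHp q s'; have := est_occ_ge0 hs1 q s'; nra.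
(* As [hs2] is not empty, [h] is not the last layer and its gap accounts for transitions. *)
have gE : gap_at h s0 a = layer_gap f (e h) star c false h s0 a.
  by rewrite /gap_at -nE; case: (hs2) hs20.
have Qgap : expl_occ h s0 a * gap_at h s0 a <= 2 * expl_gap h.
  rewrite /expl_occ mulr_suml /expl_gap mulr_sumr; apply: ler_sum => q _.
  rewrite -hs1E -!mulrA [leRHS]mulrCA ler_wpM2l//.
  rewrite (bigD1 s0)//= (bigD1 a)//= -addrA.
  have b0 s' a' : 0 <= true_occ hs1 q s' * pol_prob q h s' a' * gap_at h s' a'.
    rewrite !mulr_ge0 ?pol_prob_ge0 ?gap_at_ge0//.
    by apply: occ_ge0 => s2; rewrite ler0n.
  apply: (@le_trans _ _ (2 * (true_occ hs1 q s0 * pol_prob q h s0 a * gap_at h s0 a))).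
    by rewrite !mulrA !ler_wpM2r ?gap_at_ge0 ?pol_prob_ge0.
  rewrite ler_wpM2l// lerDl addr_ge0//; apply: sumr_ge0 => ? _ //.
  exact: sumr_ge0.
(* The left side is at most [2 G]. With [Q G <= 2 l] and [1 <= 2 zeta Q P] for a trusted transition,
   [2 G <= 8 zeta l P], and [8 zeta l <= t ^+ 2] is the mean inequality behind [tol]. *)
have key : (Num.sqrt (trans (Mcur h) s0 a c s) - Num.sqrt (trans (Mstar h) s0 a c s)) ^+ 2 <=
    t ^+ 2 * trans (Mcur h) s0 a c s.
  apply: le_trans (sqrt_trans_gap f c (e h) star h s0 a s) _; rewrite -gE.
  have D0 := gap_at_ge0 h s0 a; have Q0 := expl_occ_ge0 h s0 a.
  have P0 : 0 <= trans (Mcur h) s0 a c s by exact: trans_ge0.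
  have l0 := expl_gap_ge0 h.
  have {}tr : 1 <= 2 * zeta * expl_occ h s0 a * trans (Mcur h) s0 a c s.
    by apply: trusted_expl; rewrite -hs1E.
  set Q := expl_occ h s0 a in Q0 Qgap tr *.
  set G := gap_at h s0 a in D0 Qgap *.
  set P := trans (Mcur h) s0 a c s in P0 tr *.
  set l := expl_gap h in l0 Qgap *.
  have G4 : G <= 4 * zeta * l * P.
    have GP : 0 <= 2 * zeta * P by rewrite !mulr_ge0 ?(ltW zeta0).
    by nra.
  have t8 : 8 * zeta * l <= t ^+ 2.
    rewrite /t /tol -/l; have HV : H%:R * H%:R^-1 = 1 :> R by rewrite divff// gt_eqF.
    rewrite -subr_ge0 (_ : _ - _ = (16 * H%:R * zeta * l - (8 * H%:R)^-1) ^+ 2).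
      exact: sqr_ge0.
    by field; rewrite gt_eqF.
  by nra.
have t1 : 0 <= 1 - t by lra.
have tP : (1 - t) ^+ 2 * trans (Mcur h) s0 a c s <= trans (Mstar h) s0 a c s.
  move: key; set u := Num.sqrt (trans (Mcur h) s0 a c s).
  set v := Num.sqrt (trans (Mstar h) s0 a c s).
  have u0 : 0 <= u by exact: sqrtr_ge0.
  have v0 : 0 <= v by exact: sqrtr_ge0.
  rewrite -(sqr_sqrtr (trans_ge0 (Mcur h) s0 a c s)).
  rewrite -(sqr_sqrtr (trans_ge0 (Mstar h) s0 a c s)) -/u -/v -exprMn => uv.
  have {}uv : u - v <= t * u.
    apply: le_trans (ler_norm _) _.
    by rewrite -ler_sqr ?nnegrE ?mulr_ge0// real_normK ?num_real.
  rewrite -exprMn ler_sqr ?nnegrE ?mulr_ge0//.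
  by nra.
have step : 1 - 2 * (T + t) <= (1 - 2 * T) * (1 - t) ^+ 2 by nra.
have E0 := est_occ_ge0 hs1 p s0; have p0 := pol_prob_ge0 p h s0 a.
apply: (@le_trans _ _ ((1 - 2 * T) * (1 - t) ^+ 2 *
    (est_occ hs1 p s0 * pol_prob p h s0 a * trans (Mcur h) s0 a c s))).
  by rewrite ler_wpM2r ?mulr_ge0 ?trans_ge0.
rewrite (_ : _ * _ = (1 - 2 * T) * est_occ hs1 p s0 * pol_prob p h s0 a *
  ((1 - t) ^+ 2 * trans (Mcur h) s0 a c s)); last by ring.
apply: ler_pM => //.
- by rewrite !mulr_ge0//; lra.
- by rewrite mulr_ge0 ?sqr_ge0 ?trans_ge0.
- by rewrite ler_wpM2r.
Qed.

Lemma est_occ_le2 hs1 hs2 p s : enum 'I_H = hs1 ++ hs2 -> hs2 != [::] ->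
  est_occ hs1 p s <= 2 * true_occ hs1 p s.
Proof.
move=> E hs20; have := est_occ_le_true p s E hs20; have := tol_sum_prefix E.
have := est_occ_ge0 hs1 p s; nra.
Qed.

Lemma expl_occ_gap_le hs1 h hs2 : enum 'I_H = hs1 ++ h :: hs2 ->
  \sum_s \sum_a expl_occ h s a * gap_at h s a <= 2 * expl_gap h.
Proof.
move=> E; have [hs1E _] := enum_ord_split E.
rewrite /expl_gap mulr_sumr.
rewrite (_ : \sum_s _ = \sum_(p <- ps h) wt h p * \sum_s \sum_a
    dt h p s * pol_prob p h s a * gap_at h s a).
  apply: ler_sum => p _; rewrite [leRHS]mulrCA ler_wpM2l// mulr_sumr.
  apply: ler_sum => s _; rewrite mulr_sumr; apply: ler_sum => a _.
  rewrite !mulrA !ler_wpM2r ?gap_at_ge0 ?pol_prob_ge0// -hs1E.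
  exact: (est_occ_le2 _ _ E).
under eq_bigr do under eq_bigr do rewrite /expl_occ mulr_suml.
under eq_bigr do rewrite exchange_big/=.
rewrite exchange_big/=; apply: eq_bigr => p _; rewrite mulr_sumr.
apply: eq_bigr => s _; rewrite mulr_sumr; apply: eq_bigr => a _.
by rewrite !mulrA.
Qed.

(** Estimation error of layer [h], then the loss by the discarded transitions, of which there are at
    most one for each state, action and next state. *)
Definition step_bound y p h : R :=
  H%:R * (y * (2 * expl_gap h) + 4 * den p / y) +
  H%:R * ((#|S| * (#|S| * #|A|))%:R * (den p / zeta)).

Let value_diff_le p hs s : (size hs <= H)%N ->
  `|value_from Mcur p c hs s - value_from Mstar p c hs s| <= H%:R.
Proof.
move=> sH; have /andP[a0 a1] := value_from_bound Mcur p c hs s.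
have /andP[b0 b1] := value_from_bound Mstar p c hs s.
have : (size hs)%:R <= H%:R :> R by rewrite ler_nat.
by rewrite ler_norml => ?; apply/andP; split; lra.
Qed.

(** Telescoping over the layers along the trusted estimated occupancy. The one-step errors are
    evaluated with the value functions of the true model, and the mass that leaves the trusted
    transitions is charged separately. *)
Lemma simulation y p hs1 hs2 : 0 < y -> enum 'I_H = hs1 ++ hs2 ->
  `|\sum_s est_occ hs1 p s *
     (value_from Mcur p c hs2 s - value_from Mstar p c hs2 s)| <=
  \sum_(h <- hs2) step_bound y p h.
Proof.
move=> y0; elim: hs2 hs1 => [|h hs2 IH] hs1 E.
  by rewrite big_nil big1 ?normr0// => s _; rewrite subrr mulr0.
have [hs1E nE] := enum_ord_split E.
have szH : (size hs2 < H)%N.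
  have : (size hs1 + (size hs2).+1)%N = H by rewrite -[RHS]size_enum_ord E size_cat.
  lia.
pose Vh s := value_from Mcur p c hs2 s; pose Vs s := value_from Mstar p c hs2 s.
pose err s a := mean_rew (Mcur h) s a c - mean_rew (Mstar h) s a c +
  \sum_s' (trans (Mcur h) s a c s' - trans (Mstar h) s a c s') * Vs s'.
have VE s : value_from Mcur p c (h :: hs2) s - value_from Mstar p c (h :: hs2) s =
   \sum_a pol_prob p h s a * (err s a + \sum_s' trans (Mcur h) s a c s' * (Vh s' - Vs s')).
  rewrite /= -sumrB; apply: eq_bigr => a _; rewrite -mulrBr; congr (_ * _).
  have E1 : \sum_s' (trans (Mcur h) s a c s' - trans (Mstar h) s a c s') * Vs s' +
      \sum_s' trans (Mcur h) s a c s' * (Vh s' - Vs s') =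
      \sum_s' trans (Mcur h) s a c s' * Vh s' - \sum_s' trans (Mstar h) s a c s' * Vs s'.
    by rewrite -big_split/= -sumrB; apply: eq_bigr => s' _; ring.
  by rewrite /err -[RHS]addrA E1; ring.
pose unt s' := \sum_(sa : S * A | ~~ trusted s1 eta zeta Mprev Mcur c (est_occ hs1) h sa.1 sa.2 s')
  est_occ hs1 p sa.1 * pol_prob p h sa.1 sa.2 * trans (Mcur h) sa.1 sa.2 c s'.
have unt0 s' : 0 <= unt s'.
  by apply: sumr_ge0 => sa _; rewrite !mulr_ge0 ?est_occ_ge0 ?pol_prob_ge0 ?trans_ge0.
have -> : \sum_s est_occ hs1 p s * (value_from Mcur p c (h :: hs2) s -
    value_from Mstar p c (h :: hs2) s) =
  \sum_s \sum_a est_occ hs1 p s * pol_prob p h s a * err s a +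
  (\sum_s' est_occ (rcons hs1 h) p s' * (Vh s' - Vs s') +
   \sum_s' unt s' * (Vh s' - Vs s')).
  under [LHS]eq_bigr do rewrite VE.
  rewrite -big_split/=.
  rewrite [X in _ = _ + X](_ : _ = \sum_s' \sum_(sa : S * A) est_occ hs1 p sa.1 *
     pol_prob p h sa.1 sa.2 * trans (Mcur h) sa.1 sa.2 c s' * (Vh s' - Vs s')).
    rewrite [X in _ = _ + X]exchange_big/= -(pair_big xpredT xpredT
      (fun s a => \sum_s' est_occ hs1 p s * pol_prob p h s a * trans (Mcur h) s a c s' * (Vh s' - Vs s')))/= -big_split/=.
    apply: eq_bigr => s _; rewrite mulr_sumr -big_split/=; apply: eq_bigr => a _.
    rewrite mulrA mulrDr; congr (_ + _); rewrite mulr_sumr; apply: eq_bigr => s' _.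
    by rewrite mulrA.
  apply: eq_bigr => s' _; rewrite -mulrDl -mulr_suml; congr (_ * _).
  rewrite /est_occ foldl_rcons -/(est_occ hs1) /unt /next_occupancy.
  by rewrite [RHS](bigID (fun sa => trusted s1 eta zeta Mprev Mcur c (est_occ hs1) h sa.1 sa.2 s')).
have den0 : 0 <= den p := ltW (denominator_gt0 p).
rewrite big_cons; apply: le_trans (ler_normD _ _) _; rewrite {1}/step_bound -addrA.
apply: lerD; last first.
  apply: le_trans (ler_normD _ _) _; rewrite addrC; apply: lerD.
    by apply: IH; rewrite cat_rcons.
  apply: le_trans (ler_norm_sum _ _ _) _.
  apply: (@le_trans _ _ (\sum_(s' : S) (#|S| * #|A|)%:R * (den p / zeta) * H%:R)).
    apply: ler_sum => s' _; rewrite normrM (ger0_norm (unt0 s')).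
    apply: ler_pM => //; last by apply: value_diff_le; exact: ltnW.
    apply: (@le_trans _ _ (\sum_(sa : S * A) den p / zeta)); last first.
      by rewrite sumr_const card_prod -[leLHS]mulr_natl.
    rewrite /unt big_mkcond; apply: ler_sum => sa _; case: ifPn => [tr|_].
      by rewrite hs1E in tr *; exact: untrusted_le.
    by rewrite divr_ge0// ltW.
  rewrite sumr_const -[leLHS]mulr_natl !natrM le_eqVlt.
  by apply/orP; left; apply/eqP; ring.
have H1 : 1 <= H%:R :> R by rewrite ler1n.
(* [weighted_step_le] is applied at each pair, so that [x] varies with [s] and [a] although [y] does
   not. *)
apply: (@le_trans _ _ (\sum_s \sum_a H%:R * (y * (expl_occ h s a * gap_at h s a) +
    4 * den p / y * (est_occ hs1 p s * pol_prob p h s a)))).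
  apply: le_trans (ler_norm_sum _ _ _) _; apply: ler_sum => s _.
  apply: le_trans (ler_norm_sum _ _ _) _; apply: ler_sum => a _.
  have m0 : 0 <= est_occ hs1 p s * pol_prob p h s a.
    by rewrite mulr_ge0 ?est_occ_ge0 ?pol_prob_ge0.
  rewrite normrM (ger0_norm m0); apply: weighted_step_le => //.
  - exact: expl_occ_ge0.
  - by rewrite hs1E; exact: est_occ_le_expl.
  - move=> x x0.
    have VsP s' : 0 <= Vs s' <= (size hs2)%:R by exact: value_from_bound.
    have lastV : h.+1 == H -> forall s', Vs s' = 0.
      by rewrite -nE => /nilP hs20 s'; rewrite /Vs hs20.
    apply: le_trans (layer_step_le f c (e h) star h s a x0 (ler0n _ _) VsP lastV) _.
    apply: ler_wpM2r; last by rewrite addrC natr1 ler_nat.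
    by rewrite addr_ge0 ?divr_ge0 ?mulr_ge0 ?layer_gap_ge0// ltW.
  - exact: gap_at_ge0.
under eq_bigr do rewrite -mulr_sumr.
rewrite -mulr_sumr ler_wpM2l//.
under eq_bigr do rewrite big_split/= -!mulr_sumr pol_prob_sum1 mulr1.
rewrite big_split/= -!mulr_sumr lerD//.
  by rewrite ler_wpM2l ?(ltW y0)//; exact: expl_occ_gap_le E.
rewrite -[leRHS]mulr1 ler_wpM2l ?est_occ_sum_le1//.
by rewrite divr_ge0 ?mulr_ge0// ltW.
Qed.

Hypothesis eta_zeta : H%:R ^+ 2 * (#|S| * (#|S| * #|A|))%:R * (eta / zeta) <= 32^-1.

Lemma epoch_value_gap p :
  `|value s1 Mcur p c - value s1 Mstar p c| <= rho p / 16 +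
    (256 * H%:R ^+ 3 * eta * \sum_h expl_gap h + SA / (16 * eta)).
Proof.
(* With this [y] the terms [4 * den p / y] sum to [den p / (32 * eta)]. The discarded transitions
   cost at most as much by [eta_zeta], and [den p / (16 * eta)] contains the sixteenth of the
   previous regret. *)
pose y : R := 128 * H%:R ^+ 2 * eta.
have y0 : 0 < y by rewrite !mulr_gt0// exprn_gt0.
have := simulation p y0 (erefl : enum 'I_H = [::] ++ enum 'I_H).
rewrite (bigD1 s1)//= {1}/est_occ/= eqxx mul1r big1 ?addr0; last first.
  by move=> s /negbTE; rewrite /est_occ/= => ->; rewrite mul0r.
rewrite !valueE => /le_trans; apply.
have cst v : \sum_(h : 'I_H) v = H%:R * v :> R.
  by rewrite sumr_const card_ord mulr_natl.
rewrite big_enum/= /step_bound.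
set l := \sum_h expl_gap h; have ez := eta_zeta.
set K := (#|S| * (#|S| * #|A|))%:R in ez *.
have den0 : 0 <= den p := ltW (denominator_gt0 p).
have e1 : H%:R * (H%:R * (4 * den p / y)) = den p / (32 * eta).
  by rewrite /y; field; rewrite !gt_eqF.
have e2 : H%:R * (H%:R * (K * (den p / zeta))) <= den p / (32 * eta).
  rewrite (_ : H%:R * _ = (H%:R ^+ 2 * K * (eta / zeta)) * (den p / eta)); last first.
    by field; rewrite !gt_eqF.
  rewrite (_ : den p / (32 * eta) = 32^-1 * (den p / eta)); last first.
    by field; rewrite !gt_eqF.
  by rewrite ler_wpM2r// divr_ge0// ltW.
have e3 : den p / (32 * eta) = SA / (32 * eta) + rho p / 32.
  by rewrite /denominator; field; rewrite !gt_eqF.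
have e4 : SA / (16 * eta) = SA / (32 * eta) + SA / (32 * eta).
  by field; rewrite !gt_eqF.
have e5 : H%:R * (y * (2 * l)) = 256 * H%:R ^+ 3 * eta * l by rewrite /y; ring.
rewrite big_split/= cst -mulr_sumr big_split/= cst -mulr_sumr -mulr_sumr -/l.
by rewrite mulrDr e1 e5 e4; move: e2; rewrite e3; lra.
Qed.

End epoch_analysis.

Lemma enum_ord_take_drop (H : nat) (h : 'I_H) :
  enum 'I_H = take h (enum 'I_H) ++ h :: drop h.+1 (enum 'I_H).
Proof.
have lt : (h < size (enum 'I_H))%N by rewrite size_enum_ord.
rewrite -{1}(cat_take_drop h (enum 'I_H)); congr (_ ++ _).
by rewrite (drop_nth h lt) nth_ord_enum.
Qed.

(** * Comparison of regrets from one epoch to the next *)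

Section regret_recursion.
Context {R : realType} {d : measure_display} {X : measurableType d}.
Context {S A : pfinType} {H : nat} {I : finType} {Ms : I -> model R X S A H}.
Local Notation policy := (policy R S A H).
Variables (f : densities Ms) (star : I) (s1 : S) (c : X).
Variables (eta zeta : R) (Mprev : model R X S A H) (e : 'I_H -> I).
Hypotheses (eta0 : 0 < eta) (zeta0 : 0 < zeta) (H0 : (0 < H)%N).
Local Notation Mcur := (fun h : 'I_H => Ms (e h) h).
Local Notation Mstar := (Ms star).
Local Notation SA := ((#|S| * #|A|)%:R : R).
Local Notation K := ((#|S| * (#|S| * #|A|))%:R : R).
Variables (ps : 'I_H -> seq policy) (wt : 'I_H -> policy -> R).
Hypothesis wt0 : forall h p, 0 <= wt h p.
Hypothesis explP : forall (h : 'I_H) s a p,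
  Defs.ratio s1 eta Mprev c (est_occ s1 c eta zeta Mprev e (Ms := Ms) (take h (enum 'I_H)))
    h s a p <= 2 * expl_occ s1 c eta zeta Mprev e (Ms := Ms) ps wt h s a.
Hypothesis eta_zeta : H%:R ^+ 2 * K * (eta / zeta) <= 32^-1.

Local Notation gap := (expl_gap f star s1 c e ps wt).

Definition mean_gap (h : 'I_H) : R :=
  \sum_(p <- ps h) wt h p * (1 - traj_aff s1 f star (e h) p c).

Lemma mean_gap_ge0 h : 0 <= mean_gap h.
Proof. by apply: sumr_ge0 => p _; rewrite mulr_ge0// subr_ge0 traj_aff_le1. Qed.

Lemma expl_gap_le_mean h : gap h <= 2 * mean_gap h.
Proof.
rewrite /mean_gap mulr_sumr; apply: ler_sum => p _.
rewrite mulrCA ler_wpM2l//.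
have E := enum_ord_take_drop h; have [_ nE] := enum_ord_split E.
by rewrite /gap_at -nE; exact: (layer_gap_le f (e h) star c s1 p E).
Qed.

(** Without large errors, the comparison costs [z / 7 + 16 / 7 * a], where [a] is the error in the
    values. The coefficients [1 / 4] and [1536 = 3 * 512] are rounded up from there. The term in
    [zeta] makes the sum exceed [H] where the errors are large. *)
Definition next_error (z : R) : R := z / 4 +
  (1536 * H%:R ^+ 3 * eta + 256 * H%:R ^+ 2 * zeta) * \sum_h mean_gap h +
  SA / (4 * eta).

(* Contexts in which [epoch_value_gap] does not apply have [H <= next_error z],
   and no regret exceeds [H]. *)
Lemma regret_step z : 0 <= z ->
  (forall p, regret s1 Mprev p c <= 2 * regret s1 Mstar p c + z) ->
  (forall p, regret s1 Mstar p c <= 2 * regret s1 Mcur p c + next_error z) /\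
  (forall p, regret s1 Mcur p c <= 2 * regret s1 Mstar p c + next_error z).
Proof.
move=> z0 prev; set U := \sum_h mean_gap h.
have U0 : 0 <= U by apply: sumr_ge0 => h _; exact: mean_gap_ge0.
have gapU : \sum_h gap h <= 2 * U.
  by rewrite mulr_sumr; apply: ler_sum => h _; exact: expl_gap_le_mean.
have SA0 : 0 <= SA / (16 * eta) by rewrite divr_ge0// mulr_ge0// ltW.
have E4 : SA / (4 * eta) = 4 * (SA / (16 * eta)) by field; rewrite gt_eqF.
have HR : 0 < H%:R :> R by rewrite ltr0n.
have eU : 0 <= H%:R ^+ 3 * eta * U by rewrite !mulr_ge0 ?exprn_ge0// ltW.
have zU : 0 <= H%:R ^+ 2 * zeta * U by rewrite !mulr_ge0 ?exprn_ge0// ltW.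
have errE : next_error z = z / 4 + 1536 * (H%:R ^+ 3 * eta * U) +
    256 * (H%:R ^+ 2 * zeta * U) + 4 * (SA / (16 * eta)).
  by rewrite /next_error E4 -/U; ring.
have [good|bad] := leP (128 * zeta * H%:R * \sum_h gap h) 1; last first.
  have Hle : H%:R <= next_error z.
    rewrite errE.
    have : H%:R * 1 <= H%:R * (128 * zeta * H%:R * \sum_h gap h).
      by rewrite ler_wpM2l// ltW.
    have : H%:R * (128 * zeta * H%:R * \sum_h gap h) <=
        H%:R * (128 * zeta * H%:R * (2 * U)).
      by rewrite !ler_wpM2l ?mulr_ge0// ltW.
    rewrite (_ : H%:R * (128 * zeta * H%:R * (2 * U)) = 256 * (H%:R ^+ 2 * zeta * U)); last by ring.
    lra.
  by split=> p; [have := regret_le s1 Mstar p c; have := regret_ge0 s1 Mcur p c|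
    have := regret_le s1 Mcur p c; have := regret_ge0 s1 Mstar p c]; lra.
pose a := 512 * (H%:R ^+ 3 * eta * U) + SA / (16 * eta).
have vgap p : `|value s1 Mcur p c - value s1 Mstar p c| <=
    regret s1 Mprev p c / 16 + a.
  apply: le_trans (epoch_value_gap eta0 zeta0 H0 wt0 explP good eta_zeta p) _.
  rewrite lerD2l lerD2r (_ : 512 * _ = 256 * H%:R ^+ 3 * eta * (2 * U)); last by ring.
  apply: ler_wpM2l gapU; have : 0 <= H%:R ^+ 3 * eta by rewrite mulr_ge0 ?exprn_ge0// ltW.
  by lra.
have vg p : value s1 Mcur p c - value s1 Mstar p c <= regret s1 Mprev p c / 16 + a /\
    value s1 Mstar p c - value s1 Mcur p c <= regret s1 Mprev p c / 16 + a.
  by have := vgap p; rewrite ler_norml => /andP[? ?]; split; lra.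
have regE (M : model R X S A H) p :
    regret s1 M p c = value s1 M (bellman_policy M c) c - value s1 M p c.
  have /eqP := regret_optimal (is_optimal_bellman s1 M c).
  by rewrite /regret subr_eq0 => /eqP ->.
pose ps0 := bellman_policy Mstar c; pose pc0 := bellman_policy Mcur c.
have r0s : regret s1 Mstar ps0 c = 0 by rewrite regE subrr.
have r0c : regret s1 Mcur pc0 c = 0 by rewrite regE subrr.
have := prev ps0; rewrite r0s => Ps.
(* The previous regret of [p] is bounded by its true regret through [prev]; an eighth of the latter
   thus appears on the right and is absorbed, whence the factor [8 / 7]. *)
have first p : regret s1 Mstar p c <=
    8/7 * regret s1 Mcur p c + z / 7 + 16/7 * a.
  have [_ s_up] := vg ps0; have [p_lo _] := vg p; have Pp := prev p.
  have opt := is_optimal_bellman s1 Mcur c ps0.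
  by move: (regE Mstar p) (regE Mcur p) opt; rewrite -/ps0 -/pc0; lra.
split=> p.
  have := first p; have := regret_ge0 s1 Mcur p c; rewrite errE /a; lra.
(* The optimal policy of the new model enters with its regret in the previous one, hence with its
   true regret, which the first half of the lemma bounds. *)
have := first pc0; rewrite r0c => Fc.
have [c_up _] := vg pc0; have [_ p_up] := vg p; have Pp := prev p; have Pc := prev pc0.
have opt := is_optimal_bellman s1 Mstar c pc0.
have rp := regret_ge0 s1 Mstar p c.
move: (regE Mcur p) (regE Mstar p) (regE Mstar pc0) opt Fc c_up p_up.
by rewrite errE -/pc0 -/ps0 /a; lra.
Qed.

End regret_recursion.

(** * Weights and explorers in a fixed context *)

Section inverse_gap_weighting.
Context {R : realType} {d : measure_display} {X : measurableType d}.
Context {S A : pfinType} {H : nat}.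
Local Notation policy := (policy R S A H).
Variables (s1 : S) (eta zeta : R) (Mprev Mcur : model R X S A H) (c : X).
Hypothesis eta0 : 0 < eta.
Local Notation igw := (igw s1 eta Mprev c).
Local Notation SA := ((#|S| * #|A|)%:R : R).
Variables (ps : seq policy) (lam : R).
Hypothesis lamP : is_normalizer s1 eta Mprev c ps lam.
Hypothesis size_ps : (size ps <= (#|S| * #|A|).+1)%N.

Let lam0 : 0 < lam. Proof. by have [] := lamP. Qed.

Let er0 p : 0 <= eta * regret s1 Mprev p c.
Proof. by rewrite mulr_ge0 ?regret_ge0// ltW. Qed.

Lemma igw_gt0 p : 0 < igw lam p.
Proof. by rewrite invr_gt0 ltr_wpDr. Qed.

Lemma size_ps_le : (size ps)%:R <= 2 * SA.
Proof.
have : (0 < #|S| * #|A|)%N.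
  by rewrite muln_gt0; apply/andP; split; apply/card_gt0P; exists point.
by rewrite -natrM ler_nat; move: size_ps; lia.
Qed.

(** Each weight is at most [lam^-1], and the weights sum to 1. *)
Lemma normalizer_le : lam <= 2 * SA.
Proof.
apply: le_trans size_ps_le; have [_ s1E] := lamP.
rewrite -[leLHS]mulr1 -[in leLHS]s1E mulr_sumr -sum1_size natr_sum.
apply: ler_sum => p _; rewrite ler_pdivrMr ?ltr_wpDr// mul1r lerDl//.
Qed.

Lemma igw_ge p : (denominator s1 eta Mprev c p)^-1 <= 2 * igw lam p.
Proof.
have D0 : 0 < denominator s1 eta Mprev c p by exact: denominator_gt0.
rewrite -[2]invrK -invfM lef_pV2 ?posrE//; last by rewrite mulr_gt0 ?ltr_wpDr.
by rewrite /denominator; have := normalizer_le; have := er0 p; lra.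
Qed.

(** The explorer [x] maximizes the ratio and is itself sampled with probability at least half of
    [(denominator x)^-1], so its single term in the sum is enough. *)
Lemma explorer_ratio_le h s a x p : x \in ps ->
  is_explorer s1 eta zeta Mprev Mcur c h s a x ->
  Defs.ratio s1 eta Mprev c (occupancy s1 eta zeta Mprev Mcur c h) h s a p <=
  2 * \sum_(q <- ps) igw lam q * (occupancy s1 eta zeta Mprev Mcur c h q s * pol_prob q h s a).
Proof.
move=> xps xP; apply: le_trans (xP p) _.
have o0 q : 0 <= occupancy s1 eta zeta Mprev Mcur c h q s * pol_prob q h s a.
  rewrite mulr_ge0 ?pol_prob_ge0// /occupancy.
  elim/last_ind: (take h _) {xP}s => [|hs h' IH] s'; first by rewrite ler0n.
  rewrite foldl_rcons; apply: sumr_ge0 => sa _.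
  by rewrite !mulr_ge0 ?IH ?pol_prob_ge0 ?trans_ge0.
rewrite (big_rem x xps)/= mulrDr -[leLHS]addr0 lerD//; last first.
  by rewrite mulr_ge0//; apply: sumr_ge0 => q _; rewrite mulr_ge0// ltW ?igw_gt0.
by rewrite /Defs.ratio mulrA mulrC ler_wpM2r// igw_ge.
Qed.

(** Each term is at most [eta^-1], whatever the regret. *)
Lemma igw_regret_le :
  \sum_(p <- ps) igw lam p * regret s1 Mprev p c <= 2 * SA / eta.
Proof.
rewrite ler_pdivlMr// mulr_suml; apply: le_trans size_ps_le.
rewrite -sum1_size natr_sum; apply: ler_sum => p _.
rewrite -mulrA mulrC ler_pdivrMr ?ltr_wpDr// mul1r.
by rewrite mulrC lerDr ltW.
Qed.

End inverse_gap_weighting.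

(** * Inverse gap weighting as a kernel *)

(** The length of [undup] varies with the outcome. Dividing by multiplicities gives a sum over a
    fixed list, whose measurability can be proved term by term. *)
Lemma sum_undup (R : numFieldType) (Y : eqType) (ys : seq Y) (F : Y -> R) :
  \sum_(y <- undup ys) F y = \sum_(y <- ys) F y / (count_mem y ys)%:R.
Proof.
rewrite -(big_undup_iterop_count _ ys predT (fun y => F y / (count_mem y ys)%:R)).
rewrite big_seq [RHS]big_seq; apply: eq_bigr => y; rewrite mem_undup => yys.
rewrite -[LHS](@divfK _ (count_mem y ys)%:R); last first.
  by rewrite pnatr_eq0 -lt0n -has_count has_pred1.
rewrite mulr_natr Monoid.iteropE.
by elim: {2 3}(count_mem y ys) => [//|k IH]; rewrite mulrS IH.
Qed.

Lemma measurable_sum_undup d d' (T : measurableType d) (Y : measurableType d')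
    (R : realType) (J : eqType) (js : seq J) (q : J -> T -> Y) (G : T -> Y -> R) :
  (forall j k, measurable [set x | q j x = q k x]) ->
  (forall j, measurable_fun setT (fun x => G x (q j x))) ->
  measurable_fun setT (fun x => \sum_(y <- undup [seq q j x | j <- js]) G x y).
Proof.
move=> mq mG.
rewrite (_ : (fun _ => _) = fun x => \sum_(j <- js)
    G x (q j x) / (\sum_(k <- js) \1_[set x | q k x = q j x] x)); last first.
  apply/funext => x; rewrite sum_undup big_map; apply: eq_bigr => j _.
  rewrite count_map -sum1_count natr_sum big_mkcond/=; congr (_ / _).
  apply: eq_bigr => k _; rewrite indicE.
  have [e|/eqP ne] := eqVneq (q k x) (q j x).
    by rewrite mem_set.
  by rewrite memNset.
apply: measurable_sum => j; apply: measurable_funM => //.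
apply: measurable_invr_ge0 => [x|]; first by apply: sumr_ge0.
by apply: measurable_sum => k; exact: measurable_indic.
Qed.

Section finite_laws.
Context d (Y : measurableType d) (R : realType).
Variables (ps : seq Y) (wt : Y -> R) (wt0 : forall y, 0 <= wt y).

Let wt_nng y : {nonneg R} := NngNum (wt0 y).

Definition finite_law of (\sum_(y <- ps) wt y = 1) : set Y -> \bar R :=
  msum (fun k => mscale (wt_nng (nth point ps k)) \d_(nth point ps k)) (size ps).

Hypothesis wt1 : \sum_(y <- ps) wt y = 1.

HB.instance Definition _ := Measure.on (finite_law wt1).

Lemma finite_lawE U : finite_law wt1 U = (\sum_(y <- ps) wt y * \1_U y)%:E.
Proof.
rewrite /finite_law /msum (big_nth point) big_mkord -sumEFin.
by apply: eq_bigr => k _; rewrite EFinM.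
Qed.

Let finite_lawT : finite_law wt1 setT = 1%E.
Proof. by rewrite finite_lawE; under eq_bigr do rewrite indicT mulr1; rewrite wt1. Qed.

HB.instance Definition _ :=
  Measure_isProbability.Build _ _ _ (finite_law wt1) finite_lawT.

Lemma integral_finite_law (g : Y -> \bar R) :
  measurable_fun setT g -> (forall y, 0 <= g y)%E ->
  (\int[finite_law wt1]_y g y = \sum_(y <- ps) (wt y)%:E * g y)%E.
Proof.
move=> mg g0; rewrite ge0_integral_measure_sum//.
rewrite (big_nth point) big_mkord; apply: eq_bigr => k _.
by rewrite ge0_integral_mscale//= integral_dirac// diracT mul1e.
Qed.

End finite_laws.

(** A policy is determined by finitely many real coordinates; needed to measure the
    multiplicities. *)
Lemma measurable_policy_eq (R : realType) (S : finType) (A : pfinType) (H : nat)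
    d (T : measurableType d) (q1 q2 : T -> policy R S A H) :
  measurable_fun setT q1 -> measurable_fun setT q2 ->
  measurable [set x | q1 x = q2 x].
Proof.
move=> m1 m2.
rewrite (_ : [set _ | _] = \big[setI/setT]_(i : 'I_H * S * A)
    [set x | pol_prob (q1 x) i.1.1 i.1.2 i.2 = pol_prob (q2 x) i.1.1 i.1.2 i.2]).
  apply: big_ind => //; first exact: measurableI.
  move=> i _; rewrite -[X in measurable X]setTI.
  have := @measurable_fun_eqr _ _ _ setT _ _
    (measurableT_comp (measurable_pol_prob i.1.1 i.1.2 i.2) m1)
    (measurableT_comp (measurable_pol_prob i.1.1 i.1.2 i.2) m2) measurableT [set true] I.
  by rewrite (_ : _ @^-1` _ = [set x | pol_prob (q1 x) i.1.1 i.1.2 i.2 =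
    pol_prob (q2 x) i.1.1 i.1.2 i.2])//; apply/seteqP; split => x /= /eqP.
apply/seteqP; split => x.
  by move=> /= e; rewrite -bigcap_seq => i _ /=; rewrite e.
rewrite -bigcap_seq => /= e; apply: val_inj; apply/ffunP => -[[h s] a].
by apply: (e (h, s, a)); rewrite /= mem_index_enum.
Qed.

(** * Boundaries of epochs and segments *)

Section schedule.
Variables (R : realType) (T H N : nat).
Hypothesis (H0 : (0 < H)%N) (epochs : epoch_count R T H N).
Local Notation tau := (tau R T H N).
Local Notation bound := (bound R T H N).

Lemma tau_double m : (0 < m < N)%N -> tau m = 2 ^+ m.
Proof. by case/andP=> m0 mN; rewrite /Defs.tau gtn_eqF// mN. Qed.

Lemma tau_last m : (N <= m)%N -> tau m = T%:R / H%:R.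
Proof.
case: epochs => N0 _ _ Nm; rewrite /Defs.tau gtn_eqF ?(leq_trans N0)//.
by rewrite ltnNge Nm.
Qed.

Lemma tau_le m : tau m <= tau m.+1.
Proof.
have [N0 _ lt] := epochs.
have [mN|Nm] := ltnP m.+1 N.
  rewrite (tau_double (m := m.+1))// /Defs.tau; case: eqVneq => [_|m0]; first exact: exprn_ge0.
  by rewrite (ltnW mN) ler_weXn2l// ler1n.
rewrite (tau_last Nm) /Defs.tau; case: eqVneq => [_|m0].
  by rewrite divr_ge0.
case: ifP => // mN; apply/ltW/lt; by rewrite lt0n m0.
Qed.

Lemma bound_le m i j : (i <= j)%N -> bound m i <= bound m j.
Proof.
move=> ij; rewrite /Defs.bound lerD2l ler_wpM2l ?ler_nat// subr_ge0.
by case: m => [//|m]; exact: tau_le.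
Qed.

Lemma bound_end m : bound m H = bound m.+1 0.
Proof. by rewrite /Defs.bound/= mulr0 addr0 -mulrDl addrC subrK. Qed.

End schedule.

(** * The sampling kernel of a segment *)

Section run_kernels.
Context {R : realType} {d dO : measure_display} {X : measurableType d}.
Context {S A : pfinType} {H : nat} {Omega : measurableType dO}.
Variables (C0 : R) (P : probability Omega R) (D : probability X R) (s1 : S).
Context {I : finType} {Ms : I -> model R X S A H} {star : I}.
Context {f : densities Ms}.
Variables (delta : R) (T N : nat) (Z : process R X S A H Omega).
Variable L : choices R X S A H Omega I.
Hypothesis H0 : (0 < H)%N.
Hypothesis run : lolipop_run C0 P D s1 star f delta T N Z L.
Local Notation policy := (policy R S A H).
Local Notation eta m := (eta_m C0 #|I| #|S| #|A| T H N delta m).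
Local Notation bound := (bound R T H N).
Local Notation Ob m h := (g_sigma_algebraType (hist Z (bound m h))).
Local Notation Mhat := (Mhat Ms L).

Variables (m : nat) (h : 'I_H).
Hypothesis mN : (0 < m <= N)%N.

Definition branch (j : option (S * A)) (w : Omega) (c : X) : policy :=
  if j is Some sa then explorer L m h sa.1 sa.2 w c else greedy L m w c.

Definition branches := None :: [seq Some sa | sa <- enum {: S * A}].

Lemma policiesE w c : policies L m h w c = undup [seq branch j w c | j <- branches].
Proof. by rewrite /policies /= -map_comp. Qed.

Lemma measurable_branch j : measurable_fun [set: (Ob m h * X)%type]
  (fun wc : Ob m h * X => branch j wc.1 wc.2).
Proof.
case: j => [[s a]|]; first exact: (run_explorer_meas run).
apply: measurable_fun_gen_sub_prod (run_greedy_meas run mN).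
by apply: hist_mono; apply: bound_le => //; exact: run_epochs run.
Qed.

(** The estimated model depends on the outcome only through the [H] estimates of the previous epoch,
    which take finitely many values; for each of these the regret is measurable. *)
Lemma measurable_Mhat_regret (q : Ob m h * X -> policy) :
  measurable_fun setT q ->
  measurable_fun setT (fun wc : Ob m h * X => regret s1 (Mhat m.-1 wc.1) (q wc) wc.2).
Proof.
move=> mq; have mqc : measurable_fun setT (fun wc : Ob m h * X => (q wc, wc.2)).
  exact: measurable_fun_pair.
rewrite /Defs.Mhat; case: eqVneq => [_|m1].
  exact: measurableT_comp (measurable_regret s1 (M0 L)) mqc.
pose e (wc : Ob m h * X) := [ffun h => est L m.-1 h wc.1].
rewrite (_ : (fun _ => _) = fun wc =>
    regret s1 (fun h => Ms (e wc h) h) (q wc) wc.2); last first.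
  by apply/funext => wc; congr regret; apply/funext => h'; rewrite ffunE.
apply: (measurable_fun_fin_select (est := e)
  (F := fun e wc => regret s1 (fun h => Ms (e h) h) (q wc) wc.2)) => [i|i]; last first.
  exact: measurableT_comp (measurable_regret s1 _) mqc.
rewrite (_ : [set _ | _] = \big[setI/setT]_(h' : 'I_H)
    ([set w | est L m.-1 h' w = i h'] `*` setT)); last first.
  apply/seteqP; split => wc.
    by move=> /= <-; rewrite -bigcap_seq => h' _; split => //=; rewrite ffunE.
  rewrite -bigcap_seq => E; apply/ffunP => h'; rewrite ffunE.
  by have [] := E h' (mem_index_enum h').
apply: (big_ind (fun B : set (Ob m h * X) => measurable B)) => //.
  exact: measurableI.
move=> h' _; apply: measurableX => //.
have m1N : (0 < m.-1 <= N)%N by move: mN m1; case: m => // n; rewrite -lt0n /= => /ltnW -> ->.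
(* All segments of the previous epoch end before the current one starts. *)
have le : bound m.-1 h'.+1 <= bound m h.
  rewrite (le_trans (bound_le (run_epochs run) m.-1 (ltn_ord h')))//.
  rewrite bound_end prednK; last by case/andP: mN.
  exact: bound_le (run_epochs run) _ _ _ _.
exact: (hist_mono le (run_est_meas run (i h') m1N)).
Qed.

Lemma eta_ge0 : 0 <= eta m.
Proof.
rewrite /eta_m; apply: divr_ge0; first exact: sqrtr_ge0.
by rewrite -!mulrA; apply: mulr_ge0; rewrite ?ler0n ?mulr_ge0 ?exprn_ge0 ?expR_ge0.
Qed.

Lemma normalizer_term_gt0 x p w c : 0 < x -> 0 < x + eta m * regret s1 (Mhat m.-1 w) p c.
Proof. by move=> x0; rewrite ltr_wpDr// mulr_ge0 ?eta_ge0 ?regret_ge0. Qed.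

Lemma measurable_igw_sum (x : Ob m h * X -> R) (G : Ob m h * X -> policy -> R) :
  (forall wc, 0 < x wc) -> measurable_fun setT x ->
  (forall j, measurable_fun setT (fun wc : Ob m h * X => G wc (branch j wc.1 wc.2))) ->
  measurable_fun setT (fun wc : Ob m h * X => \sum_(p <- policies L m h wc.1 wc.2)
    igw s1 (eta m) (Mhat m.-1 wc.1) wc.2 (x wc) p * G wc p).
Proof.
move=> x0 mx mG; under eq_fun do rewrite policiesE.
apply: (@measurable_sum_undup _ _ _ _ _ _ branches
  (fun j (wc : Ob m h * X) => branch j wc.1 wc.2)
  (fun wc p => igw s1 (eta m) (Mhat m.-1 wc.1) wc.2 (x wc) p * G wc p)) => [j k|j].
  by apply: measurable_policy_eq; exact: measurable_branch.
apply: measurable_funM => //; apply: measurable_invr_ge0 => [wc|].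
  exact/ltW/normalizer_term_gt0.
apply: measurable_funD => //; apply: measurable_funM => //.
by apply: measurable_Mhat_regret; exact: measurable_branch.
Qed.

(* The sum of the weights decreases in the normalizing constant, so [lam > x] says
   that this sum exceeds 1 at [x]. *)
Lemma measurable_lam :
  measurable_fun [set: (Ob m h * X)%type] (fun wc : Ob m h * X => lam L m h wc.1 wc.2).
Proof.
pose sum x (wc : Ob m h * X) := \sum_(p <- policies L m h wc.1 wc.2)
  igw s1 (eta m) (Mhat m.-1 wc.1) wc.2 x p * 1.
have msum x : 0 < x -> measurable_fun setT (sum x).
  by move=> x0; apply: (measurable_igw_sum (x := fun=> x) (G := fun _ _ => 1)).
apply: (measurability _ (RGenOInfty.measurableE R)) => _ [_ [x ->] <-].
rewrite setTI; have [x0|x0] := leP x 0.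
  rewrite (_ : _ @^-1` _ = setT)//; apply/seteqP; split => // -[w c] _ /=.
  rewrite in_itv/= andbT (le_lt_trans x0)//.
  by have [] := run_lam run h w c mN.
rewrite (_ : _ @^-1` _ = (sum x) @^-1` `]1, +oo[); last first.
  have e l w c : \sum_(p <- policies L m h w c)
      igw s1 (eta m) (Mhat m.-1 w) c l p = sum l (w, c).
    by apply: eq_bigr => p _; rewrite mulr1.
  apply/seteqP; split => -[w c] /=; rewrite !in_itv/= !andbT;
    have [l0 <-] := run_lam run h w c mN; rewrite -e.
    move=> lt; apply: ltr_sum => [|p _].
      rewrite has_predT policiesE lt0n size_eq0.
      by apply/eqP => E; have := mem_undup [seq branch j w c | j <- branches]
         (branch None w c); rewrite E in_nil /= inE eqxx.
    by rewrite ltf_pV2 ?posrE ?normalizer_term_gt0// ltrD2r.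
  rewrite ltNge [_ < lam _ _ _ _ _]ltNge; apply: contra => le.
  apply: ler_sum => p _.
  by rewrite lef_pV2 ?posrE ?normalizer_term_gt0// lerD2r.
by rewrite -[X in measurable X]setTI; exact: msum.
Qed.

Lemma igw_weight_ge0 w c p :
  0 <= igw s1 (eta m) (Mhat m.-1 w) c (lam L m h w c) p.
Proof.
by rewrite invr_ge0 ltW// normalizer_term_gt0//; have [] := run_lam run h w c mN.
Qed.

Let igw_weight1 w c : \sum_(p <- policies L m h w c)
  igw s1 (eta m) (Mhat m.-1 w) c (lam L m h w c) p = 1.
Proof. by have [] := run_lam run h w c mN. Qed.

Definition igw_prob (wc : Ob m h * X) : probability policy R :=
  finite_law (igw_weight_ge0 wc.1 wc.2) (igw_weight1 wc.1 wc.2).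

Lemma igw_probE w c U : igw_law s1 (eta m) (Mhat m.-1 w) c
  (policies L m h w c) (lam L m h w c) U = igw_prob (w, c) U.
Proof. exact/esym/finite_lawE. Qed.

Lemma measurable_igw_prob U : measurable U ->
  measurable_fun setT (fun wc => igw_prob wc U).
Proof.
move=> mU; rewrite (_ : (fun _ => _) = fun wc => igw_law s1 (eta m)
    (Mhat m.-1 wc.1) wc.2 (policies L m h wc.1 wc.2) (lam L m h wc.1 wc.2) U);
  last by apply/funext => -[w c]; rewrite igw_probE.
apply/measurable_EFinP; apply: (measurable_igw_sum (G := fun _ p => \1_U p)) => [wc||j].
- by have [] := run_lam run h wc.1 wc.2 mN.
- exact: measurable_lam.
- exact: measurableT_comp (measurable_indic mU) (measurable_branch j).
Qed.

Definition igw_kernel : R.-pker (Ob m h * X) ~> policy :=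
  pker_of measurable_igw_prob.

Lemma igw_kernelE w c U : measurable U -> igw_law s1 (eta m) (Mhat m.-1 w) c
  (policies L m h w c) (lam L m h w c) U = igw_kernel (w, c) U.
Proof. by move=> mU; rewrite igw_probE. Qed.

Lemma integral_igw_kernel w c (g : policy -> R) :
  measurable_fun setT g -> (forall p, 0 <= g p) ->
  (\int[igw_kernel (w, c)]_p (g p)%:E = (\sum_(p <- policies L m h w c)
    igw s1 (eta m) (Mhat m.-1 w) c (lam L m h w c) p * g p)%:E)%E.
Proof.
move=> mg g0; rewrite [LHS](integral_finite_law (igw_weight_ge0 w c) (igw_weight1 w c)).
- by rewrite -sumEFin; apply: eq_bigr => p _.
- exact/measurable_EFinP.
- by move=> p; rewrite lee_fin.
Qed.

End run_kernels.

(** * Epoch schedule and parameters *)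

Lemma expR_half_le2 (R : realType) : expR (2^-1 : R) <= 2.
Proof.
rewrite -[2^-1]opprK expRN invf_ple ?posrE ?expR_gt0//.
by have := expR_ge1Dx (- 2^-1 : R); lra.
Qed.

Lemma expR1_bounds (R : realType) : 2 <= expR (1 : R) <= 4.
Proof.
apply/andP; split; first by have := expR_ge1Dx (1 : R); lra.
have -> : (1 : R) = 2^-1 + 2^-1 by lra.
rewrite expRD; have := @expR_half_le2 R; have := expR_gt0 (2^-1 : R); nra.
Qed.

Lemma ln2_ge_half (R : realType) : 2^-1 <= ln (2 : R).
Proof. by rewrite -[leLHS]expRK ler_ln ?posrE ?expR_gt0// expR_half_le2. Qed.

(** Each new term [y^-1] is at most [2 * (y - x)] for consecutive roots [x] and [y], because
    [y ^+ 2 - x ^+ 2 = 1]. *)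
Lemma sum_inv_sqrt_le (R : realType) n :
  \sum_(1 <= t < n.+1) (Num.sqrt t%:R)^-1 <= 2 * Num.sqrt n%:R :> R.
Proof.
elim: n => [|n IH]; first by rewrite big_geq// sqrtr0 mulr0.
rewrite big_nat_recr//=; apply: le_trans (lerD IH (lexx _)) _.
set x := Num.sqrt n%:R; set y := Num.sqrt n.+1%:R.
have y0 : 0 < y by rewrite sqrtr_gt0 ltr0n.
have x0 : 0 <= x by exact: sqrtr_ge0.
have x2 : x ^+ 2 = n%:R by rewrite sqr_sqrtr.
have y2 : y ^+ 2 = n%:R + 1 by rewrite sqr_sqrtr// natr1.
rewrite -(ler_pM2r y0) mulrDl mulVf ?gt_eqF//.
have : 0 <= (y - x) ^+ 2 by exact: sqr_ge0.
nra.
Qed.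

Section parameter_bounds.
Variables (R : realType) (h s a e g err : R).
Hypotheses (h1 : 1 <= h) (s1 : 1 <= s) (a1 : 1 <= a) (e2 : 2 <= e <= 4).
Hypotheses (g0 : 0 < g) (err0 : 0 < err).
Hypothesis g2 : g ^+ 2 * err = h ^+ 6 * s ^+ 4 * a ^+ 3.
Local Notation eta := (g / (720 * e ^+ 3 * h ^+ 5 * s ^+ 3 * a ^+ 2)).
Local Notation zeta := (g / (8 * e * h * (h + 1) ^+ 2)).

Let h0 : 0 < h. Proof. exact: lt_le_trans ltr01 h1. Qed.
Let s0 : 0 < s. Proof. exact: lt_le_trans ltr01 s1. Qed.
Let a0 : 0 < a. Proof. exact: lt_le_trans ltr01 a1. Qed.
Let e0 : 0 < e. Proof. by case/andP: e2 => /(lt_le_trans _) ->. Qed.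

Let c720 : (0 : R) < 720. Proof. by rewrite ltr0n. Qed.

Lemma eta_param_gt0 : 0 < eta.
Proof.
apply: divr_gt0; first exact: g0.
rewrite -!mulrA; apply: mulr_gt0; first exact: c720.
by rewrite !mulr_gt0// exprn_gt0.
Qed.

Lemma zeta_param_gt0 : 0 < zeta.
Proof.
by apply: divr_gt0; [exact: g0|rewrite !mulr_gt0 ?exprn_gt0 ?addr_gt0].
Qed.

Lemma eta_zeta_param : h ^+ 2 * (s * (s * a)) * (eta / zeta) <= 32^-1.
Proof.
have [e2' e4] := andP e2.
have -> : h ^+ 2 * (s * (s * a)) * (eta / zeta) =
    (h + 1) ^+ 2 / (90 * (e ^+ 2 * (h ^+ 2 * (s * a)))).
  field.
  by rewrite !gt_eqF// addr_gt0.
have sa : 1 <= s * a by rewrite mulr_ege1.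
have H1 := h1.
have p0 : 0 < h ^+ 2 by rewrite exprn_gt0.
have q : h ^+ 2 <= h ^+ 2 * (s * a) by rewrite ler_peMr// ltW.
have e24 : 4 <= e ^+ 2 by nra.
have q2 : 4 * h ^+ 2 <= e ^+ 2 * (h ^+ 2 * (s * a)) by apply: ler_pM => //; rewrite ltW.
rewrite ler_pdivrMr; last by rewrite !mulr_gt0 ?exprn_gt0.
by nra.
Qed.

(** The relation [g2] converts [g^-1] into [g * err]; [11520] is [180 * 4 ^ 3], with 4 the bound on
    [e]. *)
Lemma step_param : s * a / (4 * eta) <= 11520 * (g * err).
Proof.
have [e2' e4] := andP e2.
have -> : s * a / (4 * eta) = 180 * (e ^+ 3 * ((h ^+ 6 * s ^+ 4 * a ^+ 3) / (g * h))).
  by field; rewrite !gt_eqF.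
have ge0 : 0 < g * err by rewrite mulr_gt0.
have -> : (h ^+ 6 * s ^+ 4 * a ^+ 3) / (g * h) = g * err / h.
  by rewrite -g2; field; rewrite !gt_eqF.
have u : g * err / h <= g * err by rewrite ler_pdivrMr// ler_peMr// ltW.
have e3 : e ^+ 3 <= 4 ^+ 3 by apply: lerXn2r; rewrite ?nnegrE// ltW.
have : e ^+ 3 * (g * err / h) <= 4 ^+ 3 * (g * err).
  by apply: ler_pM => //; rewrite ?exprn_ge0// ?divr_ge0// ltW.
lra.
Qed.

(** The [eta] part contributes at most 1 and the [zeta] part at most [32 / 2]. *)
Lemma coef_param : (1536 * h ^+ 3 * eta + 256 * h ^+ 2 * zeta) * (h * err) <=
  17 * (g * err).
Proof.
have [e2' e4] := andP e2.
have ge0 : 0 < g * err by rewrite mulr_gt0.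
have -> : (1536 * h ^+ 3 * eta + 256 * h ^+ 2 * zeta) * (h * err) =
   (1536 / (720 * (e ^+ 3 * (h * (s ^+ 3 * a ^+ 2)))) +
    32 * (h ^+ 2 / (e * (h + 1) ^+ 2))) * (g * err).
  field.
  by rewrite !gt_eqF// addr_gt0.
rewrite ler_pM2r//.
have e3 : 2 ^+ 3 <= e ^+ 3 by apply: lerXn2r; rewrite ?nnegrE// ltW.
have H1 := h1; have hsa : 1 <= h * (s ^+ 3 * a ^+ 2) by rewrite !mulr_ege1 ?exprn_ege1.
have first_le : 1536 / (720 * (e ^+ 3 * (h * (s ^+ 3 * a ^+ 2)))) <= 1 :> R.
  have : 2 ^+ 3 * 1 <= e ^+ 3 * (h * (s ^+ 3 * a ^+ 2)) by apply: ler_pM => //; lra.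
  by move=> le; rewrite ler_pdivrMr; lra.
have second_le : h ^+ 2 / (e * (h + 1) ^+ 2) <= 2^-1.
  by rewrite ler_pdivrMr ?mulr_gt0 ?exprn_gt0 ?addr_gt0//; nra.
lra.
Qed.

End parameter_bounds.

Lemma filter_iota_itv T a n : (a + n <= T)%N ->
  [seq t <- iota 1 T | (a < t <= a + n)%N] = iota a.+1 n.
Proof.
move=> anT; apply: (@irr_sorted_eq _ ltn).
- exact: ltn_trans.
- exact: ltnn.
- by apply: sorted_filter; [exact: ltn_trans|exact: iota_ltn_sorted].
- exact: iota_ltn_sorted.
- by move=> t; rewrite mem_filter !mem_iota; apply/idP/idP; lia.
Qed.

(** Integer boundaries of the epochs before the last one, whose end [T / H] may be fractional. *)
Definition tau_nat m := if m == 0%N then 0%N else (2 ^ m)%N.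
Definition epoch_size m := (tau_nat m - tau_nat m.-1)%N.

Lemma tau_nat_le m : (tau_nat m.-1 <= tau_nat m)%N.
Proof. by case: m => [//|[|m]]//; rewrite /tau_nat/= leq_exp2l. Qed.

Lemma epoch_size_gt0 m : (0 < m)%N -> (0 < epoch_size m)%N.
Proof.
by case: m => [//|[|m]]// _; rewrite /epoch_size /tau_nat/= subn_gt0 ltn_exp2l.
Qed.

Lemma epoch_size_le m : (0 < m)%N -> (epoch_size m <= epoch_size m.+1)%N.
Proof.
case: m => [//|[|m]]// _; rewrite /epoch_size /tau_nat/=.
by rewrite !expnS; lia.
Qed.

Lemma epoch_size_ge m : (0 < m)%N -> (2 ^ m <= 2 * epoch_size m)%N.
Proof.
case: m => [//|[|m]]// _; rewrite /epoch_size /tau_nat/=.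
by rewrite !expnS; lia.
Qed.

Section epochs.
Variables (R : realType) (T H N : nat).
Hypothesis (H0 : (0 < H)%N) (epochs : epoch_count R T H N).
Local Notation tau := (tau R T H N).
Local Notation bound := (bound R T H N).

Let HR : 0 < H%:R :> R. Proof. by rewrite ltr0n. Qed.

Lemma tau_natE m : (m < N)%N -> tau m = (tau_nat m)%:R.
Proof.
rewrite /tau_nat; case: eqVneq => [->//|m0 mN].
by rewrite tau_double ?lt0n ?m0// natrX.
Qed.

Lemma epoch_sizeE m : (0 < m < N)%N -> tau m - tau m.-1 = (epoch_size m)%:R.
Proof.
case/andP=> m0 mN; rewrite !tau_natE// ?natrB ?tau_nat_le//.
by rewrite (leq_ltn_trans _ mN)// leq_pred.
Qed.

Lemma bound_natE m h : (0 < m < N)%N ->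
  bound m h = (tau_nat m.-1 * H + epoch_size m * h)%:R.
Proof.
move=> mN; rewrite /Defs.bound epoch_sizeE// tau_natE ?natrD ?natrM//.
by case/andP: mN => _; apply: leq_ltn_trans; exact: leq_pred.
Qed.

Lemma tau_horizon m : (0 < m)%N -> tau m * H%:R <= T%:R.
Proof.
move=> m0; have [mN|Nm] := ltnP m N; last by rewrite (tau_last epochs Nm) divfK ?gt_eqF.
rewrite tau_double ?m0// -ler_pdivlMr//.
by case: epochs => _ _ lt; apply/ltW/lt; rewrite m0.
Qed.

Lemma bound_H m : bound m H = tau m * H%:R.
Proof. by rewrite /Defs.bound -mulrDl addrC subrK. Qed.

Lemma segmentE m (h : 'I_H) : (0 < m < N)%N ->
  segment R T H N m h = iota (tau_nat m.-1 * H + epoch_size m * h).+1 (epoch_size m).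
Proof.
move=> mN; set a := (_ + _)%N.
have hE : bound m h.+1 = (a + epoch_size m)%:R by rewrite bound_natE// mulnS; congr _%:R; lia.
rewrite -(@filter_iota_itv T); last first.
  rewrite -(ler_nat R) -hE (le_trans (bound_le epochs m (ltn_ord h)))//.
  by rewrite bound_H tau_horizon//; case/andP: mN.
by apply: eq_filter => t; rewrite /in_segment hE bound_natE// ltr_nat ler_nat.
Qed.

Lemma mem_segment m h t : (t \in segment R T H N m h) =
  [&& (0 < t <= T)%N, bound m h < t%:R & t%:R <= bound m h.+1].
Proof. by rewrite mem_filter mem_iota add1n ltnS andbC. Qed.

(** The strict inequality [bound m h < t%:R] can be strengthened because before the last epoch the
    bound is an integer. *)
Lemma segment_bound_le m (h : 'I_H) t : (0 < m < N)%N ->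
  t \in segment R T H N m h -> bound m h <= t.-1%:R.
Proof.
move=> mN; rewrite segmentE// bound_natE// mem_iota ler_nat; lia.
Qed.

Lemma exists_segment t : (0 < t <= T)%N ->
  exists m (h : 'I_H), (0 < m <= N)%N /\ t \in segment R T H N m h.
Proof.
move=> tT; have [N0 _ _] := epochs.
have exm : exists m, t%:R <= bound m H.
  exists N; rewrite bound_H (tau_last epochs (leqnn N)) divfK ?gt_eqF//.
  by rewrite ler_nat; case/andP: tT.
case: (ex_minnP exm) => m tm mmin.
have m0 : (0 < m)%N.
  rewrite lt0n; apply: contraTneq tm => ->.
  by rewrite bound_H /Defs.tau eqxx mul0r lern0 -lt0n; case/andP: tT.
have mN : (m <= N)%N.
  apply: mmin; rewrite bound_H (tau_last epochs (leqnn N)) divfK ?gt_eqF//.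
  by rewrite ler_nat; case/andP: tT.
have lo : bound m 0 < t%:R.
  rewrite -[m]prednK// -bound_end ltNge; apply/negP => /mmin.
  by move: m0; case: m {tm mmin mN} => //= m _; rewrite ltnn.
have exh : exists h, t%:R <= bound m h.+1 by exists H.-1; rewrite prednK.
case: (ex_minnP exh) => h th hmin.
have hH : (h < H)%N by have := hmin H.-1; rewrite prednK// => /(_ tm); lia.
exists m, (Ordinal hH); rewrite m0 mN mem_segment tT th /= andbT; split => //.
case: h th hmin hH => [//|h] _ hmin _.
by rewrite ltNge; apply/negP => /hmin; rewrite ltnn.
Qed.

Lemma segment_le_pow m (h : 'I_H) t : (0 < m <= N)%N ->
  t \in segment R T H N m h -> t%:R <= 2 ^+ m * H%:R :> R.
Proof.
case/andP=> m0 mN; rewrite mem_segment => /and3P[_ _ tb].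
apply: le_trans (le_trans tb _) _.
  exact: (bound_le epochs m (ltn_ord h)).
rewrite bound_H ler_wpM2r//.
move: mN; rewrite leq_eqVlt => /orP[/eqP ->|mN]; last first.
  by rewrite tau_double ?m0.
by rewrite (tau_last epochs (leqnn N)); case: epochs.
Qed.

Lemma epoch_count_le : 1 <= ln (T%:R : R) -> N%:R <= 3 * ln (T%:R : R).
Proof.
move=> lnT; have [N0 _ lt] := epochs.
have T0 : (0 : R) < T%:R.
  by rewrite ltNge; apply/negP => T0; move: lnT; rewrite ln0// ler10.
have [N1|N1] := leqP N 1.
  have : N%:R <= 1 :> R by rewrite (ler_nat _ N 1).
  lra.
have : 2 ^+ N.-1 <= T%:R :> R.
  have := lt N.-1; rewrite -subn1 subn_gt0 N1 ltn_subrL N0 => /(_ isT) /ltW/le_trans.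
  by apply; rewrite ler_pdivrMr// ler_peMr// ?ler1n// ltW.
rewrite -ler_ln ?posrE ?exprn_gt0// lnXn// -[_ *+ _]mulr_natr => le.
have : N.-1%:R <= 2 * ln (T%:R : R).
  have h2 := @ln2_ge_half R; have n0 : 0 <= N.-1%:R :> R by [].
  nra.
have : N%:R = N.-1%:R + 1 :> R by rewrite natr1 prednK.
lra.
Qed.

End epochs.

Section logarithmic_factor.
Variables (R : realType) (K N : nat) (delta : R).
Hypotheses (K0 : (0 < K)%N) (N0 : (0 < N)%N) (delta01 : 0 < delta < 2^-1).

Definition log_factor : R := ln (K%:R / (delta / (2 * N%:R ^+ 2))).

Let d0 : 0 < delta. Proof. by case/andP: delta01. Qed.
Let KR : 1 <= K%:R :> R. Proof. by rewrite ler1n. Qed.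
Let NR : 1 <= N%:R :> R. Proof. by rewrite ler1n. Qed.

Lemma log_argE : K%:R / (delta / (2 * N%:R ^+ 2)) = 2 * N%:R ^+ 2 * (K%:R / delta).
Proof.
by field; rewrite gt_eqF// gt_eqF// ltr0n.
Qed.

Let Kd : 2 <= K%:R / delta.
Proof.
have d0' := d0; have KR' := KR; have [_ d1] := andP delta01.
by rewrite ler_pdivlMr//; lra.
Qed.

Lemma log_arg_gt0 : 0 < K%:R / (delta / (2 * N%:R ^+ 2)).
Proof.
by rewrite log_argE !mulr_gt0 ?exprn_gt0 ?invr_gt0// ltr0n.
Qed.

Lemma log_factor_ge1 : 1 <= log_factor.
Proof.
have h := @ln2_ge_half R; apply: (@le_trans _ _ (ln (2 ^+ 2))).
  by rewrite lnXn//; lra.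
have N1 : 1 <= N%:R ^+ 2 :> R by rewrite exprn_ege1.
have Kd' := Kd.
rewrite /log_factor ler_ln ?posrE ?log_arg_gt0 ?exprn_gt0// log_argE.
nra.
Qed.

Lemma log_factor_le (x : R) : 1 <= x -> N%:R <= 3 * x ->
  log_factor <= 7 * ln (K%:R * x / delta).
Proof.
move=> x1 Nx; set y := K%:R * x / delta.
have yE : y = x * (K%:R / delta) by rewrite /y; ring.
have Kd' := Kd; have NR' := NR.
have y2 : 2 <= y by rewrite yE; nra.
have y0 : 0 < y by lra.
rewrite mulrC -[7]/(7%:R) mulr_natr -lnXn// ler_ln ?posrE ?log_arg_gt0 ?exprn_gt0//.
(* The exponent 7 is [2 + 5]: as [y >= 2], the factor 18 is at most [2 ^ 5 <= y ^ 5]. *)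
rewrite log_argE; apply: (@le_trans _ _ (18 * y ^+ 2)).
  have N2 : N%:R ^+ 2 <= (3 * x) ^+ 2 by rewrite lerXn2r// nnegrE; lra.
  have z2 : K%:R / delta <= (K%:R / delta) ^+ 2 by nra.
  apply: (@le_trans _ _ (2 * (3 * x) ^+ 2 * (K%:R / delta) ^+ 2)).
    by apply: ler_pM => //; try lra; nra.
  by rewrite yE !exprMn; lra.
rewrite (_ : 7 = 5 + 2)%N// exprD ler_pM2r ?exprn_gt0//.
apply: (@le_trans _ _ (2 ^+ 5)); first by lra.
by rewrite lerXn2r ?nnegrE//; lra.
Qed.

End logarithmic_factor.

(** * Regret of a run *)

Section conditional_regret.
Local Open Scope ereal_scope.
Context {R : realType} {d dO : measure_display} {X : measurableType d}.
Context {S A : pfinType} {H : nat} {Omega : measurableType dO}.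
Local Notation policy := (policy R S A H).
Context {P : probability Omega R} {D : probability X R} {s1 : S}.
Context {I : finType} {Ms : I -> model R X S A H}.
Variables (f : densities Ms) (star : I) (Z : process R X S A H Omega).
Variables (t : nat) (kappa : Omega -> X -> set policy -> \bar R) (b : R).
Hypothesis bt : <<s hist Z b >> `<=` <<s hist Z t.-1%:R >>.
Local Notation Ob := (g_sigma_algebraType (hist Z b)).
Local Notation G := (hist Z t.-1%:R).
Variable kap : R.-pker (Ob * X) ~> policy.
Hypothesis kapE : forall w c U, measurable U -> kappa w c U = kap (w, c) U.
Hypothesis roundt : round P D s1 (Ms star) Z t kappa.
Variables (g : policy * X -> R) (M : R).
Hypotheses (mg : measurable_fun setT g) (g0M : forall z, (0 <= g z <= M)%R).

Let mean w := \int[D]_c \int[kap (w, c)]_q (g (q, c))%:E.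

Let g0 z : (0 <= g z)%R. Proof. by case/andP: (g0M z). Qed.
Let gM z : (g z <= M)%R. Proof. by case/andP: (g0M z). Qed.

Let inner_ge0 wc : 0 <= \int[kap wc]_q (g (q, wc.2))%:E.
Proof. by apply: integral_ge0 => q _; rewrite lee_fin. Qed.

Lemma measurable_kernel_mean :
  measurable_fun setT (fun wc => \int[kap wc]_q (g (q, wc.2))%:E).
Proof.
apply: (measurable_kernel_integral kap (g := fun z => (g z)%:E)) => [z|].
  by rewrite lee_fin.
exact/measurable_EFinP.
Qed.

Let measurable_mean : measurable_fun [set: Ob] (mean : Ob -> \bar R).
Proof.
exact: (@measurable_fun_fubini_tonelli_F _ _ _ _ _ D _ measurable_kernel_mean inner_ge0).
Qed.

Let mean_ge0 w : 0 <= mean w.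
Proof. by apply: integral_ge0 => c _; exact: (inner_ge0 (w, c)). Qed.

Let mean_le w : mean w <= M%:E.
Proof.
rewrite -(integral_probability_cst D M); apply: ge0_le_integral => //.
- exact: (measurable_fun_pair2 _ measurable_kernel_mean).
- move=> c _; rewrite -(integral_probability_cst (kernel_prob kap (w, c)) M).
  apply: ge0_le_integral => //.
  + by move=> q _; rewrite lee_fin.
  + by apply/measurable_EFinP; exact: measurable_fun_pair1 mg.
  + by move=> q _; rewrite lee_fin.
Qed.

(* Both sides have the same integral over the event where the inequality fails. *)
Lemma cond_exp_le_mean Y :
  is_cond_exp P G (fun w => g (pol Z t w, ctx Z t w)) Y ->
  {ae P, forall w, (Y w)%:E <= \int[D]_c \int[kap (w, c)]_q (g (q, c))%:E}.
Proof.
case=> mY iY YE; pose y w := fine (mean w).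
have yE w : (y w)%:E = mean w.
  by rewrite fineK// ge0_fin_numE// (le_lt_trans (mean_le w)) ?ltry.
have my : measurable_fun [set: g_sigma_algebraType G] (y : g_sigma_algebraType G -> R).
  apply: (measurable_fun_gen_sub bt); apply/measurable_EFinP.
  by rewrite (_ : _ \o _ = mean)//; apply/funext => w; exact: yE.
have mO (u : Omega -> R) : measurable_fun [set: g_sigma_algebraType G]
    (u : g_sigma_algebraType G -> R) -> measurable_fun setT u.
  move=> mu _ B mB; rewrite setTI; apply: (@hist_measurable _ _ _ _ _ _ _ _ Z t.-1%:R).
  by have := mu measurableT B mB; rewrite setTI.
pose F : set Omega := [set w | (y w < Y w)%R].
have GF : <<s G >> F.
  have := measurable_fun_ltr my mY measurableT (Y := [set true]) Logic.I.
  rewrite setTI (_ : _ @^-1` _ = F)//.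
have mF : measurable F by exact: (hist_measurable GF).
have iy : P.-integrable setT (EFin \o y).
  apply: (@le_integrable _ _ _ P setT measurableT _ (cst M%:E)).
  - by apply/measurable_EFinP; exact: mO.
  - move=> w _; have y0 : (0 <= y w)%R by rewrite -lee_fin yE.
    have yM : (y w <= M)%R by rewrite -lee_fin yE.
    by rewrite /= lee_fin !ger0_norm// (le_trans y0).
  - exact: finite_measure_integrable_cst.
have inty : \int[P]_(w in F) (Y w)%:E = \int[P]_(w in F) (y w)%:E.
  rewrite (YE F GF).
  transitivity (\int[P]_w ((\1_F w)%:E * (g (pol Z t w, ctx Z t w))%:E)).
    rewrite integral_mkcond; apply: eq_integral => w _.
    by rewrite patchE indicE; case: ifP => _; rewrite ?mul1e ?mul0e.
  rewrite (round_integral f bt kapE roundt (V := fun w => (\1_F w)%:E)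
    (g := fun z => (g z.1)%:E)).
  - rewrite [RHS]integral_mkcond; apply: eq_integral => w _.
    rewrite patchE indicE; case: ifP => _; rewrite ?mul1e ?mul0e// yE.
    apply: eq_integral => c _; apply: eq_integral => q _.
    exact: (integral_probability_cst (traj_measure s1 f star q c) (g (q, c))).
  - by move=> w; rewrite lee_fin.
  - apply/measurable_EFinP; exact: (@measurable_indic _ (g_sigma_algebraType G)).
  - by move=> z; rewrite lee_fin.
  - by apply/measurable_EFinP; exact: measurableT_comp mg measurable_fst.
have iYF : P.-integrable F (EFin \o Y) by exact: integrableS iY.
have iyF : P.-integrable F (EFin \o y) by exact: integrableS iy.
have mYy : measurable_fun F (fun w => (Y w - y w)%:E).
  apply/measurable_EFinP; apply: measurable_funTS.
  by apply: measurable_funB; exact: mO.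
have zero : \int[P]_(w in F) `|(Y w - y w)%:E| = 0.
  transitivity (\int[P]_(w in F) ((Y w)%:E - (y w)%:E)).
    apply: eq_integral => w; rewrite in_setE => Fw.
    by rewrite gee0_abs ?EFinB// lee_fin subr_ge0 ltW.
  rewrite integralB_EFin// inty subee//.
  exact: integrable_fin_num iyF.
have := (ae_eq_integral_abs P mF mYy).1 zero.
apply: filterS => w Yy; rewrite -/(mean w) -yE lee_fin leNgt; apply/negP => Fw.
by have [] := Yy Fw; apply/eqP; rewrite subr_eq0 gt_eqF.
Qed.

End conditional_regret.

Section run_analysis.
Context {R : realType} {d dO : measure_display} {X : measurableType d}.
Context {S A : pfinType} {H : nat} {Omega : measurableType dO}.
Context {P : probability Omega R} {D : probability X R} {s1 : S}.
Context {I : finType} {Ms : I -> model R X S A H} {star : I}.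
Context {f : densities Ms}.
Context {delta : R} {T N : nat} {Z : process R X S A H Omega}.
Context {L : choices R X S A H Omega I}.
Hypotheses (H0 : (0 < H)%N) (delta01 : 0 < delta < 2^-1).
Hypothesis run : lolipop_run 1 P D s1 star f delta T N Z L.
Local Notation policy := (policy R S A H).
Local Notation eta m := (eta_m 1 #|I| #|S| #|A| T H N delta m).
Local Notation zeta m := (zeta_m 1 #|I| #|S| #|A| T H N delta m).
Local Notation gamma m := (gamma_m 1 #|I| #|S| #|A| T H N delta m).
Local Notation err m := (err_m 1 #|I| T H N delta m).
Local Notation bound := (bound R T H N).
Local Notation Ob m h := (g_sigma_algebraType (hist Z (bound m h))).
Local Notation Mhat := (Mhat Ms L).
Local Notation weight m h w c := (igw s1 (eta m) (Mhat m.-1 w) c (lam L m h w c)).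
Let epochs := run_epochs run.

Definition seg_gap m (h : 'I_H) w c : R :=
  mean_gap f star s1 c (fun h => est L m h w) (fun h => policies L m h w c)
    (fun h => weight m h w c) h.

Definition seg_err m (h : 'I_H) w : R := fine (\int[D]_c (seg_gap m h w c)%:E).

Section one_segment.
Variables (m : nat) (h : 'I_H).
Hypothesis mN : (0 < m <= N)%N.
Local Notation ker := (igw_kernel run h mN).

Lemma seg_gapE w c :
  seg_gap m h w c = hell_gap s1 f star ker (est L m h w) (w, c).
Proof.
apply: EFin_inj; rewrite -hell_gapE integral_igw_kernel//.
- by apply: measurable_funB => //; exact: measurable_traj_aff_pol.
- by move=> p; rewrite subr_ge0 traj_aff_le1.
Qed.

Lemma measurable_seg_gap w : measurable_fun setT (seg_gap m h w).
Proof.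
rewrite (_ : seg_gap m h w = fun c => hell_gap s1 f star ker (est L m h w) (w, c)).
  exact: measurable_fun_pair2 (measurable_hell_gap s1 f star ker _).
by apply/funext => c; exact: seg_gapE.
Qed.

Lemma seg_gap_ge0 w c : 0 <= seg_gap m h w c.
Proof. by rewrite seg_gapE; case/andP: (hell_gap01 s1 f star ker (est L m h w) (w, c)). Qed.

Lemma seg_errE w : seg_err m h w = 1 - mean_aff D s1 f star ker (est L m h w) w.
Proof.
by rewrite /seg_err; under eq_integral do rewrite seg_gapE; rewrite integral_hell_gap.
Qed.

Lemma integral_seg_gap w : (\int[D]_c (seg_gap m h w c)%:E = (seg_err m h w)%:E)%E.
Proof.
by rewrite seg_errE -integral_hell_gap; under eq_integral do rewrite seg_gapE.
Qed.

Lemma seg_err01 w : 0 <= seg_err m h w <= 1.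
Proof. by rewrite seg_errE subr_ge0 mean_aff_le1 gerBl mean_aff_ge0. Qed.

Lemma measurable_seg_err : measurable_fun [set: Ob m h.+1] (seg_err m h).
Proof.
rewrite (_ : seg_err m h = fun w => 1 - mean_aff D s1 f star ker (est L m h w) w); last first.
  by apply/funext => w; exact: seg_errE.
apply: measurable_funB => //.
apply: (@measurable_fun_fin_select _ (Ob m h.+1) _ _ (est L m h)
  (fun i w => mean_aff D s1 f star ker i w)) => i.
  exact: (run_est_meas run).
apply: measurable_fun_gen_sub (measurable_mean_aff D s1 f star ker i).
by apply: hist_mono; exact: bound_le.
Qed.

Lemma segment_rounds : (m < N)%N ->
  is_segment P D s1 star Z (bound m h) (fun w c => igw_law s1 (eta m) (Mhat m.-1 w) c
    (policies L m h w c) (lam L m h w c)) (segment R T H N m h) (Ms := Ms).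
Proof.
move=> mltN; split; first by rewrite sorted_filter//; [exact: ltn_trans|exact: iota_ltn_sorted].
move=> t tseg; split.
- by move: tseg; rewrite mem_segment => /and3P[/andP[]].
- by apply: segment_bound_le tseg => //; rewrite mltN; case/andP: mN => ->.
- exact: (run_round run).
Qed.

End one_segment.

Lemma measurable_est m (h : 'I_H) i : (0 < m <= N)%N ->
  measurable [set w | est L m h w = i].
Proof. by move=> mN; exact: (hist_measurable (run_est_meas run i mN)). Qed.

Section one_epoch.
Variable m : nat.
Hypothesis mN : (0 < m < N)%N.
Let mN' : (0 < m <= N)%N. Proof. by case/andP: mN => -> /ltnW. Qed.
Let n : R := (epoch_size m)%:R.

Definition epoch_err w : R := \sum_(h < H) seg_err m h w.

Lemma epoch_err_ge0 w : 0 <= epoch_err w.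
Proof. by apply: sumr_ge0 => h _; case/andP: (seg_err01 h mN' w). Qed.

Lemma epoch_err_le w : epoch_err w <= H%:R.
Proof.
rewrite -[X in _ <= X%:R]card_ord -sum1_card natr_sum.
by apply: ler_sum => h _; case/andP: (seg_err01 h mN' w).
Qed.

Let prefix_err k w : R := \sum_(h < H | (h < k)%N) seg_err m h w.

Let measurable_prefix k : (k <= H)%N ->
  measurable_fun [set: Ob m k] (prefix_err k).
Proof.
move=> kH; rewrite /prefix_err; under eq_fun do rewrite big_mkcond/=.
apply: measurable_sum => h; case: (boolP (h < k)%N) => [hk|_]; last exact: measurable_cst.
have le : bound m h.+1 <= bound m k by exact: bound_le.
exact: (measurable_fun_gen_sub (hist_mono le) (measurable_seg_err mN')).
Qed.

Let prefixS (k : 'I_H) w : prefix_err k.+1 w = prefix_err k w + seg_err m k w.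
Proof.
rewrite /prefix_err (bigD1 k)//= addrC; congr (_ + _); apply: eq_bigl => h.
by rewrite ltnS ltn_neqAle andbC.
Qed.

(* Each segment contributes a factor #|I| to the exponential moment. Bounding the
   moment of the whole epoch spares a union bound over the segments, which would
   cost a factor log H. *)
Let prefix_moment k : (k <= H)%N ->
  (\int[P]_w (expR (n * prefix_err k w))%:E <= (#|I|%:R ^+ k)%:E)%E.
Proof.
elim: k => [_|k IH kH].
  under eq_integral do rewrite /prefix_err big_pred0// mulr0 expR0.
  by rewrite integral_cst// mul1e expr0; exact: probability_le1.
pose h := Ordinal kH.
(* The exponential of the errors of the earlier segments is known when segment [k] starts, and
   serves as the weight [W]. *)
have := mle_exp_moment (f := f) (igw_kernelE run h mN') (est := est L m h)
  (W := fun w => (expR (n * prefix_err k w))%:E) (segment_rounds h mN' _).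
rewrite (segmentE H0 epochs h mN) size_iota -/n => moment; rewrite exprS EFinM.
apply: le_trans (lee_wpmul2l _ (IH (ltnW kH))); last by rewrite lee_fin.
apply: le_trans (moment _ _ _ _ _).
- rewrite le_eqVlt; apply/orP; left; apply/eqP; apply: eq_integral => w _.
  by rewrite (prefixS h) mulrDr expRD EFinM (seg_errE h mN').
- by case/andP: mN.
- by move=> i; exact: measurable_est.
- by move=> w; rewrite -(segmentE H0 epochs h mN); exact: (run_est run).
- by move=> w; rewrite lee_fin expR_ge0.
- apply/measurable_EFinP; apply: measurableT_comp => //.
  by apply: measurable_funM => //; exact: measurable_prefix (ltnW kH).
Qed.

Lemma epoch_moment :
  (\int[P]_w (expR (n * epoch_err w))%:E <= (#|I|%:R ^+ H)%:E)%E.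
Proof.
apply: le_trans (prefix_moment (leqnn H)); rewrite le_eqVlt; apply/orP; left.
apply/eqP; apply: eq_integral => w _; congr (expR (_ * _))%:E.
by apply: eq_bigl => h; rewrite ltn_ord.
Qed.

Lemma measurable_epoch_err : measurable_fun setT epoch_err.
Proof.
apply: measurable_sum => h _ B mB; rewrite setTI.
apply: (@hist_measurable _ _ _ _ _ _ _ _ Z (bound m h.+1)).
by have := measurable_seg_err (h := h) mN' measurableT mB; rewrite setTI.
Qed.

End one_epoch.

Let K0 : (0 < #|I|)%N. Proof. by apply/card_gt0P; exists star. Qed.
Let S0 : (0 < #|S|)%N. Proof. by apply/card_gt0P; exists s1. Qed.
Let A0 : (0 < #|A|)%N. Proof. by apply/card_gt0P; exists point. Qed.
Let N0 : (0 < N)%N. Proof. by case: epochs. Qed.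

Local Notation LF := (log_factor #|I| N delta).
Definition scale : R := H%:R ^+ 6 * #|S|%:R ^+ 4 * #|A|%:R ^+ 3.
(** Dominates, up to a factor 2, the product [gamma m * err m], which equals
    [sqrt (scale * err m)]. *)
Definition rate m : R := Num.sqrt (scale * LF / 2 ^+ m).

Let LF1 : 1 <= LF. Proof. exact: log_factor_ge1. Qed.
Let LF0 : 0 < LF. Proof. exact: lt_le_trans ltr01 LF1. Qed.

Lemma scale_ge1 : 1 <= scale.
Proof. by rewrite !mulr_ege1 ?exprn_ege1 ?ler1n. Qed.

Let scale0 : 0 < scale. Proof. exact: lt_le_trans ltr01 scale_ge1. Qed.

Lemma rate_ge0 m : 0 <= rate m. Proof. exact: sqrtr_ge0. Qed.

Lemma sqr_rate m : rate m ^+ 2 = scale * LF / 2 ^+ m.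
Proof. by rewrite sqr_sqrtr// !mulr_ge0 ?invr_ge0 ?exprn_ge0// ltW. Qed.

(** From [sqrt 2 <= 3 / 2]. The rate decreases more slowly than the factor 4 gained in each epoch,
    so accumulated errors stay of the order of the current rate. *)
Lemma rate_double m : rate m <= 3 / 2 * rate m.+1.
Proof.
have r0 := rate_ge0 m.+1.
rewrite -(@ler_pXn2r _ 2)// ?nnegrE ?rate_ge0//; last by lra.
rewrite exprMn !sqr_rate [2 ^+ m.+1]exprSr.
have E : scale * LF / 2 ^+ m = 2 * (scale * LF / (2 ^+ m * 2)).
  by field; rewrite expf_neq0.
have : 0 <= scale * LF / (2 ^+ m * 2).
  by rewrite divr_ge0// ?mulr_ge0 ?exprn_ge0// ltW.
by rewrite E; lra.
Qed.

Lemma err1 : err 1 = 1.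
Proof. by rewrite /err_m /mle_error/= subrr eqxx. Qed.

Lemma errS m : (0 < m < N)%N -> err m.+1 = LF / (epoch_size m)%:R.
Proof.
move=> mN; rewrite /err_m /mle_error/= epoch_sizeE// pnatr_eq0.
by rewrite gtn_eqF ?epoch_size_gt0 ?mul1r//; case/andP: mN.
Qed.

Lemma err_gt0 m : (0 < m <= N)%N -> 0 < err m.
Proof.
case: m => [//|[|m]] mN; first by rewrite err1.
by rewrite errS// divr_gt0// ltr0n epoch_size_gt0.
Qed.

Lemma err_le m : (0 < m <= N)%N -> err m <= 4 * (LF / 2 ^+ m).
Proof.
case: m => [//|[|m]] mN; first by rewrite err1 expr1; have := LF1; lra.
rewrite errS// ler_pdivrMr ?ltr0n ?epoch_size_gt0//.
have := @epoch_size_ge m.+1 isT; rewrite -(ler_nat R) natrM natrX => le.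
have p0 : (0 : R) < 2 ^+ m.+1 by rewrite exprn_gt0.
rewrite [2 ^+ m.+2]exprS (_ : 4 * _ * _ = LF * (2 * (epoch_size m.+1)%:R / 2 ^+ m.+1)).
  by rewrite ler_peMr ?(ltW LF0)// ler_pdivlMr// mul1r.
by field; rewrite gt_eqF.
Qed.

(** [err m] is computed from the length of the preceding epoch, which is no larger than that of
    epoch [m]. In epoch 1 it is 1 by convention and the trivial bound [H] suffices. *)
Lemma epoch_err_le_err m w : (0 < m < N)%N ->
  (epoch_size m)%:R * epoch_err m w <= H%:R * LF -> epoch_err m w <= H%:R * err m.
Proof.
case: m => [//|[|m]] mN; first by move=> _; rewrite err1 mulr1 epoch_err_le.
move=> le; have mN' : (0 < m.+1 < N)%N by case/andP: mN => _ /ltnW.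
rewrite errS// mulrA ler_pdivlMr ?ltr0n ?epoch_size_gt0//.
apply: le_trans le; rewrite mulrC ler_wpM2r ?epoch_err_ge0//.
by rewrite ler_nat epoch_size_le.
Qed.

Section epoch_parameters.
Variable m : nat.
Hypothesis mN : (0 < m <= N)%N.

Let H1 : 1 <= H%:R :> R. Proof. by rewrite ler1n. Qed.
Let S1 : 1 <= #|S|%:R :> R. Proof. by rewrite ler1n. Qed.
Let A1 : 1 <= #|A|%:R :> R. Proof. by rewrite ler1n. Qed.

Lemma gamma_gt0 : 0 < gamma m.
Proof. by rewrite sqrtr_gt0 divr_gt0 ?err_gt0. Qed.

Let gamma2 : gamma m ^+ 2 * err m = scale.
Proof.
by rewrite sqr_sqrtr ?divfK ?gt_eqF ?err_gt0// divr_ge0 ?ltW ?err_gt0.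
Qed.

Lemma eta_gt0 : 0 < eta m.
Proof. by apply: eta_param_gt0; rewrite ?gamma_gt0 ?expR1_bounds. Qed.

Lemma zeta_gt0 : 0 < zeta m.
Proof. by apply: zeta_param_gt0; rewrite ?gamma_gt0 ?expR1_bounds. Qed.

Lemma eta_zeta_le :
  H%:R ^+ 2 * (#|S| * (#|S| * #|A|))%:R * (eta m / zeta m) <= 32^-1.
Proof.
by rewrite !natrM; apply: eta_zeta_param; rewrite ?gamma_gt0 ?expR1_bounds.
Qed.

Lemma gamma_err_le : gamma m * err m <= 2 * rate m.
Proof.
have g0 := gamma_gt0; have e0 := err_gt0 mN.
have ge0 : 0 <= gamma m * err m by rewrite mulr_ge0 ?ltW.
rewrite -(@ler_pXn2r _ 2)// ?nnegrE ?mulr_ge0 ?rate_ge0//.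
rewrite !exprMn sqr_rate [err m ^+ 2]expr2 mulrA gamma2.
have := ler_wpM2l (ltW scale0) (err_le mN).
by rewrite -[scale * LF / _]mulrA; lra.
Qed.

Lemma coef_le : (1536 * H%:R ^+ 3 * eta m + 256 * H%:R ^+ 2 * zeta m) *
  (H%:R * err m) <= 34 * rate m.
Proof.
have := gamma_err_le; have := coef_param H1 S1 A1 (@expR1_bounds R) gamma_gt0 (err_gt0 mN).
rewrite /eta_m /zeta_m; lra.
Qed.

Lemma offset_le : (#|S| * #|A|)%:R / (4 * eta m) <= 23040 * rate m.
Proof.
have := gamma_err_le.
have := step_param H1 S1 A1 (@expR1_bounds R) gamma_gt0 (err_gt0 mN) gamma2.
rewrite natrM /eta_m; lra.
Qed.

End epoch_parameters.

(** The error [z_m] of the comparison of regrets, as a function of the context; it starts at [H],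
    which no regret exceeds. *)
Fixpoint cum_error m w c : R :=
  if m is m'.+1 then
    next_error f star s1 c (eta m) (zeta m) (fun h => est L m h w)
      (fun h => policies L m h w c) (fun h => weight m h w c) (cum_error m' w c)
  else H%:R.

Lemma cum_errorS m w c : cum_error m.+1 w c = cum_error m w c / 4 +
  (1536 * H%:R ^+ 3 * eta m.+1 + 256 * H%:R ^+ 2 * zeta m.+1) *
    \sum_h seg_gap m.+1 h w c + (#|S| * #|A|)%:R / (4 * eta m.+1).
Proof. by []. Qed.

Let coef_ge0 m : (0 < m <= N)%N ->
  0 <= 1536 * H%:R ^+ 3 * eta m + 256 * H%:R ^+ 2 * zeta m.
Proof.
move=> mN; have e := eta_gt0 mN; have z := zeta_gt0 mN.
have := mulr_ge0 (exprn_ge0 3 (ler0n R H)) (ltW e).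
have := mulr_ge0 (exprn_ge0 2 (ler0n R H)) (ltW z); lra.
Qed.

Let offset_ge0 m : (0 < m <= N)%N -> 0 <= (#|S| * #|A|)%:R / (4 * eta m).
Proof. by move=> mN; rewrite divr_ge0// mulr_ge0// ltW ?eta_gt0. Qed.

Lemma cum_error_ge0 m w c : (m <= N)%N -> 0 <= cum_error m w c.
Proof.
elim: m => [_|m IH mN]; first exact: ler0n.
rewrite cum_errorS; apply: addr_ge0; last exact: offset_ge0.
apply: addr_ge0; first by apply: divr_ge0 => //; apply: IH; exact: ltnW.
apply: mulr_ge0; first exact: coef_ge0.
by apply: sumr_ge0 => h _; exact: seg_gap_ge0.
Qed.

Lemma size_policies m h w c : (size (policies L m h w c) <= (#|S| * #|A|).+1)%N.
Proof.
rewrite (leq_trans (size_undup _))//= size_map.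
by rewrite -cardE card_prod.
Qed.

Lemma explorer_in m h w c s a : explorer L m h s a w c \in policies L m h w c.
Proof.
rewrite mem_undup inE; apply/orP; right; apply/mapP.
by exists (s, a); rewrite ?mem_enum.
Qed.

(** The bound on estimated regrets feeds the induction; the bound on true regrets is the one used
    for the sampled policies. *)
Lemma regret_invariant m w c : (m < N)%N ->
  (forall p, regret s1 (Ms star) p c <= 2 * regret s1 (Mhat m w) p c + cum_error m w c) /\
  (forall p, regret s1 (Mhat m w) p c <= 2 * regret s1 (Ms star) p c + cum_error m w c).
Proof.
elim: m => [_|m IH mN].
  by split=> p; have := regret_le s1 (Ms star) p c; have := regret_ge0 s1 (Ms star) p c;
    have := regret_le s1 (Mhat 0 w) p c; have := regret_ge0 s1 (Mhat 0 w) p c;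
    rewrite /cum_error; lra.
have mN' : (0 < m.+1 <= N)%N by exact: ltnW.
have [_ prev] := IH (ltnW mN).
apply: (regret_step f (eta_gt0 mN') (zeta_gt0 mN') H0 _ _ (eta_zeta_le mN') _ prev).
- by move=> h p; exact: (igw_weight_ge0 run h mN' w c p).
- move=> h s a p.
  exact: (explorer_ratio_le (eta_gt0 mN') (run_lam run h w c mN')
    (size_policies m.+1 h w c) p (explorer_in m.+1 h w c s a)
    (run_explorer run h s a w c mN')).
- by rewrite cum_error_ge0// ltnW// ltnW.
Qed.

Lemma measurable_cum_error m w : (m <= N)%N -> measurable_fun setT (cum_error m w).
Proof.
elim: m => [_|m IH mN]; first exact: measurable_cst.
rewrite (_ : cum_error _ _ = fun c => cum_error m w c / 4 +
  (1536 * H%:R ^+ 3 * eta m.+1 + 256 * H%:R ^+ 2 * zeta m.+1) *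
    \sum_h seg_gap m.+1 h w c + (#|S| * #|A|)%:R / (4 * eta m.+1)) //.
apply: measurable_funD => //; apply: measurable_funD.
  by apply: measurable_funM => //; exact: IH (ltnW mN).
apply: measurable_funM => //; apply: measurable_sum => h.
exact: measurable_seg_gap.
Qed.

Definition accurate w m := (epoch_size m)%:R * epoch_err m w <= H%:R * LF.

(* Products such as 200 * 300 are not evaluated, since numerals are unary and large
   ones slow to unify. *)
Lemma integral_cum_error m w : (m < N)%N ->
  (forall k, (0 < k <= m)%N -> accurate w k) ->
  (\int[D]_c (cum_error m w c)%:E <= (200 * 300 * rate m)%:E)%E.
Proof.
elim: m => [_ _|m IH mN acc].
  rewrite (integral_probability_cst D (H%:R)) lee_fin.
  (* The factor [H ^+ 6] of [scale] makes the rate at 0 exceed the initial error [H]. *)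
  have : H%:R <= rate 0.
    rewrite -(@ler_pXn2r _ 2)// ?nnegrE ?rate_ge0// sqr_rate expr0 divr1.
    have HR1 : 1 <= H%:R :> R by rewrite ler1n.
    have : H%:R ^+ 2 <= scale.
      rewrite /scale -mulrA (_ : 6 = 2 + 4)%N// exprD -mulrA ler_peMr ?exprn_ge0//.
      by rewrite !mulr_ege1 ?exprn_ege1 ?ler1n.
    by move=> le; apply: (le_trans le); rewrite ler_peMr// ltW.
  by have := rate_ge0 0; lra.
have mN' : (0 < m.+1 <= N)%N by exact: ltnW.
have c0 := coef_ge0 mN'; have o0 := offset_ge0 mN'.
have gap0 c : 0 <= \sum_h seg_gap m.+1 h w c.
  by apply: sumr_ge0 => h _; exact: seg_gap_ge0.
have mgap : measurable_fun setT (fun c => \sum_h seg_gap m.+1 h w c).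
  by apply: measurable_sum => h; exact: measurable_seg_gap.
have z0 c : 0 <= cum_error m w c by rewrite cum_error_ge0// ltnW// ltnW.
have mz : measurable_fun setT (cum_error m w) by apply: measurable_cum_error; rewrite ltnW// ltnW.
set k := 1536 * H%:R ^+ 3 * eta m.+1 + 256 * H%:R ^+ 2 * zeta m.+1 in c0.
set o := (#|S| * #|A|)%:R / (4 * eta m.+1) in o0.
have -> : (\int[D]_c (cum_error m.+1 w c)%:E =
    4^-1%:E * \int[D]_c (cum_error m w c)%:E + (k * epoch_err m.+1 w)%:E + o%:E)%E.
  under eq_integral do rewrite cum_errorS -/k -/o !EFinD.
  rewrite ge0_integralD//; last 2 first.
  - move=> c _; rewrite -EFinD lee_fin addr_ge0// ?divr_ge0//.
    by rewrite mulr_ge0.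
  - apply: emeasurable_funD; apply/measurable_EFinP.
      exact: measurable_funM.
    exact: measurable_funM.
  rewrite integral_probability_cst; congr (_ + _)%E.
  rewrite ge0_integralD//; last 4 first.
  - by move=> c _; rewrite lee_fin divr_ge0.
  - by apply/measurable_EFinP; exact: measurable_funM.
  - by move=> c _; rewrite lee_fin mulr_ge0.
  - by apply/measurable_EFinP; exact: measurable_funM.
  congr (_ + _)%E.
    under eq_integral do rewrite mulrC EFinM.
    rewrite ge0_integralZl//; first exact/measurable_EFinP.
    by move=> c _; rewrite lee_fin.
  under eq_integral do rewrite EFinM.
  rewrite ge0_integralZl//; [|exact/measurable_EFinP|by move=> c _; rewrite lee_fin].
  rewrite EFinM; congr (_ * _)%E.
  under eq_integral do rewrite -sumEFin.
  rewrite ge0_integral_sum//; last 2 first.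
  - by move=> h; apply/measurable_EFinP; exact: measurable_seg_gap.
  - by move=> h c _; rewrite lee_fin seg_gap_ge0.
  by rewrite -sumEFin; apply: eq_bigr => h _; rewrite integral_seg_gap.
have Eprev : (\int[D]_c (cum_error m w c)%:E <= (200 * 300 * rate m)%:E)%E.
  by apply: IH; [exact: ltnW|move=> j /andP[j0 jm]; apply: acc; rewrite j0 leqW].
apply: (@le_trans _ _ (4^-1%:E * (200 * 300 * rate m)%:E +
    (k * epoch_err m.+1 w)%:E + o%:E)%E).
  by rewrite leeD2r// leeD2r// lee_wpmul2l.
rewrite -EFinM -!EFinD lee_fin.
(* The constant reproduces itself: a quarter of it times [3 / 2], plus 34 and 23040, is below
   60000. *)
have e := @epoch_err_le_err m.+1 w mN (acc m.+1 (leqnn _)).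
have := ler_wpM2l c0 e; have := coef_le mN'; have := offset_le mN'.
have := rate_double m; have := rate_ge0 m.+1; rewrite -/k -/o; lra.
Qed.

Lemma mean_regret_le m (h : 'I_H) w (mN : (0 < m <= N)%N) :
  (forall k, (0 < k < m)%N -> accurate w k) ->
  (\int[D]_c \int[igw_kernel run h mN (w, c)]_q (regret s1 (Ms star) q c)%:E <=
   (500 * 1000 * rate m)%:E)%E.
Proof.
move=> acc; have [m0 mleN] := andP mN.
have m1N : (m.-1 < N)%N by rewrite prednK.
set o := (#|S| * #|A|)%:R / (4 * eta m).
have o0 : 0 <= o by exact: offset_ge0.
pose g (z : policy * X) := regret s1 (Ms star) z.1 z.2.
have mg : measurable_fun setT g by exact: measurable_regret.
have g0M z : 0 <= g z <= H%:R by rewrite regret_ge0 regret_le.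
have inner c : (\int[igw_kernel run h mN (w, c)]_q (regret s1 (Ms star) q c)%:E =
    (\sum_(p <- policies L m h w c) weight m h w c p * regret s1 (Ms star) p c)%:E)%E.
  apply: integral_igw_kernel => [|p]; last exact: regret_ge0.
  exact: measurable_fun_pair1 mg.
have inner_le c : \sum_(p <- policies L m h w c) weight m h w c p *
    regret s1 (Ms star) p c <= 16 * o + cum_error m.-1 w c.
  have [star_le _] := regret_invariant w c m1N.
  apply: (@le_trans _ _ (\sum_(p <- policies L m h w c) (weight m h w c p *
      (2 * regret s1 (Mhat m.-1 w) p c + cum_error m.-1 w c)))).
    by apply: ler_sum => p _; rewrite ler_wpM2l ?star_le// (igw_weight_ge0 run h mN).
  under eq_bigr do rewrite mulrDr mulrCA.
  rewrite big_split/= -mulr_sumr -mulr_suml.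
  have [_ ->] := run_lam run h w c mN; rewrite mul1r lerD2r.
  have := igw_regret_le (eta_gt0 mN) (run_lam run h w c mN) (size_policies m h w c).
  have -> : 2 * (#|S| * #|A|)%:R / eta m = 8 * o.
    by rewrite /o; field; rewrite gt_eqF// eta_gt0.
  lra.
have mz := measurable_cum_error w (ltnW m1N).
have z0 c : 0 <= cum_error m.-1 w c by rewrite cum_error_ge0// ltnW.
apply: (@le_trans _ _ (\int[D]_c ((16 * o)%:E + (cum_error m.-1 w c)%:E))%E).
  apply: ge0_le_integral => //.
  - by move=> c _; apply: integral_ge0 => q _; rewrite lee_fin regret_ge0.
  - exact: measurable_fun_pair2 (measurable_kernel_mean (igw_kernel run h mN) mg g0M).
  - by apply: emeasurable_funD => //; exact/measurable_EFinP.
  - by move=> c _; rewrite inner -EFinD lee_fin.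
rewrite ge0_integralD//; last 3 first.
- by move=> c _; rewrite lee_fin; lra.
- by move=> c _; rewrite lee_fin.
- exact/measurable_EFinP.
rewrite integral_probability_cst.
have Ez : (\int[D]_c (cum_error m.-1 w c)%:E <= (200 * 300 * rate m.-1)%:E)%E.
  apply: integral_cum_error => // k /andP[k0 km].
  by apply: acc; rewrite k0 -(prednK m0) ltnS.
apply: le_trans (leeD2l _ Ez) _; rewrite -EFinD lee_fin.
(* The constants are [16 * 23040] for the sampling and [3 / 2 * 60000] for the accumulated error,
   below 500000 together. *)
have := offset_le mN; rewrite -/o.
by have := rate_double m.-1; rewrite prednK//; have := rate_ge0 m; lra.
Qed.

(** A single Markov inequality for this sum replaces a union bound over the epochs. The last epoch
    is left out, since no later policy uses its estimate. *)
Definition confidence w : R :=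
  \sum_(m < N) (if (0 < m)%N then expR ((epoch_size m)%:R * epoch_err m w) else 0).

Lemma confidence_accurate w k : confidence w <= expR (H%:R * LF) ->
  (0 < k < N)%N -> accurate w k.
Proof.
move=> le /andP[k0 kN]; rewrite /accurate -ler_expR; apply: le_trans le.
rewrite /confidence (bigD1 (Ordinal kN))//= k0 lerDl.
by apply: sumr_ge0 => m _; case: ifP => // _; exact: expR_ge0.
Qed.

Let measurable_term (m : 'I_N) : measurable_fun setT (fun w =>
  if (0 < m)%N then expR ((epoch_size m)%:R * epoch_err m w) else 0).
Proof.
case: (boolP (0 < m)%N) => m0; last exact: measurable_cst.
apply: measurableT_comp => //; apply: measurable_funM => //.
by apply: measurable_epoch_err; rewrite m0 ltn_ord.
Qed.

Lemma measurable_confidence : measurable_fun setT confidence.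
Proof. exact: measurable_sum. Qed.

Lemma confidence_probability :
  ((1 - delta)%:E <= P [set w | (confidence w <= expR (H%:R * LF))%R])%E.
Proof.
apply: probability_le_moment.
- exact: expR_gt0.
- exact: measurable_confidence.
- by move=> w; apply: sumr_ge0 => m _; case: ifP => // _; exact: expR_ge0.
under eq_integral do rewrite /confidence -sumEFin.
rewrite ge0_integral_sum//; last 2 first.
- by move=> m; exact/measurable_EFinP.
- by move=> m w _; rewrite lee_fin; case: ifP => // _; exact: expR_ge0.
apply: (@le_trans _ _ (\sum_(m < N) (#|I|%:R ^+ H)%:E)%E).
  apply: lee_sum => m _; case: (boolP (0 < m)%N) => m0.
    by apply: epoch_moment; rewrite m0 ltn_ord.
  by rewrite integral0 lee_fin exprn_ge0.
rewrite sumEFin lee_fin sumr_const card_ord.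
have [d0 d1] := andP delta01.
have N1 : 1 <= N%:R :> R by rewrite ler1n.
have KR : 0 < #|I|%:R :> R by rewrite ltr0n.
rewrite [H%:R * _]mulrC expRM_natr /log_factor lnK ?posrE ?log_arg_gt0// log_argE//.
set r := 2 * N%:R ^+ 2 / delta.
have dr : delta * r = 2 * N%:R ^+ 2 by rewrite /r; field; rewrite gt_eqF.
have r1 : 1 <= r by rewrite /r ler_pdivlMr//; nra.
have -> : 2 * N%:R ^+ 2 * (#|I|%:R / delta) = #|I|%:R * r by rewrite /r; ring.
(* The factor [#|I| ^ H] cancels, and of [r ^ H] a single [r] is enough: [delta * r = 2 N ^ 2]
   exceeds the number of epochs. *)
rewrite exprMn mulrCA -[_ *+ N]mulr_natr ler_pM2l ?exprn_gt0//.
apply: (@le_trans _ _ (delta * r)); first by rewrite dr; nra.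
by rewrite ler_pM2l// -[leLHS]expr1 ler_weXn2l.
Qed.

Lemma round_regret_ae t (Y : Omega -> R) m (h : 'I_H) (mN : (0 < m <= N)%N) :
  t \in segment R T H N m h ->
  is_cond_exp P (hist Z t.-1%:R)
    (fun w => regret s1 (Ms star) (pol Z t w) (ctx Z t w)) Y ->
  {ae P, forall w, (forall k, (0 < k < N)%N -> accurate w k) ->
    Y w <= 500 * 1000 * rate m}.
Proof.
move=> tseg YE; pose g (z : policy * X) := regret s1 (Ms star) z.1 z.2.
have mg : measurable_fun setT g by exact: measurable_regret.
have g0M z : 0 <= g z <= H%:R by rewrite regret_ge0 regret_le.
(* In the last epoch the boundary may be fractional, but the rounds up to it are integers below [t],
   hence at most [t - 1]. *)
have bt : <<s hist Z (bound m h) >> `<=` <<s hist Z t.-1%:R >>.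
  apply: g_sigma_algebra_mono => B [u [u0 ub] Bu]; exists u => //; split => //.
  move: tseg; rewrite mem_segment => /and3P[/andP[t0 _] lt _].
  by rewrite ler_nat -ltnS prednK// -(ltr_nat R) (le_lt_trans ub).
have := cond_exp_le_mean f bt (igw_kernelE run h mN) (run_round run mN tseg) mg g0M YE.
apply: filterS => w le acc; rewrite -lee_fin; apply: (le_trans le).
apply: mean_regret_le => k /andP[k0 km]; apply: acc; rewrite k0 (leq_trans km)//.
by have [] := andP mN.
Qed.

(** Each of the [H] segments of an epoch uses its own rounds, so [t] may reach [2 ^ m * H]; this
    brings the seventh factor [H]. *)
Lemma rate_le t m (h : 'I_H) : (0 < m <= N)%N -> t \in segment R T H N m h ->
  rate m <= Num.sqrt (scale * LF * H%:R) * (Num.sqrt t%:R)^-1.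
Proof.
move=> mN tseg; have tp := segment_le_pow epochs mN tseg.
have t0 : 0 < t%:R :> R.
  by rewrite ltr0n; move: tseg; rewrite mem_segment => /andP[/andP[]].
have p0 : (0 : R) < 2 ^+ m by rewrite exprn_gt0.
have sl : 0 < scale * LF by rewrite mulr_gt0.
have sl0 := ltW sl.
rewrite -sqrtrV// -sqrtrM; last by rewrite mulr_ge0.
rewrite ler_wsqrtr// -[_ * H%:R / _]mulrA ler_pM2l// ler_pdivlMr// mulrC ler_pdivrMr//.
by rewrite mulrC.
Qed.

Lemma total_regret_ae (Y : nat -> Omega -> R) :
  (forall t, (0 < t <= T)%N -> is_cond_exp P (hist Z t.-1%:R)
    (fun w => regret s1 (Ms star) (pol Z t w) (ctx Z t w)) (Y t)) ->
  {ae P, forall w, (forall k, (0 < k < N)%N -> accurate w k) ->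
    \sum_(1 <= t < T.+1) Y t w <=
    500 * 1000 * 2 * Num.sqrt (scale * LF * H%:R * T%:R)}.
Proof.
move=> YE; have c0 : (0 : R) <= 500 * 1000 by apply: mulr_ge0; exact: ler0n.
have : {ae P, forall w, forall t, (0 < t <= T)%N ->
    (forall k, (0 < k < N)%N -> accurate w k) ->
    Y t w <= 500 * 1000 * (Num.sqrt (scale * LF * H%:R) * (Num.sqrt t%:R)^-1)}.
  apply: ae_foralln => t; case: (boolP (0 < t <= T)%N) => [tT|_]; last exact: aeW.
  have [m [h [mN tseg]]] := exists_segment H0 epochs tT.
  have := round_regret_ae mN tseg (YE t tT).
  apply: filterS => w le _ acc; apply: (le_trans (le acc)).
  exact: (ler_wpM2l c0 (rate_le mN tseg)).
apply: filterS => w le acc.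
apply: (@le_trans _ _ (\sum_(1 <= t < T.+1)
    500 * 1000 * (Num.sqrt (scale * LF * H%:R) * (Num.sqrt t%:R)^-1))).
  rewrite !big_nat; apply: ler_sum => t /andP[t0 tT]; apply: le => //.
  by rewrite t0.
rewrite -mulr_sumr -mulr_sumr -[500 * 1000 * 2 * _]mulrA.
apply: (ler_wpM2l c0).
rewrite [Num.sqrt (_ * T%:R)]sqrtrM; last by rewrite !mulr_ge0 ?(ltW scale0) ?(ltW LF0).
by rewrite mulrCA ler_wpM2l// sum_inv_sqrt_le.
Qed.

End run_analysis.

Theorem theorem4p2 (R : realType) :
  exists C0 : R, 0 < C0 /\ mle_is_oracle C0 /\
  exists C C' : R, 0 < C /\ 0 < C' /\
  forall (d dO : measure_display) (X : measurableType d) (S A : pfinType)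
    (H : nat) (s1 : S) (D : probability X R)
    (I : finType) (Ms : I -> model R X S A H) (star : I) (f : densities Ms)
    (delta : R) (T N : nat) (Omega : measurableType dO)
    (P : probability Omega R) (Z : process R X S A H Omega)
    (L : choices R X S A H Omega I) (Y : nat -> Omega -> R),
    (0 < H)%N ->
    0 < delta < 2^-1 ->
    1 <= ln (T%:R : R) ->
    (forall p c,
       traj_law s1 (Ms star) p c [set x | 0 <= total_reward x <= 1] = 1%E) ->
    lolipop_run C0 P D s1 star f delta T N Z L ->
    (forall t, (0 < t <= T)%N ->
       is_cond_exp P (hist Z t.-1%:R)
         (fun w => regret s1 (Ms star) (pol Z t w) (ctx Z t w)) (Y t)) ->
    ((1 - delta)%:E <= P [set w |
       (\sum_(1 <= t < T.+1) Y t w <=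
         C * Num.sqrt (H%:R ^+ 7 * #|S|%:R ^+ 4 * #|A|%:R ^+ 3 * T%:R *
                       ln (#|I|%:R * ln T%:R / delta)))%R])%E /\
    (size (oracle_calls H N))%:R <= C' * H%:R * ln (T%:R : R).
Proof.
exists 1; split; first exact: ltr01.
split; first exact: mle_is_oracle1.
have c0 : (0 : R) < 500 * 1000 * 2 by apply: mulr_gt0; [apply: mulr_gt0|]; rewrite ltr0n.
(* The factor 2 comes from the sum of [1 / sqrt t], the factor 3 pays for replacing [log_factor] by
   the logarithm of the statement, and the second witness is the constant of [epoch_count_le]. *)
exists (500 * 1000 * 2 * 3), 3; split; first by apply: mulr_gt0; rewrite ?c0 ?ltr0n.
split; first by rewrite ltr0n.
move=> d dO X S A H s1 D I Ms star f delta T N Omega P Z L Y H0 delta01 lnT _ run YE.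
have epochs := run_epochs run; have [N0 _ _] := epochs.
have N3 := epoch_count_le H0 epochs lnT.
split; last first.
  rewrite size_allpairs size_iota size_enum_ord natrM.
  by rewrite mulrAC ler_wpM2r.
have K0 : (0 < #|I|)%N by apply/card_gt0P; exists star.
have LF7 := log_factor_le K0 N0 delta01 lnT N3.
have LF1 := log_factor_ge1 K0 N0 delta01.
set lf := log_factor #|I| N delta in LF7 LF1.
set x := ln (#|I|%:R * ln T%:R / delta) in LF7 *.
set E := [set w | _].
have mY t : (0 < t <= T)%N -> measurable_fun setT (Y t).
  move=> tT; have [mYt _ _] := YE t tT.
  move=> _ B mB; rewrite setTI; apply: (@hist_measurable _ _ _ _ _ _ _ _ Z t.-1%:R).
  by have := mYt measurableT B mB; rewrite setTI.
have mE : measurable E.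
  rewrite /E -[X in measurable X]setTI.
  apply: (measurable_fun_ler (f := fun w => \sum_(1 <= t < T.+1) Y t w) _
    (measurable_cst _) measurableT (Y := [set true])) => //.
  under eq_fun do rewrite big_add1 big_mkord.
  by apply: measurable_sum => t; apply: mY; rewrite ltn_ord.
apply: (le_trans (confidence_probability H0 delta01 run)).
set F := [set w | _].
have mF : measurable F.
  rewrite /F -[X in measurable X]setTI.
  exact: (measurable_fun_ler (measurable_confidence run) (measurable_cst _)
    measurableT (Y := [set true])).
(* The confidence event lies in [E] only up to a null set, so the probabilities are compared as
   integrals of indicators. *)
rewrite -[X in (P X <= _)%E]setIT -[X in (_ <= P X)%E]setIT -!integral_indic//.
apply: ae_ge0_le_integral => //.
- by apply/measurable_EFinP; exact: measurable_indic.
- by apply/measurable_EFinP; exact: measurable_indic.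
have := total_regret_ae H0 delta01 run YE.
apply: filterS => w le _; rewrite lee_fin !indicE ler_nat.
case: (boolP (w \in F)) => //; rewrite in_setE => Fw.
rewrite mem_set//; apply: le_trans (le _) _.
  by move=> k kN; exact: confidence_accurate kN.
rewrite -/lf -[500 * 1000 * 2 * 3 * _]mulrA.
apply: (ler_wpM2l (ltW c0)).
have sq0 : (0 : R) <= 9 by [].
(* Under the root the factor becomes 9, which covers the 7 of [log_factor_le]. *)
have -> : (3 : R) = Num.sqrt (3 ^+ 2) by rewrite sqrtr_sqr ger0_norm.
rewrite -sqrtrM ?exprn_ge0// ler_wsqrtr//.
set q := H%:R ^+ 6 * #|S|%:R ^+ 4 * #|A|%:R ^+ 3 * H%:R * T%:R : R.
have q0 : 0 <= q by rewrite !mulr_ge0 ?exprn_ge0.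
rewrite /scale (_ : _ * _ * _ * lf * H%:R * T%:R = q * lf); last by rewrite /q; ring.
have -> : 3 ^+ 2 * (H%:R ^+ 7 * #|S|%:R ^+ 4 * #|A|%:R ^+ 3 * T%:R * x) = q * (9 * x).
  by rewrite /q; ring.
by rewrite ler_wpM2l//; lra.
Qed.
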